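(* Let $A,g,b$ and the parameters $p,q,\alpha,\beta,\mu,\mu_1$ satisfy the structure conditions $(H_1)$ and $(H_2)$ of the context, and suppose in addition that $p-1<\beta$, $\mu_1>0$ and $$N-d>\max\left\{\frac{pq}{q-p+1},\ \frac{p^2}{p-1}\right\}.$$ Let $u\in W^{1,p}_{\mathrm{loc}}(\bar\Omega\setminus\Gamma)\cap L^\infty_{\mathrm{loc}}(\bar\Omega\setminus\Gamma)$ be a weak solution in $\bar\Omega\setminus\Gamma$ of $$-\operatorname{div}\left[(1+|x|)^{-\alpha}A(\nabla u)\right]+(1+|x|)^{-\alpha}g(u)=0\ \text{ in }\Omega,\qquad (1+|x|)^{-\alpha}A(\nabla u)\cdot\nu+(1+|x|)^{-\beta}b(u)=0\ \text{ on }\partial\Omega,$$ and suppose that $u$ satisfies assumption $(A_1)$ of the context. Then the singularity of $u$ at $\Gamma$ is removable.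
   Context: Setting. $N\ge 3$, $d\in\{1,\dots,N-2\}$, $R\in(0,\infty]$, $B_R^+=\{(x_{d+1},\dots,x_N)\in\mathbb{R}^{N-1-d}\times\mathbb{R}^+: |(x_{d+1},\dots,x_N)|<R\}$, $\Omega=\mathbb{R}^d\times B_R^+$, $\Gamma=\{x\in\mathbb{R}^N: x_{d+1}=\cdots=x_N=0\}$. When $d=0$, one writes $\Omega=B_R^+$ and $\Gamma=\{x\in\mathbb{R}^N: x=0\}$. Write $x'=(x_{d+1},\dots,x_N)$, $x''=(x_1,\dots,x_d)$. Put $\vartheta_\alpha(x)=(1+|x|)^{-\alpha}$; in integrals over $\Omega$, $d\vartheta_\alpha=(1+|x|)^{-\alpha}dx$, and in integrals over $\partial\Omega$, $d\vartheta_\beta=(1+|x|)^{-\beta}dS$ with $dS$ surface measure; $\nu$ is the outward unit normal; boundary values are in the sense of traces. Structure conditions. $A:\mathbb{R}^N\to\mathbb{R}^N$, $g,b:\mathbb{R}\to\mathbb{R}$ are measurable, with $g,b$ locally bounded. $(H_1)$: $A(\eta)\cdot\eta\ge\mu|\eta|^p$ and $|A(\eta)|\le\mu^{-1}|\eta|^{p-1}$ for all $\eta\in\mathbb{R}^N$; $g(u)\operatorname{sign}u\ge|u|^q$ and $b(u)\operatorname{sign}u\ge\mu_1|u|^{p-1}$ for all $u\in\mathbb{R}$. $(H_2)$: $A(-\eta)=-A(\eta)$ for all $\eta\in\mathbb{R}^N$. Here $p\in(1,N)$, $\alpha,\beta\in[0,N)$, $p-1\le\beta-\alpha$, $q-p+1>0$,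 $\mu>0$, $\mu_1\ge0$. Spaces. For an open set $U$, $L^p(U;\vartheta_\alpha)$ is the set of measurable $u$ on $U$ with $\int_U|u|^p\,d\vartheta_\alpha<\infty$, and $W^{1,p}(U;\vartheta_\alpha)$ is the set of $u\in L^p(U;\vartheta_\alpha)$ with $|\nabla u|\in L^p(U;\vartheta_\alpha)$. $W^{1,p}_{\mathrm{loc}}(\bar\Omega\setminus\Gamma;\vartheta_\alpha)$ is the set of $u:\Omega\to\mathbb{R}$ with $u\in W^{1,p}(U;\vartheta_\alpha)$ for every open $U\subset\Omega$ with $\bar U\cap\Gamma=\emptyset$; $L^\infty_{\mathrm{loc}}(\bar\Omega\setminus\Gamma)$ is defined similarly. $W^{1,p}_{\mathrm{loc}}(\bar\Omega\setminus\Gamma)$ denotes the unweighted space (weight identically $1$). Weak solution. $u\in W^{1,p}_{\mathrm{loc}}(\bar\Omega\setminus\Gamma;\vartheta_\alpha)\cap L^\infty_{\mathrm{loc}}(\bar\Omega\setminus\Gamma)$ is a weak solution in $\bar\Omega\setminus\Gamma$ if $$\int_\Omega\left(\langle A(\nabla u),\nabla\varphi\rangle+g(u)\varphi\right)d\vartheta_\alpha+\int_{\partial\Omega}b(u)\varphi\,d\vartheta_\beta=0\qquad( * )$$ for all $\varphi\in W^{1,p}_{\mathrm{loc}}(\bar\Omega\setminus\Gamma;\vartheta_\alpha)\cap L^\infty_{\mathrm{loc}}(\bar\Omega\setminus\Gamma)$ with $\operatorname{supp}\varphi\subset\bar\Omega\setminus\Gamma$. Removability. The singularity of a solution $u$ at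 $\Gamma$ is removable if $u\in W^{1,p}(\Omega;\vartheta_\alpha)\cap L^\infty(\Omega)$ and $( * )$ holds for all $\varphi\in W^{1,p}(\Omega;\vartheta_\alpha)\cap L^\infty(\Omega)$. Assumption $(A_1)$, for a measurable $u:\Omega\to\mathbb{R}$. There are $\delta>d$ and $C_0>0$ such that for all $r_1,r_2\in(0,1)$ with $r_1<r_2$, $$u^\pm(x)\le C_0\,m^\pm_{r_1,r_2}(1+|x''|)^{-\delta}\quad\text{for a.e. }x\in\Omega\text{ with }r_1<|x'|<r_2,$$ where $m^\pm_{r_1,r_2}=\operatorname{ess\,sup}\{u^\pm(x): x\in\Omega,\ r_1<|x'|<r_2\}$, $u^+=\max\{u,0\}$, $u^-=-\min\{u,0\}$. *)

(* Defs.v *)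
From HB Require Import structures.
From mathcomp Require Import all_boot all_order all_algebra.
From mathcomp Require Import all_classical all_reals all_analysis ess_sup_inf.

Set Implicit Arguments.
Unset Strict Implicit.
Unset Printing Implicit Defensive.

Import Order.TTheory GRing.Theory Num.Theory.
Import numFieldNormedType.Exports.

Local Open Scope classical_set_scope.
Local Open Scope ring_scope.

Definition rV_coord (R : realType) (n : nat) (i : 'I_n) (x : 'rV[R]_n) :
  measurableTypeR R := x ord0 i.

Section measurable_rV.
Variables (R : realType) (n : nat).

Let rV_set0 : g_sigma_preimage (@rV_coord R n) set0.
Proof. exact: sigma_algebra0. Qed.

Let rV_setC A :
  g_sigma_preimage (@rV_coord R n) A -> g_sigma_preimage (@rV_coord R n) (~` A).
Proof. exact: sigma_algebraC. Qed.

Let rV_bigcup (F : _^nat) :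
  (forall i, g_sigma_preimage (@rV_coord R n) (F i)) ->
  g_sigma_preimage (@rV_coord R n) (\bigcup_i (F i)).
Proof. exact: sigma_algebra_bigcup. Qed.

(* The sigma-algebra generated by the coordinates, i.e. the Borel sets of R^n. *)
HB.instance Definition _ := @isMeasurable.Build default_measure_display
  'rV[R]_n (g_sigma_preimage (@rV_coord R n)) rV_set0 rV_setC rV_bigcup.

Lemma measurable_rV_coord (i : 'I_n) :
  measurable_fun [set: 'rV[R]_n] (rV_coord i).
Proof.
move=> _ Y mY; rewrite setTI; apply: sub_sigma_algebra => /=.
rewrite -bigcup_seq/=; exists i => /=; first by rewrite mem_index_enum.
by exists Y => //; rewrite setTI.
Qed.

Lemma measurable_fun_rV d (T : measurableType d) (f : T -> 'rV[R]_n) :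
  (forall i, measurable_fun [set: T] (rV_coord i \o f)) ->
  measurable_fun [set: T] f.
Proof.
move=> mf.
have fS : preimage_set_system setT f (g_sigma_preimage (@rV_coord R n))
    `<=` measurable.
  rewrite -g_sigma_preimage_comp.
  apply: smallest_sub; first exact: sigma_algebra_measurable.
  rewrite -bigcup_seq; apply: bigcup_sub => i _.
  by move=> A [B mB <-]; exact: mf.
by move=> _ A mA; apply: fS; exists A.
Qed.

End measurable_rV.

(* (y_1, .., y_n, t) *)
Definition snoc (R : realType) (n : nat) (y : 'rV[R]_n) (t : R) :
    'rV[R]_n.+1 :=
  \row_i if unlift ord_max i is Some j then y ord0 j else t.

Section leb_step.
Variables (R : realType) (n : nat).

Let glue (z : 'rV[R]_n * measurableTypeR R) : 'rV[R]_n.+1 := snoc z.1 z.2.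
Let cut (x : 'rV[R]_n.+1) : 'rV[R]_n * measurableTypeR R :=
  (\row_j x ord0 (lift ord_max j), x ord0 ord_max).

Let measurable_glue : measurable_fun setT glue.
Proof.
apply: measurable_fun_rV => i.
case: (unliftP ord_max i) => [j ->|->].
- rewrite (_ : _ \o _ = rV_coord j \o fst).
    exact: measurableT_comp (@measurable_rV_coord R n j) measurable_fst.
  by apply/funext => z; rewrite /rV_coord /= mxE liftK.
- rewrite (_ : _ \o _ = snd); first exact: measurable_snd.
  by apply/funext => z; rewrite /rV_coord /= mxE unlift_none.
Qed.

Let measurable_cut : measurable_fun setT cut.
Proof.
apply: measurable_fun_pair; last exact: (measurable_rV_coord ord_max).
apply: measurable_fun_rV => j.
rewrite (_ : _ \o _ = rV_coord (lift ord_max j)).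
  exact: measurable_rV_coord.
by apply/funext => x; rewrite /rV_coord /= mxE.
Qed.

Variable m : {sigma_finite_measure set 'rV[R]_n -> \bar R}.

Definition leb_succ : set 'rV[R]_n.+1 -> \bar R :=
  pushforward (m \x (@lebesgue_measure R))%E
    (fun z : 'rV[R]_n * measurableTypeR R => snoc z.1 z.2).

Let glue_preimage A : measurable A -> measurable (glue @^-1` A).
Proof. by move=> mA; rewrite -[X in measurable X]setTI; exact: measurable_glue. Qed.

Let leb_succ0 : leb_succ set0 = 0%E.
Proof. by rewrite /leb_succ /pushforward preimage_set0 measure0. Qed.

Let leb_succ_ge0 A : (0 <= leb_succ A)%E.
Proof. exact: measure_ge0. Qed.

Let leb_succ_sigma_additive : semi_sigma_additive leb_succ.
Proof.
move=> F mF tF mUF; rewrite /leb_succ /pushforward preimage_bigcup.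
apply: measure_semi_sigma_additive.
- by move=> k; exact: glue_preimage.
- apply/trivIsetP => /= i j _ _ ij; rewrite -preimage_setI.
  by move/trivIsetP : tF => /(_ _ _ _ _ ij) ->//; rewrite preimage_set0.
- by rewrite -preimage_bigcup; exact: glue_preimage.
Qed.

HB.instance Definition _ := isMeasure.Build _ _ _
  leb_succ leb_succ0 leb_succ_ge0 leb_succ_sigma_additive.

Let leb_succ_sigma_finite : sigma_finite setT leb_succ.
Proof.
have /sigma_finiteP[F [TF ndF Foo]] := sigma_finiteT m.
have /sigma_finiteP[G [TG ndG Goo]] := sigma_finiteT (@lebesgue_measure R).
have cutE z : cut (glue z) = z.
  case: z => y t; rewrite /cut /=; congr pair.
    by apply/rowP => j; rewrite !mxE liftK.
  by rewrite mxE unlift_none.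
exists (fun k => cut @^-1` (F k `*` G k)).
  rewrite predeqE => x; split=> // _.
  have [i _ Fi] : (\bigcup_i F i) (cut x).1 by rewrite -TF.
  have [j _ Gj] : (\bigcup_i G i) (cut x).2 by rewrite -TG.
  exists (maxn i j) => //; split.
  - by move: Fi; exact/subsetPset/ndF/leq_maxl.
  - by move: Gj; exact/subsetPset/ndG/leq_maxr.
move=> k; have [mF Fk] := Foo k; have [mG Gk] := Goo k; split.
  rewrite -[X in measurable X]setTI; apply: measurable_cut => //.
  exact: measurableX.
rewrite /leb_succ /pushforward -comp_preimage.
rewrite (_ : cut \o _ = id) ?preimage_id; last exact/funext/cutE.
by rewrite product_measure1E// lte_mul_pinfty// ge0_fin_numE.
Qed.

HB.instance Definition _ :=
  Measure_isSigmaFinite.Build _ _ _ leb_succ leb_succ_sigma_finite.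

End leb_step.

Fixpoint leb (R : realType) (n : nat) :
    {sigma_finite_measure set 'rV[R]_n -> \bar R} :=
  match n with
  | 0 => \d_(0 : 'rV[R]_0)
  | k.+1 => leb_succ (leb R k)
  end.

(* The ambient space R^N is 'rV[R]_n.+1. Indices start at 0, so that
   x' = (x_(d+1), .., x_N) consists of the coordinates of index i >= d and
   x'' = (x_1, .., x_d) of those of index i < d; x_N has index ord_max. *)

Section geometry.
Variables (R : realType) (n : nat).
Implicit Types x y : 'rV[R]_n.

Definition dot x y : R := \sum_i x ord0 i * y ord0 i.

(* Euclidean norms; the library norm `|x| on 'rV[R]_n is the sup norm. *)
Definition enorm x : R := Num.sqrt (\sum_i x ord0 i ^+ 2).
Definition enorm' (d : nat) x : R :=
  Num.sqrt (\sum_(i < n | (d <= i)%N) x ord0 i ^+ 2).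
Definition enorm'' (d : nat) x : R :=
  Num.sqrt (\sum_(i < n | (i < d)%N) x ord0 i ^+ 2).

Definition weight (a : R) x : R := (1 + enorm x) `^ (- a).

End geometry.

Section domain.
Variables (R : realType) (n d : nat) (rho : \bar R).
Implicit Types x : 'rV[R]_n.+1.

Definition Omega : set 'rV[R]_n.+1 :=
  [set x : 'rV[R]_n.+1 | 0 < x ord0 ord_max /\ ((enorm' d x)%:E < rho)%E].

Definition Gamma : set 'rV[R]_n.+1 :=
  [set x : 'rV[R]_n.+1 | forall i : 'I_n.+1, (d <= i)%N -> x ord0 i = 0].

Definition bdOmega : set 'rV[R]_n.+1 := closure Omega `\` Omega.

(* The integral of f over bdOmega against the surface measure: the flat part
   x_N = 0 plus, when rho = r is finite, the graph of
   h(y) = sqrt (r^2 - |y'|^2), whose area element is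
   sqrt (1 + |grad h|^2) = r / h. The edge is a null set. *)
Definition surface_integral (f : 'rV[R]_n.+1 -> \bar R) : \bar R :=
  (\int[leb R n]_(y in [set y | ((enorm' d y)%:E < rho)%E]) f (snoc y 0%R) +
   if rho is r%:E then
     \int[leb R n]_(y in [set y | (enorm' d y < r)%R])
       (f (snoc y (Num.sqrt (r ^+ 2 - enorm' d y ^+ 2))) *
        (r / Num.sqrt (r ^+ 2 - enorm' d y ^+ 2))%:E)
   else 0)%E.

End domain.

Section sobolev.
Variables (R : realType) (n : nat).
Local Notation E := 'rV[R]_n.
Implicit Types (f u w : E -> R) (G : E -> E) (U : set E).

Definition partial (i : 'I_n) f (x : E) : R := 'D_(delta_mx ord0 i) f x.
Definition grad f (x : E) : E := \row_i partial i f x.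

Fixpoint Ck (k : nat) f : Prop :=
  match k with
  | 0 => continuous f
  | l.+1 => (forall x, differentiable f x) /\ forall i, Ck l (partial i f)
  end.

Definition smooth f : Prop := forall k, Ck k f.

Definition test_function U f : Prop :=
  [/\ smooth f, compact (closure [set x | f x != 0]) &
      closure [set x | f x != 0] `<=` U].

Definition loc_integrable U f : Prop :=
  measurable_fun U f /\
  forall K, K `<=` U -> compact K -> (\int[leb R n]_(x in K) `|f x|%:E < +oo)%E.

Definition weak_grad U u G : Prop :=
  [/\ loc_integrable U u, forall i, loc_integrable U (fun x => G x ord0 i) &
      forall f i, test_function U f ->
        (\int[leb R n]_(x in U) (u x * partial i f x)%:E =
         - \int[leb R n]_(x in U) (G x ord0 i * f x)%:E)%E].

Definition Lp (p : R) w U f : Prop :=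
  measurable_fun U f /\
  (\int[leb R n]_(x in U) (`|f x| `^ p * w x)%:E < +oo)%E.

Definition Linfty U f : Prop :=
  measurable_fun U f /\
  exists M : R, \forall x \ae leb R n, U x -> `|f x| <= M.

Definition W1p (p : R) w U u : Prop :=
  Lp p w U u /\
  exists G, weak_grad U u G /\ Lp p w U (fun x => enorm (G x)).

(* The complement of the largest open set on which f = 0 a.e. in U. *)
Definition ess_supp U f : set E :=
  [set x | forall V : set E, open V -> V x ->
     ~ (\forall y \ae leb R n, U y -> V y -> f y = 0)].

End sobolev.

Section problem.
Variables (R : realType) (n d : nat) (rho : \bar R).
Local Notation E := 'rV[R]_n.+1.
Local Notation Om := (@Omega R n d rho).
Local Notation Ga := (@Gamma R n d).
Local Notation mu := (leb R n.+1).
Implicit Types (u phi w T S : E -> R) (G H : E -> E).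

Definition off_Gamma (U : set E) : Prop := closure U `&` Ga = set0.

Definition W1p_loc (p : R) w u : Prop :=
  forall U : set E, open U -> U `<=` Om -> off_Gamma U -> W1p p w U u.

Definition Linfty_loc u : Prop :=
  forall U : set E, open U -> U `<=` Om -> off_Gamma U -> Linfty U u.

(* T is the trace of u on the boundary, where G is the weak gradient of u: on
   bounded open sets whose closure misses Gamma, u is the W^{1,p} limit of
   functions of class C^1 up to the boundary whose boundary values converge to T
   in L^p. The weights are bounded above and below on such sets. The values of T
   on Gamma are irrelevant, since Gamma has surface measure zero. *)
Definition is_trace (p : R) u G T : Prop :=
  measurable_fun (@bdOmega R n d rho) T /\
  forall V : set E, open V -> bounded_set V -> off_Gamma V ->
    exists v : nat -> E -> R,
      [/\ forall k, Ck 1 (v k),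
          (fun k => \int[mu]_(x in Om `&` V)
             (`|v k x - u x| `^ p + enorm (grad (v k) x - G x) `^ p)%:E)%E
            @ \oo --> 0%E &
          (fun k => surface_integral d rho
             (fun x => (`|v k x - T x| `^ p * \1_V x)%:E)) @ \oo --> 0%E].

(* G and T (H and S) are the weak gradient and trace of u (phi). Since the
   equation is in \bar R, where +oo + -oo = -oo, it forces both integrals to be
   finite. *)
Definition weak_identity (alpha beta : R) (A : E -> E) (g b : R -> R)
    u G T phi H S : Prop :=
  (\int[mu]_(x in Om)
     ((dot (A (G x)) (H x) + g (u x) * phi x) * weight alpha x)%:E +
   surface_integral d rho
     (fun x => (b (T x) * S x * weight beta x)%:E) = 0)%E.

(* By the trace theorem G, T, H and S exist, and they are unique a.e., so their
   existential or universal quantification makes no difference. *)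
Definition weak_identity_for (p alpha beta : R) (A : E -> E) (g b : R -> R) u
    (test : set (E -> R)) : Prop :=
  exists G T, [/\ weak_grad Om u G, is_trace p u G T &
    forall phi H S, test phi -> weak_grad Om phi H -> is_trace p phi H S ->
      weak_identity alpha beta A g b u G T phi H S].

Definition weak_solution (p alpha beta : R) (A : E -> E) (g b : R -> R) u :
    Prop :=
  [/\ W1p_loc p (weight alpha) u, Linfty_loc u &
      weak_identity_for p alpha beta A g b u
        [set phi | [/\ W1p_loc p (weight alpha) phi, Linfty_loc phi &
                       ess_supp Om phi `<=` closure Om `\` Ga]]].

Definition removable (p alpha beta : R) (A : E -> E) (g b : R -> R) u : Prop :=
  [/\ W1p p (weight alpha) Om u, Linfty Om u &
      weak_identity_for p alpha beta A g b u
        [set phi | W1p p (weight alpha) Om phi /\ Linfty Om phi]].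

Definition shell (r1 r2 : R) : set E :=
  [set x | Om x /\ r1 < enorm' d x < r2].

(* Applied to f >= 0 only, so extending f by 0 outside the shell is harmless. *)
Definition shell_sup (f : E -> R) (r1 r2 : R) : \bar R :=
  ess_sup mu ((EFin \o f) \_ (shell r1 r2)).

Definition shell_decay (delta C0 : R) (f : E -> R) (r1 r2 : R) : Prop :=
  \forall x \ae mu, shell r1 r2 x ->
    ((f x)%:E <=
     C0%:E * shell_sup f r1 r2 * ((1 + enorm'' d x) `^ (- delta))%:E)%E.

Definition assumption_A1 u : Prop :=
  exists delta C0 : R, [/\ d%:R < delta, 0 < C0 &
    forall r1 r2 : R, 0 < r1 -> r1 < r2 -> r2 < 1 ->
      shell_decay delta C0 u^\+ r1 r2 /\ shell_decay delta C0 u^\- r1 r2].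

End problem.

Definition locally_bounded (R : realType) (f : R -> R) : Prop :=
  forall t : R, exists M : R, \forall s \near t, `|f s| <= M.

Definition condition_H1 (R : realType) (n : nat) (p q mu mu1 : R)
    (A : 'rV[R]_n -> 'rV[R]_n) (g b : R -> R) : Prop :=
  (forall eta, mu * enorm eta `^ p <= dot (A eta) eta /\
               enorm (A eta) <= mu^-1 * enorm eta `^ (p - 1)) /\
  (forall t, `|t| `^ q <= g t * Num.sg t /\
             mu1 * `|t| `^ (p - 1) <= b t * Num.sg t).

Definition condition_H2 (R : realType) (n : nat)
    (A : 'rV[R]_n -> 'rV[R]_n) : Prop :=
  forall eta, A (- eta) = - A eta.

(* Main.v *)
From HB Require Import structures.
Require Import Defs.
From mathcomp Require Import all_boot all_order all_algebra.
From mathcomp Require Import all_classical all_reals all_analysis.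
From mathcomp Require Import measurable_realfun.
From mathcomp Require Import ring lra.
Import Order.TTheory GRing.Theory Num.Theory.
Import numFieldNormedType.Exports.
Local Open Scope classical_set_scope.
Local Open Scope ring_scope.
Set Implicit Arguments.
Unset Strict Implicit.
Unset Printing Implicit Defensive.

(** Under the dimension condition the solution vanishes identically, and so do
    g(0) and b(0); the identity that removability asks for is then 0 = 0.

    Let h(t) = t (1 + t^2)^(-a). It is odd, it has a derivative in ]0, 1], and it
    grows like |t|^kappa with kappa = 1 - 2a in ]0, 1[. Test the equation with
    h(u) zeta^s, where zeta is a C^1 cutoff that vanishes near Gamma and near
    infinity. The boundary term has the sign of b(u) h(u) >= 0. By the coercivity
    of A, the growth of g and a Young type inequality ([key_inequality]),
      int (h'(u) |grad u|^p + |u|^q |h(u)|) zeta^s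
        <= C int |grad eta|^P + C int |u|^p |grad chi|^p
    for zeta = eta chi, where P = p (q + kappa) / (q - p + 1). The power |u|^q
    absorbs u completely in the first term, so that no bound of u near Gamma
    enters. The second factor chi cuts off at distance k from the origin; away
    from Gamma the function |u|^p is integrable, so the second term disappears as
    k -> oo ([energy_estimate]).

    As kappa tends to 0, P decreases to pq / (q - p + 1), which is smaller than
    the codimension N - d of Gamma; hence P < N - d for some kappa
    ([exists_exponent]). The factor eta makes its transition where
    |x'|^2 is of the order of 1 / (j (1 + |x''|^2)^M). In this layer |grad eta| is
    of the order of the inverse of its thickness, and the layer thins out fast
    enough at infinity for int |grad eta|^P to be finite although Gamma is
    unbounded; the integral is of the order of j^(-(N - d - P) / 2)
    ([integral_shell_density]) and tends to 0 as j -> oo. By Fatou's lemma u and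
    its gradient vanish almost everywhere, and, since b(u) h(u) is positive
    wherever u is not 0 on the boundary, so does the trace
    ([solution_vanishes]). What remains of the equation is
      g(0) int phi (1 + |x|)^(-alpha) + b(0) int phi (1 + |x|)^(-beta) dS = 0,
    and bumps inside the domain and at a flat boundary point give g(0) = 0 and
    b(0) = 0 ([reaction0], [boundary_term0]).

    The test function h(u) zeta^s needs a weak gradient and a trace. Both come
    from the C^1 functions v_k that approximate u up to the boundary in the
    definition of the trace: h(v_k) zeta^s converges to h(u) zeta^s in W^{1,p}
    and on the boundary ([trace_chain]), and a W^{1,p} limit of C^1 functions has
    a weak gradient by integration by parts ([weak_grad_of_trace]). *)

(** * Borel sets of row vectors *)

Section rV_topology.
Variables (R : realType) (n : nat).
Local Notation E := 'rV[R]_n.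

Lemma continuous_rV (T : topologicalType) (f : T -> E) :
  (forall i, continuous (fun t => f t ord0 i)) -> continuous f.
Proof.
move=> cf t; apply/cvg_ballP => e e0.
have : \forall s \near t, forall i, ball (f t ord0 i) e (f s ord0 i).
  have := @filter_forall T _ (fun i s => ball (f t ord0 i) e (f s ord0 i)) (nbhs t) _.
  apply=> i.
  by move: (cf i t) => /cvg_ballP; apply.
apply: filterS => s H; split => // i j; by rewrite ord1.
Qed.

Lemma continuous_coord (i : 'I_n) : continuous (fun x : E => x ord0 i).
Proof. exact: coord_continuous. Qed.

(** An open set is the countable union of the open cubes with rational centre and
    radius 1/(k+1) that it contains, and these are preimages under coordinates. *)
Lemma open_rV_measurable (U : set E) : open U -> measurable U.
Proof.
move=> oU.
pose box (c : 'rV[rat]_n) (k : nat) : set E :=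
  [set x | forall i, `|x ord0 i - ratr (c ord0 i)| < k.+1%:R^-1].
have mbox c k : measurable (box c k).
  rewrite (_ : box c k = \bigcap_(i in [set: 'I_n])
     [set x : E | `|x ord0 i - ratr (c ord0 i)| < k.+1%:R^-1]); last first.
    by apply/seteqP; split => x //= H i; [move=> _; exact: H|exact: H].
  apply: fin_bigcap_measurable => [|i _]; first exact: finite_finset.
  have -> : [set x : E | `|x ord0 i - ratr (c ord0 i)| < k.+1%:R^-1] =
     setT `&` rV_coord i @^-1` (ball (ratr (c ord0 i) : R) k.+1%:R^-1).
    rewrite setTI; apply/seteqP; split => x /=;
    by rewrite /rV_coord -ball_normE /ball_/= distrC.
  apply: (measurable_rV_coord i) => //.
  by apply: open_measurable; exact: ball_open.
pose F (ck : 'rV[rat]_n * nat) :=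
  if `[<box ck.1 ck.2 `<=` U>] then box ck.1 ck.2 else set0.
have -> : U = \bigcup_ck F ck.
  apply/seteqP; split => [x Ux|x [ck _]]; last first.
    by rewrite /F; case: asboolP => // + ?; apply.
  have /nbhs_ballP[e /= e0 eU] : nbhs x U by exact: open_nbhs_nbhs.
  have [k _ ke] : exists2 k : nat, True & 2 * k.+1%:R^-1 < e.
    exists (Num.trunc (2 / e)) => //.
    rewrite -ltr_pdivlMl// -[ltRHS]invrK ltf_pV2 ?posrE ?invr_gt0//; last first.
      by rewrite mulr_gt0// invr_gt0.
    by rewrite invrM ?unitfE ?invr_eq0// ?gt_eqF// invrK mulrC; exact: truncnS_gt.
  have [c cP] : exists c : 'rV[rat]_n, forall i, `|x ord0 i - ratr (c ord0 i)| < k.+1%:R^-1.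
    suff /choice[c cP] : forall i : 'I_n, exists c : rat,
        `|x ord0 i - ratr c| < k.+1%:R^-1.
      by exists (\row_i c i) => i; rewrite mxE.
    move=> i.
    have k0 : 0 < k.+1%:R^-1 :> R by rewrite invr_gt0.
    have [] := @rat_in_itvoo R (x ord0 i - k.+1%:R^-1) (x ord0 i + k.+1%:R^-1).
      by rewrite ltrBlDr -addrA ltrDl addr_gt0.
    by move=> q; rewrite in_itv /= => qP; exists q; rewrite distrC ltr_distl.
  exists (c, k) => //; rewrite /F /=; case: asboolP => [_|[]]; first exact: cP.
  move=> y yP; apply: eU; split => // i j; rewrite !ord1.
  rewrite -ball_normE /ball_ /=.
  rewrite (_ : x ord0 j - y ord0 j = (x ord0 j - ratr (c ord0 j)) - (y ord0 j - ratr (c ord0 j)));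
    last by ring.
  apply: le_lt_trans (ler_normB _ _) _.
  by apply: lt_trans ke; rewrite mulr2n mulrDl mul1r ltrD.
apply: countable_bigcupT_measurable => // ck.
by rewrite /F; case: asboolP.
Qed.

Lemma closed_rV_measurable (U : set E) : closed U -> measurable U.
Proof.
move=> cU; rewrite -(setCK U); apply: measurableC; apply: open_rV_measurable.
exact: closed_openC.
Qed.

Lemma continuous_rV_measurable (f : E -> R) :
  continuous f -> measurable_fun [set: E] f.
Proof.
move=> /continuousP cf; apply: (measurability _ (RGenOpens.measurableE R)).
move=> _ [_ [a [b ->] <-]]; rewrite setTI; apply: open_rV_measurable.
exact/cf/interval_open.
Qed.
End rV_topology.

(** * Lebesgue measure on row vectors *)

Section leb_theory.
Variable R : realType.
Local Notation rV := (fun n => 'rV[R]_n).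
Local Notation lam := (@lebesgue_measure R).

Lemma snoc_lift n (y : 'rV[R]_n) t (j : 'I_n) :
  snoc y t ord0 (lift ord_max j) = y ord0 j.
Proof. by rewrite mxE liftK. Qed.

Lemma snoc_max n (y : 'rV[R]_n) t : snoc y t ord0 ord_max = t.
Proof. by rewrite mxE unlift_none. Qed.

Lemma snocP n (i : 'I_n.+1) :
  (exists j : 'I_n, i = lift ord_max j) \/ i = ord_max.
Proof. by case: (unliftP ord_max i) => [j ->|->]; [left; exists j|right]. Qed.

Lemma measurable_snoc n : measurable_fun setT
  (fun z : 'rV[R]_n * measurableTypeR R => snoc z.1 z.2).
Proof.
apply: measurable_fun_rV => i; case: (snocP i) => [[j ->]|->].
- rewrite (_ : _ \o _ = rV_coord j \o fst).
    exact: measurableT_comp (@measurable_rV_coord R n j) measurable_fst.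
  by apply/funext => z; rewrite /rV_coord /= snoc_lift.
- rewrite (_ : _ \o _ = snd); first exact: measurable_snd.
  by apply/funext => z; rewrite /rV_coord /= snoc_max.
Qed.

Lemma continuous_snocl n (t : R) : continuous (fun y : 'rV[R]_n => snoc y t).
Proof.
apply: continuous_rV => i; case: (snocP i) => [[j ->]|->].
- rewrite (_ : (fun _ => _) = (fun y : 'rV[R]_n => y ord0 j)).
    exact: continuous_coord.
  by apply/funext => y; rewrite snoc_lift.
- rewrite (_ : (fun _ => _) = (fun=> t)); first exact: cst_continuous.
  by apply/funext => y; rewrite snoc_max.
Qed.

Lemma continuous_snocr n (y : 'rV[R]_n) : continuous (fun t : R => snoc y t).
Proof.
apply: continuous_rV => i; case: (snocP i) => [[j ->]|->].
- rewrite (_ : (fun _ => _) = (fun=> y ord0 j)); first exact: cst_continuous.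
  by apply/funext => t; rewrite snoc_lift.
- rewrite (_ : (fun _ => _) = id); first by move=> ?; exact: cvg_id.
  by apply/funext => t; rewrite snoc_max.
Qed.

Local Open Scope ereal_scope.

(** Tonelli's theorem for the last coordinate; [integral_lebS] and
    [integral_lebS_swap] are the two orders in Fubini's theorem. *)
Lemma ge0_integral_lebS n (f : 'rV[R]_n.+1 -> \bar R) :
  measurable_fun setT f -> (forall x, 0 <= f x) ->
  \int[leb R n.+1]_x f x = \int[leb R n]_y \int[lam]_t f (snoc y t).
Proof.
move=> mf f0.
rewrite [LHS](@ge0_integral_pushforward _ _ _ _ _ _ (@measurable_snoc n) _ setT)//.
rewrite preimage_setT /comp.
rewrite (fubini_tonelli1 (fun z : 'rV[R]_n * measurableTypeR R => f (snoc z.1 z.2)))//.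
by apply: measurableT_comp => //; exact: measurable_snoc.
Qed.

Lemma integrable_lebS n (f : 'rV[R]_n.+1 -> \bar R) :
  (leb R n.+1).-integrable setT f ->
  (leb R n \x lam).-integrable setT
    (fun z : 'rV[R]_n * measurableTypeR R => f (snoc z.1 z.2)).
Proof.
move=> /integrableP[mf fi]; apply/integrableP; split.
  by apply: measurableT_comp => //; exact: measurable_snoc.
move: fi; rewrite [X in X < _](@ge0_integral_pushforward _ _ _ _ _ _
  (@measurable_snoc n) _ setT)//.
by apply: measurableT_comp.
Qed.

Lemma integral_lebS n (f : 'rV[R]_n.+1 -> \bar R) :
  (leb R n.+1).-integrable setT f ->
  \int[leb R n.+1]_x f x = \int[leb R n]_y \int[lam]_t f (snoc y t).
Proof.
move=> /[dup] /integrable_lebS fi /integrableP[mf _].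
rewrite [LHS](@integral_pushforward _ _ _ _ _ _ (@measurable_snoc n) _ setT)//.
by rewrite preimage_setT /comp -(integral12_prod_meas1 fi).
Qed.

Lemma integral_lebS_swap n (f : 'rV[R]_n.+1 -> \bar R) :
  (leb R n.+1).-integrable setT f ->
  \int[leb R n.+1]_x f x = \int[lam]_t \int[leb R n]_y f (snoc y t).
Proof.
move=> /[dup] /integrable_lebS fi /integrableP[mf _].
rewrite [LHS](@integral_pushforward _ _ _ _ _ _ (@measurable_snoc n) _ setT)//.
by rewrite preimage_setT /comp -(integral21_prod_meas1 fi).
Qed.

Lemma measurable_rV_coordT n (i : 'I_n) :
  measurable_fun setT (fun x : 'rV[R]_n => x ord0 i : measurableTypeR R).
Proof. exact: measurable_rV_coord. Qed.

Lemma integral_prod_coord n (f : R -> R) (c : R) :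
  measurable_fun setT f -> (forall t, (0 <= f t)%R) ->
  \int[lam]_t (f t)%:E = c%:E ->
  \int[leb R n]_x (\prod_(i < n) f (x ord0 i))%:E = (c ^+ n)%:E.
Proof.
move=> mf f0 fc.
have mp m : measurable_fun setT (fun x : 'rV[R]_m => (\prod_(i < m) f (x ord0 i))%R).
  apply: measurable_prod => i _.
  exact: measurableT_comp (measurable_rV_coordT i).
elim: n => [|n IHn].
  rewrite /= integral_dirac//; last by apply/measurable_EFinP; exact: mp.
  by rewrite diracE in_setT mul1e big_ord0 expr0.
rewrite ge0_integral_lebS; last 2 first.
  by apply/measurable_EFinP; exact: mp.
  by move=> x; rewrite lee_fin prodr_ge0.
transitivity (\int[leb R n]_y (c%:E * (\prod_(i < n) f (y ord0 i))%:E)).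
  apply: eq_integral => y _.
  rewrite -fc muleC -ge0_integralZl//; last 3 first.
    by apply/measurable_EFinP.
    by move=> t _; rewrite lee_fin.
    by rewrite lee_fin prodr_ge0.
  apply: eq_integral => t _; rewrite -EFinM big_ord_recr/=; congr (_ * _)%:E.
    apply: eq_bigr => i _; congr (f _).
    rewrite -(snoc_lift y t); congr (snoc y t ord0 _).
    by apply: val_inj; rewrite /= /bump leqNgt ltn_ord.
  by rewrite -[in RHS](snoc_max y t); congr (f (snoc _ _ _ _)); exact: val_inj.
rewrite ge0_integralZl//.
- by rewrite IHn -EFinM exprS.
- by apply/measurable_EFinP; exact: mp.
- by move=> x _; rewrite lee_fin prodr_ge0.
- by rewrite -fc integral_ge0// => t _; rewrite lee_fin.
Qed.

Definition cube n (M : R) : set 'rV[R]_n := [set x | forall i, (`|x ord0 i| <= M)%R].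
Arguments cube n M : clear implicits.

Lemma cube_closed n M : closed (cube n M).
Proof.
have -> : cube n M = \bigcap_(i in setT) ((fun x : 'rV[R]_n => `|x ord0 i|%R) @^-1` [set t | (t <= M)%R]).
  by apply/seteqP; split => x /= H i; [move=> _; exact: H|exact: H].
apply: closed_bigI => i _; apply: closed_comp; last exact: closed_le.
by move=> x _; apply: continuous_comp; [exact: continuous_coord|exact: norm_continuous].
Qed.

Lemma leb_cube_lty n M : leb R n (cube n M) < +oo.
Proof.
have mc : measurable (cube n M) by apply: closed_rV_measurable; exact: cube_closed.
have [M0|M0] := ltP M 0%R.
  case: n mc => [|n] mc.
    by rewrite (le_lt_trans (probability_le1 _ _)) ?ltry.
  rewrite (_ : cube _ _ = set0) ?measure0 ?ltry//.
  apply/seteqP; split => // x /(_ ord0) H; have := le_lt_trans H M0.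
  by rewrite normr_lt0.
pose f (t : R) : R := (\1_(`[- M, M]%classic) t)%R.
have mf : measurable_fun setT f by exact: measurable_indic.
have f0 t : (0 <= f t)%R by rewrite /f indicE.
have If : \int[lam]_t (f t)%:E = (M + M)%:E.
  rewrite integral_indic// setIT.
  rewrite [LHS]lebesgue_measure_itv/= lte_fin.
  have [MM|MM] := ltP (- M)%R M; first by rewrite opprK.
  by have -> : M = 0%R; [lra|rewrite add0r].
rewrite -(setIT (cube n M)) -integral_indic//.
rewrite (eq_integral (fun x : 'rV[R]_n => (\prod_(i < n) f (x ord0 i))%:E)).
  by rewrite (integral_prod_coord n mf f0 If) ltry.
move=> x _; congr EFin; rewrite indicE.
have [|] := boolP (x \in cube n M); rewrite ?inE => xM.
  rewrite big1// => i _; rewrite /f indicE mem_set//= in_itv/= -ler_norml.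
  exact: xM.
have [i xi] : exists i, ~ (`|x ord0 i| <= M)%R.
  by apply/existsNP => H; move/negP: xM; rewrite inE; apply.
rewrite (bigD1 i)//= /f indicE memNset ?mul0r//= in_itv/= -ler_norml.
exact: xi.
Qed.

Lemma bounded_sub_cube n (V : set 'rV[R]_n) :
  bounded_set V -> exists M, V `<=` cube n M.
Proof.
move=> [M [_ HM]]; exists (M + 1)%R => x Vx i.
apply: le_trans (HM (M + 1)%R _ x Vx); last by rewrite ltrDl.
have /mapP[j Hj ->] : `|x ord0 i|%R \in [seq `|x k.1 k.2|%R | k : 'I_1 * 'I_n].
  by apply/mapP; exists (ord0, i) => //=; rewrite mem_enum.
by rewrite [leRHS]/Num.norm /= mx_normrE; apply/bigmax_geP; right => /=; exists j.
Qed.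

Lemma cube_bounded n M : bounded_set (cube n M).
Proof.
exists `|M|%R; split; first exact: normr_real.
move=> N MN x xM /=; rewrite [leLHS]/Num.norm/= mx_normrE.
apply/bigmax_leP; split => [|[i j] _ /=].
  by rewrite ltW// (le_lt_trans _ MN).
by rewrite ord1 (le_trans (xM j))// ltW// (le_lt_trans _ MN)// ler_norm.
Qed.

Lemma leb_bounded_lty n (V : set 'rV[R]_n) :
  measurable V -> bounded_set V -> leb R n V < +oo.
Proof.
move=> mV /bounded_sub_cube[M VM]; apply: le_lt_trans (leb_cube_lty n M).
apply: le_measure => //; rewrite inE//.
by apply: closed_rV_measurable; exact: cube_closed.
Qed.

(** An open set contains the product of a ball and an interval. *)
Lemma leb_open_gt0 n (U : set 'rV[R]_n) x : open U -> U x -> 0 < leb R n U.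
Proof.
elim: n U x => [|n IHn] U x oU Ux.
  by rewrite /= diracE mem_set ?lte01// -(_ : x = 0%R)//; apply/rowP => -[].
have /nbhs_ballP[e /= e0 eU] : nbhs x U by exact: open_nbhs_nbhs.
pose y := \row_j x ord0 (lift ord_max j); pose t := x ord0 ord_max.
have yt : (ball y e : set 'rV[R]_n) `*` (ball t e : set (measurableTypeR R)) `<=`
   (fun z => snoc z.1 z.2) @^-1` U.
  move=> [z s] /= [[_ yz] ts]; apply: eU; split => // i j.
  rewrite ord1; case: (snocP j) => [[k ->]|->].
    by rewrite snoc_lift; have := yz ord0 k; rewrite mxE.
  by rewrite snoc_max.
have mB1 : measurable (ball y e) by apply: open_rV_measurable; exact: ball_open.
have mB2 : measurable (ball t e : set (measurableTypeR R)).
  by apply: open_measurable; exact: ball_open.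
apply: (@lt_le_trans _ _ ((leb R n \x lam) (ball y e `*` ball t e))).
  rewrite product_measure1E// mule_gt0//.
    by apply: (IHn _ y); [exact: ball_open|exact: ballxx].
  by rewrite [ltRHS]lebesgue_measure_ball ?lte_fin ?ltW// mulrn_wgt0.
apply: le_measure => //; rewrite inE//; first exact: measurableX.
rewrite -[X in measurable X]setTI; apply: measurable_snoc => //.
exact: open_rV_measurable.
Qed.

(** Makes the set of points of the boundary that lie on Gamma negligible. *)
Lemma leb_hyperplane n : leb R n.+1 [set x | x ord0 ord_max = 0%R] = 0.
Proof.
rewrite /= /leb_succ /pushforward.
rewrite (_ : _ @^-1` _ = setT `*` [set 0%R : measurableTypeR R]); last first.
  by apply/seteqP; split => -[y t] /=; rewrite snoc_max// => -[].
rewrite product_measure1E//.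
by rewrite [X in _ * X](lebesgue_measure_set1 0%R) mule0.
Qed.

(** The factors 1 / (1 + t^2) have integral pi; their product is the integrable
    function on R^d to which powers of 1 + |x''|^2 are compared. *)
Lemma integral_prod_oneDsqr n :
  \int[leb R n]_x (\prod_(i < n) (oneDsqr (x ord0 i))^-1)%:E = (pi ^+ n)%:E.
Proof.
apply: (integral_prod_coord n (f := fun t => (oneDsqr t)^-1%R)).
- by apply: continuous_measurable_fun; exact: continuous_oneDsqrV.
- by move=> t; rewrite invr_ge0 (le_trans ler01)// oneDsqr_ge1.
rewrite ge0_symfun_integralT//=.
- rewrite (_ : [set x | _] = `[0%R, +oo[%classic); last first.
    by apply/seteqP; split => x/=; rewrite in_itv/= andbT.
  by rewrite integral0y_oneDsqr -EFinM mulrCA divff// mulr1.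
- exact: continuous_oneDsqrV.
- by move=> x/=; rewrite /oneDsqr sqrrN.
Qed.
End leb_theory.

Arguments cube {R} n M _.

(** * Integrals of partial derivatives *)

Section compactly_supported.
Variable R : realType.
Local Notation lam := (@lebesgue_measure R).

Lemma continuous_bounded_cube n (f : 'rV[R]_n -> R) M : continuous f ->
  exists C, forall x, cube n M x -> `|f x| <= C.
Proof.
move=> cf.
have cK : compact (cube n M).
  by apply: bounded_closed_compact; [exact: cube_bounded|exact: cube_closed].
have : compact [set f x | x in cube n M].
  by apply: continuous_compact => //; exact: continuous_subspaceT.
move=> /compact_bounded[C [_ HC]]; exists (C + 1) => x xK.
by apply: (HC (C + 1)); [rewrite ltrDl|exists x].
Qed.

Lemma integrable_continuous_cube n (f : 'rV[R]_n -> R) M : continuous f ->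
  (forall x, ~ cube n M x -> f x = 0) ->
  (leb R n).-integrable setT (EFin \o f).
Proof.
move=> cf f0; have [C HC] := continuous_bounded_cube M cf.
have mK : measurable (cube n M) by apply: closed_rV_measurable; exact: cube_closed.
have mf := continuous_rV_measurable cf.
have fE : EFin \o f = (EFin \o f) \_ (cube n M).
  apply/funext => x; rewrite patchE; case: ifPn => //; rewrite notin_setE => xK /=.
  by rewrite f0.
rewrite fE; apply/(integrable_restrict (leb R n) mK measurableT (EFin \o f)).
rewrite setTI; apply: measurable_bounded_integrable => //.
- exact: leb_cube_lty.
- exact: measurable_funTS.
- exists C; split; first exact: num_real.
  by move=> D CD x xK /=; rewrite (le_trans (HC x xK))// ltW.
Qed.

Lemma cube_snoc n M (y : 'rV[R]_n) t :
  cube n.+1 M (snoc y t) -> cube n M y /\ `|t| <= M.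
Proof.
move=> H; split => [i|]; first by rewrite -(snoc_lift y t); exact: H.
by rewrite -{1}(snoc_max y t); exact: H.
Qed.

Lemma snocD n (y z : 'rV[R]_n) s t : snoc y s + snoc z t = snoc (y + z) (s + t).
Proof. by apply/rowP => i; rewrite !mxE; case: unliftP => // j _; rewrite mxE. Qed.

Lemma snocZ n (y : 'rV[R]_n) s h : h *: snoc y s = snoc (h *: y) (h * s).
Proof. by apply/rowP => i; rewrite !mxE; case: unliftP => // j _; rewrite mxE. Qed.

Lemma delta_lift n (j : 'I_n) :
  delta_mx ord0 (lift ord_max j) = snoc (delta_mx ord0 j) 0 :> 'rV[R]_n.+1.
Proof.
apply/rowP => i; case: (snocP i) => [[k ->]|->].
  by rewrite snoc_lift !mxE (inj_eq lift_inj).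
by rewrite snoc_max mxE /= (negPf (neq_lift _ _)).
Qed.

Lemma delta_max n : delta_mx ord0 ord_max = snoc 0 1 :> 'rV[R]_n.+1.
Proof.
apply/rowP => i; case: (snocP i) => [[k ->]|->].
  by rewrite snoc_lift !mxE /= eq_sym (negPf (neq_lift _ _)).
by rewrite snoc_max mxE /= eqxx.
Qed.

Lemma line_lift n (F : 'rV[R]_n.+1 -> R) (j : 'I_n) y t :
  (fun h : R => F (h *: delta_mx ord0 (lift ord_max j) + snoc y t)) =
  (fun h => F (snoc (h *: delta_mx ord0 j + y) t)).
Proof. by apply/funext => h; rewrite delta_lift snocZ snocD mulr0 add0r. Qed.

Lemma line_max n (F : 'rV[R]_n.+1 -> R) y t :
  (fun h : R => F (h *: delta_mx ord0 ord_max + snoc y t)) =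
  (fun h : R => F (snoc y (h *: 1 + t))).
Proof. by apply/funext => h; rewrite delta_max snocZ snocD scaler0 add0r. Qed.

(** A directional derivative only depends on the restriction to a line. This
    identifies the partial derivatives of F with those of its restrictions to the
    slices [snoc y t], over which Fubini's theorem integrates. *)
Lemma derive_line (V V' : normedModType R) (f : V -> R) (g : V' -> R) a v a' v' :
  (fun h : R => f (h *: v + a)) = (fun h : R => g (h *: v' + a')) ->
  derivable f a v = derivable g a' v' /\ 'D_v f a = 'D_v' g a'.
Proof.
move=> E; have E0 : f a = g a'.
  by have := congr1 (@^~ 0) E; rewrite /= !scale0r !add0r.
suff EE : (fun h : R => h^-1 *: ((f \o shift a) (h *: v) - f a)) =
    (fun h : R => h^-1 *: ((g \o shift a') (h *: v') - g a')).
  by rewrite /derivable /derive EE.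
by apply/funext => h; have := congr1 (@^~ h) E; rewrite /= E0 => ->.
Qed.

Lemma derivable_lift n (F : 'rV[R]_n.+1 -> R) (j : 'I_n) y t :
  derivable F (snoc y t) (delta_mx ord0 (lift ord_max j)) =
  derivable (fun y => F (snoc y t)) y (delta_mx ord0 j).
Proof.
exact: (derive_line (line_lift F j y t)).1.
Qed.

Lemma partial_lift n (F : 'rV[R]_n.+1 -> R) (j : 'I_n) y t :
  partial (lift ord_max j) F (snoc y t) = partial j (fun y => F (snoc y t)) y.
Proof.
exact: (derive_line (line_lift F j y t)).2.
Qed.

Lemma derivable_max n (F : 'rV[R]_n.+1 -> R) y t :
  derivable F (snoc y t) (delta_mx ord0 ord_max) =
  derivable (fun t : R => F (snoc y t)) t 1.
Proof.
exact: (derive_line (line_max F y t)).1.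
Qed.

Lemma partial_max n (F : 'rV[R]_n.+1 -> R) y t :
  partial ord_max F (snoc y t) = 'D_1 (fun t : R => F (snoc y t)) t.
Proof.
exact: (derive_line (line_max F y t)).2.
Qed.

Lemma partial_out n (F : 'rV[R]_n -> R) M i x :
  (forall z, ~ cube n M z -> F z = 0) -> ~ cube n M x -> partial i F x = 0.
Proof.
move=> F0 xM; rewrite /partial (near_eq_derive (g := cst 0)) ?derive_cst//.
have : nbhs x (~` cube n M).
  apply: open_nbhs_nbhs; split => //; apply: closed_openC; exact: cube_closed.
by apply: filterS => z /F0.
Qed.

Lemma integral_derive_R (f : R -> R) (M : R) :
  (forall t, derivable f t 1) -> continuous ('D_1 f) ->
  (forall t, M < `|t| -> f t = 0) ->
  (\int[lam]_t ('D_1 f t)%:E = 0)%E.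
Proof.
move=> df cf f0; pose M' : R := `|M| + 1.
have M'0 : 0 < M' by rewrite ltr_wpDl.
have MM' : M < M' by rewrite (le_lt_trans (ler_norm _))// ltrDl.
have out (t : R) : M' < `|t| -> 'D_1 f t = 0.
  move=> /(lt_trans MM') tM; rewrite (near_eq_derive (g := cst 0)) ?derive_cst//.
  have : \forall s \near t, M < `|s|.
    apply: (@cvgr_gt R R (nbhs t) _ (fun s : R => `|s|) `|t|) => //.
    exact: norm_continuous.
  by apply: filterS => s; exact: f0.
transitivity (\int[lam]_(t in `[(- M')%R, M']) ('D_1 f t)%:E)%E.
  rewrite [RHS]integral_mkcond; apply: eq_integral => t _.
  rewrite patchE; case: ifPn => //; rewrite notin_setE/= in_itv/= -ler_norml.
  by move/negP; rewrite -ltNge => /out ->.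
rewrite (@continuous_FTC2 _ _ f).
- by rewrite !f0 ?subee// ?normrN gtr0_norm.
- by rewrite (lt_trans _ M'0)// oppr_lt0.
- exact: continuous_subspaceT.
- have cf' t : f s @[s --> t] --> f t.
    by apply: differentiable_continuous; apply/derivable1_diffP.
  by split => [t _||]; [exact: df|exact: cvg_at_right_filter|exact: cvg_at_left_filter].
- by move=> t _; rewrite derive1E.
Qed.

(** By Fubini's theorem the variable of differentiation can be integrated first,
    which leaves the fundamental theorem of calculus in one variable. As [leb] splits
    off the last coordinate, the other variables are reached by induction. *)
Lemma integral_partial n (F : 'rV[R]_n -> R) M i :
  (forall x, derivable F x (delta_mx ord0 i)) -> continuous (partial i F) ->
  (forall x, ~ cube n M x -> F x = 0) ->
  (\int[leb R n]_x (partial i F x)%:E = 0)%E.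
Proof.
elim: n F i => [|n IHn] F i; first by case: i.
move=> dF cF F0.
have iF := integrable_continuous_cube cF (fun x => partial_out i F0).
case: (snocP i) => [[j ij]|ij]; rewrite {i}ij in dF cF iF *.
  rewrite (integral_lebS_swap iF) integral0_eq// => t _.
  rewrite /= (eq_integral (fun y => (partial j (fun y => F (snoc y t)) y)%:E)); last first.
    by move=> y _; rewrite partial_lift.
  apply: IHn.
  - by move=> y; rewrite -derivable_lift.
  - rewrite (_ : partial j _ = partial (lift ord_max j) F \o (fun y => snoc y t)).
      move=> y; apply: continuous_comp; [exact: continuous_snocl|exact: cF].
    by apply/funext => y; rewrite /= partial_lift.
  - by move=> y yM; apply: F0 => /cube_snoc[].
rewrite (integral_lebS iF) integral0_eq// => y _.
transitivity (\int[lam]_t ('D_1 (fun t : R => F (snoc y t)) t)%:E)%E.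
  by apply: eq_integral => t _; rewrite /= partial_max.
apply: (integral_derive_R (M := M)).
- by move=> t; rewrite -derivable_max.
- rewrite (_ : 'D_1 (fun t : R => F (snoc y t)) = partial ord_max F \o (fun t => snoc y t)).
    move=> t; apply: continuous_comp; [exact: continuous_snocr|exact: cF].
  by apply/funext => t; rewrite /= partial_max.
- by move=> t tM; apply: F0 => /cube_snoc[_]; rewrite leNgt tM.
Qed.

End compactly_supported.

(** * Functions of class C^1 and integration by parts *)

Section C1_calculus.
Variables (R : realType) (n : nat).
Local Notation E := 'rV[R]_n.
Implicit Types (f : E -> R) (g : 'I_n -> E -> R).

(** Recording the partial derivatives along with f lets the usual rules of
    calculus produce the gradient together with the regularity. *)
Definition C1_grad f g : Prop :=
  [/\ forall x, differentiable f x, forall i x, partial i f x = g i x &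
      forall i, continuous (g i)].

Lemma C1_gradW f g : C1_grad f g -> Ck 1 f.
Proof.
case=> df fg cg; split => // i.
by rewrite (_ : partial i f = g i)//; apply/funext => x.
Qed.

Lemma C1_gradE f g x : C1_grad f g -> grad f x = \row_i g i x.
Proof. by case=> _ fg _; apply/rowP => i; rewrite !mxE. Qed.

Lemma Ck1_grad f : Ck 1 f -> C1_grad f (fun i => partial i f).
Proof. by case=> df cf; split. Qed.

Lemma Ck1_continuous f : Ck 1 f -> continuous f.
Proof. by case=> df _ x; exact/differentiable_continuous/df. Qed.

Lemma C1_grad_cst (c : R) : C1_grad (fun=> c) (fun _ _ => 0).
Proof.
split => [x|i x|i]; [exact: differentiable_cst|exact: derive_cst|].
exact: cst_continuous.
Qed.

Lemma C1_grad_coord j : C1_grad (fun x => x ord0 j) (fun i _ => (i == j)%:R).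
Proof.
split => [x|i x|i]; first exact: differentiable_coord.
  rewrite /partial deriveE; last exact: differentiable_coord.
  have lin : linear (fun N : E => N ord0 j : R^o).
    by move=> a u v; rewrite !mxE.
  pose Lf : {linear E -> R^o} := HB.pack (fun N : E => N ord0 j : R^o)
    (GRing.isLinear.Build _ _ _ _ (fun N : E => N ord0 j : R^o) lin).
  rewrite (@diff_lin _ _ _ Lf) /=; last exact: coord_continuous.
  by rewrite mxE eqxx /= eq_sym.
exact: cst_continuous.
Qed.

Lemma C1_gradD f1 g1 f2 g2 : C1_grad f1 g1 -> C1_grad f2 g2 ->
  C1_grad (fun x => f1 x + f2 x) (fun i x => g1 i x + g2 i x).
Proof.
move=> [df1 fg1 cg1] [df2 fg2 cg2]; split => [x|i x|i].
- exact: differentiableD.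
- rewrite -(fg1 i x) -(fg2 i x); apply: deriveD; apply: diff_derivable;
    [exact: df1|exact: df2].
- by move=> x; exact: (cvgD (cg1 i x) (cg2 i x)).
Qed.

Lemma C1_gradM f1 g1 f2 g2 : C1_grad f1 g1 -> C1_grad f2 g2 ->
  C1_grad (fun x => f1 x * f2 x) (fun i x => f1 x * g2 i x + f2 x * g1 i x).
Proof.
move=> [df1 fg1 cg1] [df2 fg2 cg2]; split => [x|i x|i].
- exact: differentiableM.
- rewrite -(fg1 i x) -(fg2 i x); apply: deriveM; apply: diff_derivable;
    [exact: df1|exact: df2].
- have cf1 : continuous f1 by move=> x; exact/differentiable_continuous/df1.
  have cf2 : continuous f2 by move=> x; exact/differentiable_continuous/df2.
  by move=> x; exact: (cvgD (cvgM (cf1 x) (cg2 i x)) (cvgM (cf2 x) (cg1 i x))).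
Qed.

Lemma C1_grad_comp (h h' : R -> R) f g :
  (forall t : R, is_derive t 1 h (h' t)) -> continuous h' ->
  C1_grad f g -> C1_grad (fun x => h (f x)) (fun i x => h' (f x) * g i x).
Proof.
move=> hh' ch' [df fg cg].
have dh t : differentiable h t.
  by apply/derivable1_diffP; have [] := hh' t.
split => [x|i x|i].
- exact: differentiable_comp.
- rewrite /partial deriveE; last exact: differentiable_comp.
  rewrite -(fg i x) [X in _ * X]deriveE//.
  rewrite (_ : (fun _ => _) = h \o f)// diff_comp//= diff1E//= derive1E.
  by have [_ ->] := hh' (f x); rewrite mulrC.
- move=> x; apply: cvgM (cg i x).
  apply: (@continuous_comp _ _ _ f h'); last exact: ch'.
  exact/differentiable_continuous/df.
Qed.

Lemma C1_grad_sumsq (P : pred 'I_n) :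
  C1_grad (fun x => \sum_(j | P j) x ord0 j ^+ 2)
          (fun i x => if P i then 2 * x ord0 i else 0).
Proof.
suff H (s : seq 'I_n) : C1_grad (fun x => \sum_(j <- s | P j) x ord0 j ^+ 2)
    (fun i x => \sum_(j <- s | P j) 2 * x ord0 j * (i == j)%:R).
  case: (H (index_enum 'I_n)) => df fg cg.
  have HE i (x : E) : (\sum_(j | P j) 2 * x ord0 j * (i == j)%:R : R) =
      if P i then 2 * x ord0 i else 0.
    case: ifPn => Pi.
      rewrite (bigD1 i)//= eqxx mulr1 big1 ?addr0// => j /andP[_ ji].
      by rewrite eq_sym (negPf ji) mulr0.
    rewrite big1// => j Pj; case: eqP => [ij|]; rewrite ?mulr0//.
    by rewrite ij Pj in Pi.
  split => // [i x|i]; first by rewrite fg HE.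
  rewrite (_ : (fun x : E => _) =
    (fun x : E => \sum_(j | P j) 2 * x ord0 j * (i == j)%:R))//.
  by apply/funext => x; rewrite HE.
elim: s => [|j s IH].
  have := C1_grad_cst 0; congr C1_grad.
    by apply/funext => x; rewrite big_nil.
  by apply/funext => i; apply/funext => x; rewrite big_nil.
have [Pj|Pj] := boolP (P j); last first.
  move: IH; congr C1_grad.
    by apply/funext => x; rewrite big_cons (negPf Pj).
  by apply/funext => i; apply/funext => x; rewrite big_cons (negPf Pj).
have := C1_gradD (C1_gradM (C1_grad_coord j) (C1_grad_coord j)) IH; congr C1_grad.
  by apply/funext => x; rewrite big_cons Pj expr2.
apply/funext => i; apply/funext => x; rewrite big_cons Pj; ring.
Qed.

End C1_calculus.

Lemma integration_by_parts (R : realType) n (v f : 'rV[R]_n -> R) M i :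
  Ck 1 v -> Ck 1 f -> (forall x, ~ cube n M x -> f x = 0) ->
  (\int[leb R n]_x (v x * partial i f x + f x * partial i v x)%:E = 0)%E.
Proof.
move=> v1 f1 f0.
have [dF FE cF] := C1_gradM (Ck1_grad v1) (Ck1_grad f1).
have E : partial i (fun x => v x * f x) =
    (fun x => v x * partial i f x + f x * partial i v x).
  by apply/funext => x; rewrite FE.
rewrite -(@integral_partial R n (fun x => v x * f x) M i).
- by apply: eq_integral => x _; rewrite E.
- by move=> x; exact: diff_derivable.
- by rewrite E.
- by move=> x xM; rewrite f0// mulr0.
Qed.

Section derivatives.
Variable R : realType.

(** A C^1 function that vanishes on the negative half line; cutoffs and bumps are
    made from it. *)
Definition sqp (t : R) : R := Num.max 0 t ^+ 2.

Lemma is_derive_sqp (t : R) : is_derive t 1 sqp (2 * Num.max 0 t).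
Proof.
have dsq (s : R) : is_derive s 1 (fun r : R => r ^+ 2) (2 * s).
  apply: is_derive_eq; rewrite /GRing.scale/=; ring.
have [t0|t0|t0] := ltgtP t 0.
- rewrite mulr0.
  have := @is_derive_cst R R R (0:R) t 1; apply: near_eq_is_derive.
  have : \forall s \near t, s < 0 by exact: (@cvgr_lt R R (nbhs t) _ id t (@cvg_id _ _) 0 t0).
  by apply: filterS => s s0; rewrite /sqp max_l ?expr0n// ltW.
- have := dsq t; apply: near_eq_is_derive.
  have : \forall s \near t, 0 < s by exact: (@cvgr_gt R R (nbhs t) _ id t (@cvg_id _ _) 0 t0).
  by apply: filterS => s s0; rewrite /sqp max_r// ltW.
rewrite t0 mulr0.
suff H : h^-1 *: ((sqp \o shift 0) (h *: 1) - sqp 0) @[h --> (0:R)^'] --> (0:R).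
  by apply: DeriveDef; [exact/cvgP/H|exact/cvg_lim/H].
apply/cvgrPdist_le => e e0; near=> h.
rewrite /= addr0 /sqp maxxx expr0n/= subr0 sub0r normrN /GRing.scale/= mulr1.
have h0 : h != 0 by near: h; exact: nbhs_dnbhs_neq.
have he : `|h| <= e.
  by near: h; exact: dnbhs0_le.
case: (leP h 0) => hh; first by rewrite expr0n/= mulr0 normr0 ltW.
by rewrite expr2 mulKf.
Unshelve. all: by end_near. Qed.

Lemma continuous_maxr0 : continuous (fun t : R => Num.max 0 t).
Proof.
rewrite (_ : (fun t : R => _) = (fun t : R => (t + `|t|) / 2)).
  move=> t; apply: (cvgM _ (@cvg_cst _ _ _ _ _)).
  exact: (cvgD (@cvg_id _ _) (@norm_continuous _ _ _)).
by apply/funext => t; case: (leP 0 t) => t0; [rewrite ger0_norm//; lra|rewrite ltr0_norm//; lra].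
Qed.

End derivatives.

(** * Euclidean norm, domain and boundary charts *)

Section euclidean_norm.
Variables (R : realType) (n : nat).
Local Notation E := 'rV[R]_n.
Implicit Types x y : E.

Lemma sumsq_ge0 (P : pred 'I_n) x : 0 <= \sum_(i | P i) x ord0 i ^+ 2.
Proof. by apply: sumr_ge0 => i _; exact: sqr_ge0. Qed.

Lemma enorm_ge0 x : 0 <= enorm x. Proof. exact: sqrtr_ge0. Qed.

Lemma sqr_enorm x : enorm x ^+ 2 = \sum_i x ord0 i ^+ 2.
Proof. by rewrite sqr_sqrtr// sumsq_ge0. Qed.

Lemma sqr_enorm' d x : enorm' d x ^+ 2 = \sum_(i < n | (d <= i)%N) x ord0 i ^+ 2.
Proof. by rewrite sqr_sqrtr// sumsq_ge0. Qed.

Lemma enorm'_ge0 d x : 0 <= enorm' d x. Proof. exact: sqrtr_ge0. Qed.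

Lemma ler_sumsq (P : pred 'I_n) x i : P i ->
  x ord0 i ^+ 2 <= \sum_(j | P j) x ord0 j ^+ 2.
Proof.
by move=> Pi; rewrite (bigD1 i)//= lerDl sumr_ge0// => j _; exact: sqr_ge0.
Qed.

Lemma coord_le_enorm x i : `|x ord0 i| <= enorm x.
Proof.
rewrite -(@ler_pXn2r _ 2)// ?nnegrE ?enorm_ge0// sqr_enorm real_normK ?num_real//.
exact: (ler_sumsq (P := predT)).
Qed.

Lemma enorm_eq0 x : enorm x = 0 -> x = 0.
Proof.
move=> x0; apply/rowP => i; apply/eqP; rewrite mxE -normr_le0 -x0.
exact: coord_le_enorm.
Qed.

Lemma enorm0 : enorm (0 : E) = 0.
Proof. by rewrite /enorm big1 ?sqrtr0// => i _; rewrite mxE expr0n. Qed.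

Lemma enormZ (a : R) x : enorm (a *: x) = `|a| * enorm x.
Proof.
rewrite /enorm -sqrtr_sqr -sqrtrM ?sqr_ge0//; congr Num.sqrt.
by rewrite mulr_sumr; apply: eq_bigr => i _; rewrite mxE exprMn.
Qed.

Lemma dotZr (a : R) x y : dot x (a *: y) = a * dot x y.
Proof. by rewrite /dot mulr_sumr; apply: eq_bigr => i _; rewrite mxE mulrCA. Qed.

Lemma dotDr x y z : dot x (y + z) = dot x y + dot x z.
Proof. by rewrite /dot -big_split; apply: eq_bigr => i _; rewrite mxE mulrDr. Qed.

Lemma dot0l y : dot 0 y = 0.
Proof. by rewrite /dot big1// => i _; rewrite mxE mul0r. Qed.

(** Normalise both vectors and use 2 a b <= a^2 + b^2 in each coordinate. *)
Lemma dot_le_enorm x y : `|dot x y| <= enorm x * enorm y.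
Proof.
have [/enorm_eq0 ->|x0] := eqVneq (enorm x) 0.
  by rewrite dot0l normr0 mulr_ge0 ?enorm_ge0.
have [y0|y0] := eqVneq (enorm y) 0.
  rewrite (enorm_eq0 y0) /dot big1 ?normr0 ?mulr_ge0 ?enorm_ge0// => i _.
  by rewrite mxE mulr0.
have x1 : 0 < enorm x by rewrite lt0r x0 enorm_ge0.
have y1 : 0 < enorm y by rewrite lt0r y0 enorm_ge0.
apply: (le_trans (ler_norm_sum _ _ _)).
rewrite -[leRHS]mulr1 -ler_pdivrMl ?mulr_gt0// mulr_sumr.
apply: (@le_trans _ _ (\sum_i (2^-1 * ((x ord0 i / enorm x) ^+ 2 + (y ord0 i / enorm y) ^+ 2)))).
  apply: ler_sum => i _; rewrite normrM.
  set a := x ord0 i; set b := y ord0 i.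
  rewrite (_ : _ * _ = (`|a| / enorm x) * (`|b| / enorm y)); last first.
    by rewrite invfM; ring.
  rewrite -(real_normK (num_real (a / enorm x))) -(real_normK (num_real (b / enorm y))).
  rewrite !normrM !(@ger0_norm _ (_ ^-1)) ?invr_ge0 ?enorm_ge0//.
  have := sqr_ge0 (`|a| / enorm x - `|b| / enorm y); nra.
rewrite -mulr_sumr big_split/=.
have sE (z : E) : enorm z != 0 -> \sum_i (z ord0 i / enorm z) ^+ 2 = 1.
  move=> z0; under eq_bigr do rewrite expr_div_n.
  by rewrite -mulr_suml -sqr_enorm divff// expf_neq0.
by rewrite !sE//; lra.
Qed.

Lemma enormD x y : enorm (x + y) <= enorm x + enorm y.
Proof.
rewrite -(@ler_pXn2r _ 2)// ?nnegrE ?addr_ge0 ?enorm_ge0// sqr_enorm.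
apply: (@le_trans _ _ (enorm x ^+ 2 + 2 * dot x y + enorm y ^+ 2)).
  rewrite !sqr_enorm /dot mulr_sumr -!big_split/=; apply: ler_sum => i _.
  by rewrite mxE le_eqVlt; apply/orP; left; apply/eqP; ring.
by have := le_trans (ler_norm _) (dot_le_enorm x y); nra.
Qed.

Lemma enorm_le_sum x : enorm x <= \sum_i `|x ord0 i|.
Proof.
rewrite -(@ler_pXn2r _ 2)// ?nnegrE ?enorm_ge0 ?sumr_ge0// sqr_enorm.
rewrite expr2 mulr_suml; apply: ler_sum => i _.
rewrite -real_normK ?num_real// expr2 ler_wpM2l//.
by rewrite (bigD1 i)//= lerDl sumr_ge0.
Qed.

Definition sumsq (P : pred 'I_n) (x : E) : R := \sum_(i | P i) x ord0 i ^+ 2.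

Lemma continuous_sumsq (P : pred 'I_n) : continuous (sumsq P).
Proof. by have H := Ck1_continuous (C1_gradW (@C1_grad_sumsq R n P)); exact: H. Qed.

Lemma continuous_enorm : continuous (@enorm R n).
Proof.
move=> x; apply: continuous_comp; last exact: sqrt_continuous.
exact: (@continuous_sumsq predT x).
Qed.

Lemma continuous_enorm' d : continuous (@enorm' R n d).
Proof.
move=> x; apply: continuous_comp; last exact: sqrt_continuous.
exact: (@continuous_sumsq (fun i => d <= i)%N x).
Qed.

Lemma weight_gt0 a x : 0 < weight a x.
Proof. by rewrite powR_gt0// ltr_pwDl// enorm_ge0. Qed.

Lemma weight_le1 a x : 0 <= a -> weight a x <= 1.
Proof.
move=> a0; rewrite /weight powRN invf_le1 ?powR_gt0 ?ltr_pwDl ?enorm_ge0//.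
by rewrite -{1}(powRr0 (1 + enorm x)) ler_powR// lerDl enorm_ge0.
Qed.

Lemma measurable_enorm : measurable_fun [set: E] (@enorm R n).
Proof. exact: (continuous_rV_measurable continuous_enorm). Qed.

Lemma measurable_weight a : measurable_fun [set: E] (weight a).
Proof.
have H : measurable_fun [set: E] (fun x => 1 + enorm x).
  by apply: measurable_funD => //; exact: measurable_enorm.
exact: (measurableT_comp (measurable_powR (- a)) H).
Qed.

Lemma measurable_dot d (T : measurableType d) (D : set T) (f g : T -> E) :
  (forall i, measurable_fun D (fun t => f t ord0 i)) ->
  (forall i, measurable_fun D (fun t => g t ord0 i)) ->
  measurable_fun D (fun t => dot (f t) (g t)).
Proof. by move=> mf mg; apply: measurable_sum => i; exact: measurable_funM. Qed.

Lemma measurable_fun_rVD d (T : measurableType d) (D : set T) (f : T -> E) :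
  measurable D -> (forall i, measurable_fun D (fun t => f t ord0 i)) ->
  measurable_fun D f.
Proof.
move=> mD mf; apply/(measurable_restrictT f mD).
apply: measurable_fun_rV => i.
rewrite (_ : _ \o _ = (fun t => f t ord0 i : measurableTypeR R) \_ D).
  by apply/(measurable_restrictT _ mD); exact: mf.
by apply/funext => t; rewrite /rV_coord /= !patchE; case: ifP => //; rewrite mxE.
Qed.

End euclidean_norm.

Section domain_geometry.
Variables (R : realType) (n d : nat) (rho : \bar R).
Hypothesis dn : (d <= n)%N.
Local Notation E := 'rV[R]_n.+1.
Local Notation Om := (@Omega R n d rho).

Lemma sumsq_snoc (P : pred nat) (y : 'rV[R]_n) t :
  \sum_(i < n.+1 | P i) snoc y t ord0 i ^+ 2 =
  \sum_(i < n | P i) y ord0 i ^+ 2 + (if P n then t ^+ 2 else 0).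
Proof.
rewrite !(big_mkcond (fun i : 'I__ => P i)) big_ord_recr/=; congr (_ + _).
  apply: eq_bigr => i _; case: ifP => // _; rewrite -(snoc_lift y t).
  congr (snoc _ _ _ _ ^+ 2); apply: val_inj.
  by rewrite /= /bump leqNgt ltn_ord.
case: ifP => // _; rewrite -[in RHS](snoc_max y t); congr (snoc _ _ _ _ ^+ 2).
Qed.

Lemma enorm'_snoc (y : 'rV[R]_n) t :
  enorm' d (snoc y t) = Num.sqrt (enorm' d y ^+ 2 + t ^+ 2).
Proof. by rewrite /enorm' (sumsq_snoc (leq d)) dn sqr_sqrtr// sumsq_ge0. Qed.

Lemma open_cylinder (m : nat) :
  open [set y : 'rV[R]_m | ((enorm' d y)%:E < rho)%E].
Proof.
case: rho => [r||].
- rewrite (_ : mkset _ = enorm' d @^-1` [set t | t < r]).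
    by apply: open_comp; [move=> y _; exact: continuous_enorm'|exact: open_lt].
  by apply/seteqP; split => y /=; rewrite lte_fin.
- rewrite (_ : mkset _ = setT); first exact: openT.
  by apply/seteqP; split => y //= _; rewrite ltry.
- rewrite (_ : mkset _ = set0); first exact: open0.
  by apply/seteqP; split => y.
Qed.

Lemma open_Omega : open Om.
Proof.
rewrite (_ : Om = (fun x : E => x ord0 ord_max) @^-1` [set t | 0 < t] `&`
    [set y : E | ((enorm' d y)%:E < rho)%E]) //.
apply: openI; last exact: open_cylinder.
by apply: open_comp; [move=> x _; exact: continuous_coord|exact: open_gt].
Qed.

Lemma measurable_Omega : measurable Om.
Proof. exact: (open_rV_measurable open_Omega). Qed.

Lemma measurable_bdOmega : measurable (@bdOmega R n d rho).
Proof.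
apply: measurableD; last exact: measurable_Omega.
exact: (closed_rV_measurable (@closed_closure _ Om)).
Qed.

(** The charts in which the surface integral is written: the flat part of the
    boundary, and the projection of the spherical part with its parametrisation and
    area element. *)
Definition flat : set 'rV[R]_n := [set y | ((enorm' d y)%:E < rho)%E].
Definition cap (r : R) : set 'rV[R]_n := [set y | enorm' d y < r].
Definition capmap (r : R) (y : 'rV[R]_n) : E :=
  snoc y (Num.sqrt (r ^+ 2 - enorm' d y ^+ 2)).

Lemma measurable_flat : measurable flat.
Proof. exact: (open_rV_measurable (@open_cylinder n)). Qed.

Lemma measurable_cap r : measurable (cap r).
Proof.
apply: open_rV_measurable; rewrite (_ : cap r = enorm' d @^-1` [set t | t < r])//.
by apply: open_comp; [move=> y _; exact: continuous_enorm'|exact: open_lt].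
Qed.

Lemma flat_closure y : flat y -> closure Om (snoc y 0).
Proof.
move=> yf V V0.
have cf := @continuous_snocr R n y 0.
have oc : open [set t : R | ((enorm' d (snoc y t))%:E < rho)%E].
  apply: (@open_comp _ _ (fun t : R => snoc y t) [set y : E | ((enorm' d y)%:E < rho)%E]).
    by move=> t _; exact: continuous_snocr.
  exact: open_cylinder.
have n1 : \forall t \near (0 : R), ((enorm' d (snoc y t))%:E < rho)%E.
  apply: open_nbhs_nbhs; split => //=.
  by rewrite enorm'_snoc expr0n/= addr0 sqrtr_sqr ger0_norm ?enorm'_ge0.
have n2 : \forall t \near (0 : R), V (snoc y t) by exact: cf.
near (0 : R)^'+ => t.
exists (snoc y t); split; last first.
  by near: t; exact: cvg_at_right_filter n2.
split; first by rewrite snoc_max.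
by near: t; exact: cvg_at_right_filter n1.
Unshelve. all: by end_near. Qed.

Lemma flat_bdOmega y : flat y -> (@bdOmega R n d rho) (snoc y 0).
Proof.
move=> yf; split; first exact: flat_closure.
by case; rewrite snoc_max ltxx.
Qed.

Lemma measurable_snocD (D : set 'rV[R]_n) (f : 'rV[R]_n -> R) :
  measurable D -> measurable_fun D f ->
  measurable_fun D (fun y => snoc y (f y)).
Proof.
move=> mD mf; apply: measurable_fun_rVD => // i.
case: (snocP i) => [[j ->]|->].
  rewrite (_ : (fun _ => _) = (fun y : 'rV[R]_n => y ord0 j)).
    by apply: measurable_funTS; exact: measurable_rV_coordT.
  by apply/funext => y; rewrite snoc_lift.
by rewrite (_ : (fun _ => _) = f)//; apply/funext => y; rewrite snoc_max.
Qed.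

Lemma continuous_root (r : R) : continuous
  (fun y : 'rV[R]_n => Num.sqrt (r ^+ 2 - enorm' d y ^+ 2)).
Proof.
have c := @continuous_enorm' R n d.
have H : continuous (fun t : R => r ^+ 2 - t ^+ 2).
  by move=> t; apply: cvgB; [exact: cvg_cst|exact: exprn_continuous].
have H' : continuous (fun t : R => Num.sqrt (r ^+ 2 - t ^+ 2)).
  by move=> t; apply: continuous_comp; [exact: H|exact: sqrt_continuous].
by move=> y; exact: (@continuous_comp _ _ _ (enorm' d) _ y (c y) (H' _)).
Qed.

Lemma measurable_capmap r : measurable_fun [set: 'rV[R]_n] (capmap r).
Proof.
apply: measurable_snocD => //.
exact: (continuous_rV_measurable (@continuous_root r)).
Qed.

Lemma cap_root_gt0 r y : cap r y -> 0 < Num.sqrt (r ^+ 2 - enorm' d y ^+ 2).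
Proof.
by rewrite /cap/= => yr; rewrite sqrtr_gt0 subr_gt0 ltrXn2r// enorm'_ge0.
Qed.

Lemma enorm'_capmap r y : cap r y -> enorm' d (capmap r y) = r.
Proof.
move=> yr; have r0 : 0 <= r by rewrite (le_trans (enorm'_ge0 d y))// ltW.
rewrite enorm'_snoc (@sqr_sqrtr _ (r ^+ 2 - enorm' d y ^+ 2)) ?subrKC ?sqrtr_sqr ?ger0_norm//.
by rewrite subr_ge0 ltW// ltrXn2r// enorm'_ge0.
Qed.

Lemma cap_bdOmega r y : rho = r%:E -> cap r y ->
  (@bdOmega R n d rho) (capmap r y).
Proof.
move=> rhor yr; split; last first.
  by case => _; rewrite (enorm'_capmap yr) rhor ltxx.
move=> V V0; have t0 := cap_root_gt0 yr.
have r0 : 0 <= r by rewrite (le_trans (enorm'_ge0 d y))// ltW.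
set T : R := Num.sqrt _ in t0.
have n2 : \forall t \near (T : R), V (snoc y t) by exact: (@continuous_snocr R n y T).
near T^'- => t.
exists (snoc y t); split; last first.
  by near: t; exact: cvg_at_left_filter n2.
have tT : t < T by near: t; exact: nbhs_left_lt.
have tt : 0 < t by near: t; exact: nbhs_left_gt.
split; first by rewrite snoc_max.
rewrite rhor lte_fin -(enorm'_capmap yr) !enorm'_snoc ltr_sqrt ?ltrD2l ?ltrXn2r// ?ltW//.
by rewrite ltr_wpDl ?sqr_ge0// exprn_gt0.
Unshelve. all: by end_near. Qed.

Lemma measurable_capmap_bd r (f : E -> R) : rho = r%:E ->
  measurable_fun (@bdOmega R n d rho) f ->
  measurable_fun (cap r) (f \o capmap r).
Proof.
move=> rhor mf; apply: (measurable_comp measurable_bdOmega) mf _.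
  by move=> x [y yr <-]; exact: cap_bdOmega.
exact: measurable_funTS (measurable_capmap r).
Qed.

Lemma measurable_flat_bd (f : E -> R) :
  measurable_fun (@bdOmega R n d rho) f ->
  measurable_fun flat (fun y => f (snoc y 0)).
Proof.
move=> mf; apply: (measurable_comp measurable_bdOmega (g := fun y => snoc y 0)) mf _.
  by move=> x [y yr <-]; exact: flat_bdOmega.
by apply: measurable_snocD => //; exact: measurable_flat.
Qed.

Definition jac r (y : 'rV[R]_n) : R := r / Num.sqrt (r ^+ 2 - enorm' d y ^+ 2).

Lemma jac_gt0 r y : cap r y -> 0 < jac r y.
Proof.
move=> yr; have r0 : 0 < r by exact: le_lt_trans (enorm'_ge0 d y) yr.
by rewrite divr_gt0// cap_root_gt0.
Qed.

Lemma measurable_jac r : measurable_fun [set: 'rV[R]_n] (jac r).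
Proof.
rewrite (_ : jac r = (fun y => r * Num.sqrt (r ^+ 2 - enorm' d y ^+ 2) `^ (-1))).
  apply: measurable_funM => //.
  apply: (measurableT_comp (measurable_powR (-1))).
  exact: (continuous_rV_measurable (@continuous_root r)).
by apply/funext => y; rewrite powR_inv1 ?sqrtr_ge0.
Qed.

End domain_geometry.

(** * Powers and limits of integrals *)

Section integration_tools.
Variable R : realType.
Local Open Scope ereal_scope.

Lemma integral_supportE d (T : measurableType d) (m : {measure set T -> \bar R})
    (A B : set T) (F : T -> \bar R) :
  A `<=` B -> (forall x, B x -> ~ A x -> F x = 0) ->
  \int[m]_(x in A) F x = \int[m]_(x in B) F x.
Proof.
move=> AB F0; rewrite integral_mkcond [RHS]integral_mkcond; apply: eq_integral => x _.
rewrite !patchE; case: ifPn => [|]; rewrite ?inE ?notin_setE => Ax.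
  by rewrite mem_set//; exact: AB.
by case: ifPn => //; rewrite inE => Bx; rewrite F0.
Qed.

Lemma powR_add_le (p : R) (a b : R) : (0 <= p -> 0 <= a -> 0 <= b ->
  (a + b) `^ p <= 2 `^ p * (a `^ p + b `^ p))%R.
Proof.
move=> p0; wlog ab : a b / (a <= b)%R.
  by move=> H a0 b0; have [/H|/ltW/H] := leP a b; [apply|rewrite addrC (addrC (a `^ p)%R); apply].
move=> a0 b0; apply: (@le_trans _ _ ((2 * b) `^ p)%R).
  by apply: ge0_ler_powR => //; rewrite ?nnegrE; lra.
by rewrite powRM// ler_wpM2l ?powR_ge0// lerDr powR_ge0.
Qed.

(** If x > e then x^(1-p) <= e^(1-p). This converts smallness in L^p into smallness
    in L^1 on sets of finite measure. *)
Lemma powR_split (p e x : R) : (1 <= p -> 0 < e -> 0 <= x ->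
  x <= e + e `^ (1 - p) * x `^ p)%R.
Proof.
move=> p1 e0 x0; have [xe|xe] := leP x e.
  by rewrite ler_wpDr// mulr_ge0 ?powR_ge0.
have x1 := lt_trans e0 xe.
apply: (@le_trans _ _ (e `^ (1 - p) * x `^ p)%R); last by rewrite lerDr ltW.
rewrite -{1}(powRr1 x0) -[X in (x `^ X)%R](subrK p 1%R) powRD ?(gt_eqF x1) ?implybT//.
rewrite ler_wpM2r ?powR_ge0// -opprB !powRN lef_pV2 ?posrE ?powR_gt0//.
by apply: ge0_ler_powR; rewrite ?nnegrE; lra.
Qed.

Lemma cvge0P (f : nat -> \bar R) : (forall k, 0 <= f k) ->
  f k @[k --> \oo] --> 0 <->
  forall e : R, (0 < e)%R -> \forall k \near \oo, f k <= e%:E.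
Proof.
move=> f0; split.
  move=> /fine_cvgP[fin /cvgrPdist_le H] e e0.
  near=> k; have fk : f k \is a fin_num by near: k.
  rewrite -(fineK fk) lee_fin.
  have : (`|0 - fine (f k)| <= e)%R by near: k; exact: H.
  by rewrite sub0r normrN; apply: le_trans; exact: ler_norm.
move=> H; apply/fine_cvgP.
have fin : \forall k \near \oo, f k \is a fin_num.
  have := H 1%R ltr01; apply: filterS => k fk.
  by rewrite ge0_fin_numE ?f0// (le_lt_trans fk) ?ltry.
split => //; apply/cvgrPdist_le => e e0.
near=> k; have fk : f k \is a fin_num by near: k.
rewrite sub0r normrN /= ger0_norm ?fine_ge0// -lee_fin fineK//.
by near: k; exact: H.
Unshelve. all: by end_near. Qed.

(** Dominated convergence: the integrand tends to 0 pointwise below g. *)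
Lemma integral_tail d (T : measurableType d) (m : {measure set T -> \bar R})
    (D : set T) (g : T -> R) (e : R) :
  measurable D -> measurable_fun D g -> (forall x, D x -> 0 <= g x)%R ->
  \int[m]_(x in D) (g x)%:E < +oo -> (0 < e)%R ->
  exists k : nat, \int[m]_(x in D) (if (k%:R < g x)%R then g x else 0%R)%:E <= e%:E.
Proof.
move=> mD mg g0 gi e0.
pose f (k : nat) x := (if (k%:R < g x)%R then g x else 0%R)%:E.
have ig : m.-integrable D (EFin \o g).
  apply/integrableP; split; first exact/measurable_EFinP.
  rewrite (eq_integral (EFin \o g))// => x; rewrite inE => Dx /=.
  by rewrite ger0_norm// g0.
have mf k : measurable_fun D (f k).
  apply/measurable_EFinP.
  have mk : measurable_fun [set: R] (fun t : R => if (k%:R < t)%R then t else 0%R).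
    by apply: measurable_fun_ifT => //; exact: measurable_fun_ltr.
  exact: (measurableT_comp mk mg).
have f0 k x : D x -> 0 <= f k x.
  by move=> Dx; rewrite /f; case: ifP; rewrite lee_fin// g0.
have H : \int[m]_(x in D) f k x @[k --> \oo] --> \int[m]_(x in D) (cst 0 x : \bar R).
  have [//||||||_ _ //] := @dominated_convergence _ T R m D _ f (cst 0) (EFin \o g).
  - exact: mf.
  - exact: measurable_cst.
  - apply: aeW => x Dx; apply: cvg_near_cst.
    exists (Num.trunc (g x)).+1 => // k /= kx; rewrite /f ifF//.
    apply/negbTE; rewrite -leNgt (le_trans (ltW (truncnS_gt _)))//.
    by rewrite ler_nat.
  - exact: ig.
  - apply: aeW => x k Dx; rewrite gee0_abs ?f0// /f /=.
    by case: ifP => _; rewrite lee_fin ?g0.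
rewrite integral0 in H.
have /cvge0P H' : forall k, 0 <= \int[m]_(x in D) f k x.
  by move=> k; apply: integral_ge0 => x; exact: f0.
by have [k _ Hk] := H'.1 H e e0; exists k; exact: Hk (leqnn k).
Qed.

(** By Fatou's lemma the lower limit of the F_k has integral 0; it is F0 almost
    everywhere. *)
Lemma fatou_ae0 d (T : measurableType d) (m : {measure set T -> \bar R})
    (D : set T) (F : nat -> T -> R) (F0 : T -> R) :
  measurable D -> (forall k, measurable_fun D (F k)) ->
  (forall k x, D x -> 0 <= F k x)%R ->
  \int[m]_(x in D) (F k x)%:E @[k --> \oo] --> 0 ->
  (\forall x \ae m, D x -> \forall k \near \oo, F k x = F0 x) ->
  \forall x \ae m, D x -> F0 x = 0%R.
Proof.
move=> mD mF F_ge0 F_to F_F0.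
pose L x := limn_einf (fun k => (F k x)%:E).
have L_ge0 x : D x -> 0 <= L x.
  move=> Dx; rewrite /L limn_einf_lim; apply: lime_ge; first exact: is_cvg_einfs.
  apply: nearW => k; apply: le_ereal_inf_tmp => _ [j _ <-].
  by rewrite lee_fin F_ge0.
have mL : measurable_fun D L.
  apply: (emeasurable_fun_cvg (fun k x => einfs (fun j => (F j x)%:E) k)).
    by move=> k; apply: (measurable_fun_einfs (f := fun k x => (F k x)%:E)) => j;
      exact/measurable_EFinP.
  by move=> x Dx; rewrite /L limn_einf_lim; exact: is_cvg_einfs.
have : \int[m]_(x in D) L x = 0.
  apply/eqP; rewrite eq_le integral_ge0//= andbT.
  apply: le_trans (fatou _ _ _ _) _ => //.
  - by move=> k; exact/measurable_EFinP.
  - by rewrite (cvg_limn_einf_sup F_to).1.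
rewrite (@eq_integral _ _ _ m D (fun x => `|L x|)); last first.
  by move=> x; rewrite inE => Dx; rewrite gee0_abs// L_ge0.
move/(ae_eq_integral_abs m mD mL); rewrite /ae_eq.
move: F_F0; apply: filterS2 => x FF LL Dx.
have : L x = (F0 x)%:E.
  apply: (cvg_limn_einf_sup _).1; apply: cvg_near_cst.
  by move: (FF Dx); apply: filterS => k ->.
by rewrite LL// => -[].
Qed.

End integration_tools.

Section more_integration.
Context d (T : measurableType d) (R : realType).
Variables (m : {measure set T -> \bar R}) (D : set T).
Hypothesis mD : measurable D.
Local Open Scope ereal_scope.

Lemma le_integral_lin2 (a b : R) (F G H : T -> R) :
  (0 <= a)%R -> (0 <= b)%R ->
  measurable_fun D F -> measurable_fun D G -> measurable_fun D H ->
  (forall x, D x -> 0 <= F x)%R -> (forall x, D x -> 0 <= G x)%R ->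
  (forall x, D x -> 0 <= H x <= a * F x + b * G x)%R ->
  \int[m]_(x in D) (H x)%:E <=
    a%:E * \int[m]_(x in D) (F x)%:E + b%:E * \int[m]_(x in D) (G x)%:E.
Proof.
move=> a0 b0 mF mG mH F0 G0 H0.
rewrite -!ge0_integralZl//; do ?exact/measurable_EFinP.
rewrite -ge0_integralD//; do ?[by apply: measurable_funeM; exact/measurable_EFinP |
  by move=> x Dx; rewrite mule_ge0// lee_fin ?F0 ?G0].
apply: ge0_le_integral => //.
- by move=> x Dx; rewrite lee_fin; case/andP: (H0 x Dx).
- exact/measurable_EFinP.
- by apply: emeasurable_funD; apply: measurable_funeM; exact/measurable_EFinP.
- by move=> x Dx; rewrite -!EFinM -EFinD lee_fin; case/andP: (H0 x Dx).
Qed.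

Lemma le_integral_affine (a b : R) (F H : T -> R) :
  (0 <= a)%R -> (0 <= b)%R -> measurable_fun D F -> measurable_fun D H ->
  (forall x, D x -> 0 <= F x)%R ->
  (forall x, D x -> 0 <= H x <= a * F x + b)%R ->
  \int[m]_(x in D) (H x)%:E <= a%:E * \int[m]_(x in D) (F x)%:E + b%:E * m D.
Proof.
move=> a0 b0 mF mH F0 H0.
have := @le_integral_lin2 a b F (cst 1%R) H a0 b0 mF _ mH F0.
rewrite -(mul1e (m D)) -integral_cst//; apply => //.
by move=> x Dx; rewrite mulr1; exact: H0.
Qed.

End more_integration.

(** * Traces of nonlinear functions of u *)

Section traces.
Variables (R : realType) (n d : nat) (rho : \bar R) (p : R).
Hypotheses (dn : (d <= n)%N) (p1 : 1 < p).
Local Notation E := 'rV[R]_n.+1.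
Local Notation Om := (@Omega R n d rho).
Local Notation bd := (@bdOmega R n d rho).
Local Notation mu := (leb R n.+1).
Implicit Types (u v phi T : E -> R) (G : E -> E).

Lemma surface_integral_ge0 (f : E -> \bar R) : (forall x, bd x -> (0 <= f x)%E) ->
  (0 <= surface_integral d rho f)%E.
Proof.
move=> f0; apply: adde_ge0.
  by apply: integral_ge0 => y yf; exact/f0/flat_bdOmega.
case rhoE : {1}rho => [r||]//; apply: integral_ge0 => y yc.
apply: mule_ge0; first exact/f0/cap_bdOmega.
by rewrite lee_fin ltW//; exact: jac_gt0.
Qed.

Lemma le_surface_integral (f g : E -> R) :
  measurable_fun bd f -> measurable_fun bd g ->
  (forall x, bd x -> 0 <= f x <= g x) ->
  (surface_integral d rho (EFin \o f) <= surface_integral d rho (EFin \o g))%E.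
Proof.
move=> mf mg fg; apply: leeD.
  apply: ge0_le_integral.
  - exact: (@measurable_flat R n d rho).
  - by move=> y /(flat_bdOmega dn)/fg/andP[].
  - apply/measurable_EFinP; exact: measurable_flat_bd.
  - apply/measurable_EFinP; exact: measurable_flat_bd.
  - by move=> y /(flat_bdOmega dn)/fg/andP[_]; rewrite lee_fin.
case rhoE : {1 2}rho => [r||]//.
have mj : measurable_fun (@cap R n d r) (@jac R n d r).
  by apply: measurable_funTS; exact: measurable_jac.
apply: ge0_le_integral.
- exact: measurable_cap.
- move=> y yc; have /andP[f0 _] := fg _ (cap_bdOmega dn rhoE yc).
  by apply: mule_ge0 => //; rewrite lee_fin ltW//; exact: jac_gt0.
- apply: emeasurable_funM; apply/measurable_EFinP => //.
  exact: (measurable_capmap_bd dn rhoE mf).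
- apply: emeasurable_funM; apply/measurable_EFinP => //.
  exact: (measurable_capmap_bd dn rhoE mg).
- move=> y yc; have /andP[_ fgy] := fg _ (cap_bdOmega dn rhoE yc).
  by apply: lee_wpmul2r; rewrite lee_fin// ltW//; exact: jac_gt0.
Qed.

(** A function with its gradient and trace, together with the measurability in the
    domain that [is_trace] does not mention. *)
Definition trace_data u G T : Prop :=
  [/\ measurable_fun Om u, forall i, measurable_fun Om (fun x => G x ord0 i) &
      is_trace d rho p u G T].

Definition sobolev_gap v u G x : R :=
  `|v x - u x| `^ p + enorm (grad v x - G x) `^ p.

Lemma sobolev_gap_ge0 v u G x : 0 <= sobolev_gap v u G x.
Proof. by rewrite addr_ge0 ?powR_ge0. Qed.

Lemma Ck1_measurable v : Ck 1 v -> measurable_fun [set: E] v.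
Proof. by move=> v1; exact: (continuous_rV_measurable (Ck1_continuous v1)). Qed.

Lemma Ck1_measurable_grad v i : Ck 1 v -> measurable_fun [set: E] (partial i v).
Proof. by move=> v1; case: (v1) => _ c; exact: (continuous_rV_measurable (c i)). Qed.

Lemma measurable_enormD (D : set E) G : measurable D ->
  (forall i, measurable_fun D (fun x => G x ord0 i)) ->
  measurable_fun D (fun x => enorm (G x)).
Proof.
move=> mD mG; apply: (measurableT_comp (@measurable_enorm R n.+1)).
exact: measurable_fun_rVD.
Qed.

Lemma measurable_powRD (D : set E) (f : E -> R) a :
  measurable_fun D f -> measurable_fun D (fun x => f x `^ a).
Proof. by move=> mf; exact: (measurableT_comp (measurable_powR a) mf). Qed.

Lemma measurable_normD (D : set E) (f : E -> R) :
  measurable_fun D f -> measurable_fun D (fun x => `|f x|).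
Proof.
have mn : measurable_fun [set: R] (fun t : R => `|t|).
  by apply: continuous_measurable_fun; exact: norm_continuous.
by move=> mf; exact: (measurableT_comp mn mf).
Qed.

Lemma measurable_gap v u G : Ck 1 v -> measurable_fun Om u ->
  (forall i, measurable_fun Om (fun x => G x ord0 i)) ->
  measurable_fun Om (sobolev_gap v u G).
Proof.
move=> v1 m_u mG; have mOm := @measurable_Omega R n d rho.
apply: measurable_funD; apply: measurable_powRD.
  apply: measurable_normD; apply: measurable_funB => //.
  by apply: measurable_funTS; exact: Ck1_measurable.
apply: measurable_enormD => // i.
rewrite (_ : (fun _ => _) = (fun x => partial i v x - G x ord0 i)); last first.
  by apply/funext => x; rewrite !mxE.
apply: measurable_funB => //.
by apply: measurable_funTS; exact: Ck1_measurable_grad.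
Qed.

Lemma Ck1_bounded v (V : set E) : Ck 1 v -> bounded_set V ->
  exists2 C, 0 <= C & forall x, V x -> `|v x| <= C /\ enorm (grad v x) <= C.
Proof.
move=> v1 /bounded_sub_cube[M VM].
have [C1 H1] := continuous_bounded_cube M (Ck1_continuous v1).
have cg : continuous (fun x => grad v x).
  apply: continuous_rV => i; rewrite (_ : (fun _ => _) = partial i v).
    by case: v1.
  by apply/funext => x; rewrite mxE.
have ceg : continuous (fun x => enorm (grad v x)).
  by move=> x; exact: (@continuous_comp _ _ _ (grad v) _ x (cg x) (@continuous_enorm R n.+1 _)).
have [C2 H2] := continuous_bounded_cube M ceg.
exists (`|C1| + `|C2|); first by rewrite addr_ge0.
move=> x /VM xM; have := H1 x xM; have := H2 x xM.
rewrite (ger0_norm (enorm_ge0 _)) => h2 h1; split.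
  by rewrite (le_trans h1)// (le_trans (ler_norm _))// lerDl.
by rewrite (le_trans h2)// (le_trans (ler_norm _))// lerDr.
Qed.

(** One of the approximating functions is at finite distance from u, and it is
    bounded together with its gradient on bounded sets. *)
Lemma trace_Lp u G T (V : set E) : trace_data u G T ->
  open V -> bounded_set V -> off_Gamma d V ->
  (\int[mu]_(x in Om `&` V) (`|u x| `^ p + enorm (G x) `^ p)%:E < +oo)%E.
Proof.
move=> [m_u mG [mT tr]] oV bV gV.
have [v [v1 vu _]] := tr V oV bV gV.
have mOm := @measurable_Omega R n d rho.
have mV : measurable V := open_rV_measurable oV.
have mD : measurable (Om `&` V) by exact: measurableI.
have /cvge0P H : forall k, (0 <= \int[mu]_(x in Om `&` V) (sobolev_gap (v k) u G x)%:E)%E.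
  by move=> k; apply: integral_ge0 => x _; rewrite lee_fin sobolev_gap_ge0.
have [k _ /(_ k (leqnn k)) Hk] := H.1 vu 1 ltr01.
have [C C0 HC] := Ck1_bounded (v1 k) bV.
have p0 : 0 <= p by rewrite ltW// (lt_trans ltr01).
apply: (@le_lt_trans _ _ ((2 `^ p)%:E * \int[mu]_(x in Om `&` V) (sobolev_gap (v k) u G x)%:E
   + (2 `^ p * (C `^ p + C `^ p))%:E * mu (Om `&` V))%E).
  apply: le_integral_affine => //.
  - by rewrite mulr_ge0 ?addr_ge0 ?powR_ge0.
  - by apply: (measurable_funS mOm) => //; exact: measurable_gap.
  - apply: (measurable_funS mOm) => //; apply: measurable_funD; apply: measurable_powRD.
      exact: measurable_normD.
    exact: measurable_enormD.
  - by move=> x _; exact: sobolev_gap_ge0.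
  - move=> x [Ox Vx]; rewrite addr_ge0 ?powR_ge0//= /sobolev_gap.
    have [hv hg] := HC x Vx.
    have h1 : `|u x| `^ p <= 2 `^ p * (`|v k x - u x| `^ p + C `^ p).
      apply: le_trans (powR_add_le p0 _ _) => //.
      apply: ge0_ler_powR => //; rewrite ?nnegrE ?addr_ge0//.
      rewrite {1}(_ : u x = - (v k x - u x) + v k x); last by ring.
      by rewrite (le_trans (ler_normD _ _))// normrN lerD2l.
    have h2 : enorm (G x) `^ p <= 2 `^ p * (enorm (grad (v k) x - G x) `^ p + C `^ p).
      apply: le_trans (powR_add_le p0 _ _) => //; rewrite ?enorm_ge0//.
      apply: ge0_ler_powR => //; rewrite ?nnegrE ?addr_ge0 ?enorm_ge0//.
      rewrite {1}(_ : G x = (-1) *: (grad (v k) x - G x) + grad (v k) x); last first.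
        by rewrite scaleN1r opprB subrK.
      by rewrite (le_trans (enormD _ _))// enormZ normrN1 mul1r lerD2l.
    by apply: le_trans (lerD h1 h2) _; rewrite le_eqVlt; apply/orP; left; apply/eqP; ring.
apply: lte_add_pinfty; apply: lte_mul_pinfty => //.
- by rewrite (le_lt_trans Hk)// ltry.
- by rewrite lee_fin mulr_ge0 ?addr_ge0 ?powR_ge0.
- apply: le_lt_trans (leb_bounded_lty mV bV); apply: le_measure; rewrite ?inE//.
Qed.

Lemma powR_add3_le (a b c : R) : 0 <= a -> 0 <= b -> 0 <= c ->
  (a + b + c) `^ p <= 4 `^ p * (a `^ p + b `^ p + c `^ p).
Proof.
move=> a0 b0 c0; have p0 : 0 <= p by rewrite ltW// (lt_trans ltr01).
apply: le_trans (powR_add_le p0 (addr_ge0 a0 b0) c0) _.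
have -> : 4 `^ p = 2 `^ p * 2 `^ p :> R by rewrite -powRM//; congr (_ `^ p); lra.
rewrite -mulrA ler_wpM2l ?powR_ge0// mulrDr lerD ?powR_add_le//.
rewrite ler_peMl ?powR_ge0// -{1}(powRr0 2) ler_powR//; lra.
Qed.

Let chain_arith (X Y a b C l D t : R) :
  0 <= X * a -> 0 <= X * C * b -> 0 <= X * l * b -> 0 <= b ->
  X * D <= X * (l * a + Y * t) ->
  a + X * (b + D + C * a) <= (1 + X * (1 + l + C)) * (a + b) + X * Y * t.
Proof. lra. Qed.

(** Chain and product rule for traces. If v_k of class C^1 approximates u then
    h(v_k) z approximates h(u) z. The only term of the gradient that is not
    Lipschitz in v_k is (h'(v_k) - h'(u)) G: where |G|^p <= m it is at most
    m^(1/p) L |v_k - u|, and elsewhere it is at most 2 |G|, whose integral over this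
    set is small for large m. *)
Lemma trace_chain u G T (h h' : R -> R) L (z : E -> R) (gz : 'I_n.+1 -> E -> R) :
  trace_data u G T ->
  (forall t : R, is_derive t 1 h (h' t)) -> continuous h' ->
  (forall t, `|h' t| <= 1) -> (forall s t, `|h s - h t| <= `|s - t|) ->
  0 <= L -> (forall s t, `|h' s - h' t| <= L * `|s - t|) ->
  C1_grad z gz -> (forall x, 0 <= z x <= 1) ->
  trace_data (fun x => h (u x) * z x)
    (fun x => (h' (u x) * z x) *: G x + h (u x) *: \row_i gz i x)
    (fun x => h (T x) * z x).
Proof.
move=> [m_u mG [mT tr]] hh' ch' h'1 hlip L0 h'lip zg z01.
have p0 : 0 <= p by rewrite ltW// (lt_trans ltr01).
have z1 := C1_gradW zg; have mz := Ck1_measurable z1.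
have ch : continuous h.
  move=> t; apply: differentiable_continuous; apply/derivable1_diffP.
  by have [] := hh' t.
have mh := continuous_measurable_fun ch; have mh' := continuous_measurable_fun ch'.
have mOm := @measurable_Omega R n d rho.
have mbd := @measurable_bdOmega R n d rho.
have mphi : measurable_fun Om (fun x => h (u x) * z x).
  apply: measurable_funM; first exact: (measurableT_comp mh).
  exact: measurable_funTS.
have mH i : measurable_fun Om (fun x =>
    ((h' (u x) * z x) *: G x + h (u x) *: \row_i gz i x) ord0 i).
  rewrite (_ : (fun _ => _) = (fun x => h' (u x) * z x * G x ord0 i + h (u x) * partial i z x)).
    apply: measurable_funD; apply: measurable_funM => //.
    - by apply: measurable_funM; [exact: (measurableT_comp mh')|exact: measurable_funTS].
    - exact: (measurableT_comp mh).
    - by apply: measurable_funTS; exact: Ck1_measurable_grad.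
  by apply/funext => x; rewrite !mxE; case: zg => _ ->.
have mphiT : measurable_fun bd (fun x => h (T x) * z x).
  apply: measurable_funM; first exact: (measurableT_comp mh).
  exact: measurable_funTS.
split; [exact: mphi|exact: mH|split; [exact: mphiT|move=> V oV bV gV]].
have [v [v1 vu vT]] := tr V oV bV gV.
have mV : measurable V := open_rV_measurable oV.
have mD : measurable (Om `&` V) by exact: measurableI.
pose w k x := h (v k x) * z x.
have wg k := C1_gradM (C1_grad_comp hh' ch' (Ck1_grad (v1 k))) zg.
exists w; split => [k||].
- exact: C1_gradW (wg k).
- have [C C0 HC] := Ck1_bounded z1 bV.
  pose g x := enorm (G x) `^ p.
  have mg : measurable_fun Om g by apply: measurable_powRD; exact: measurable_enormD.
  have gi : (\int[mu]_(x in Om `&` V) (g x)%:E < +oo)%E.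
    apply: le_lt_trans (trace_Lp (And3 m_u mG (conj mT tr)) oV bV gV).
    apply: ge0_le_integral => //.
    - by move=> x _; rewrite lee_fin powR_ge0.
    - by apply/measurable_EFinP; exact: (measurable_funS mOm).
    - apply/measurable_EFinP; apply: (measurable_funS mOm) => //.
      by apply: measurable_funD => //; apply: measurable_powRD; exact: measurable_normD.
    - by move=> x _; rewrite lee_fin lerDr powR_ge0.
  apply/cvge0P.
    by move=> k; apply: integral_ge0 => x _; rewrite lee_fin addr_ge0 ?powR_ge0.
  move=> e e0; pose c : R := 4 `^ p * 2 `^ p.
  have c0 : 0 < c by rewrite mulr_gt0 ?powR_gt0.
  (* The level m makes the contribution of |G|^p > m at most e/2; K is the Lipschitz
     constant that remains once m is chosen. *)
  have [m Hm] := @integral_tail _ _ _ mu (Om `&` V) g (e / 2 / c) mD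
    (measurable_funS mOm (@subIsetl _ _ _) mg) (fun x _ => powR_ge0 _ _) gi
    ltac:(by rewrite !divr_gt0).
  pose K : R := 1 + 4 `^ p * (1 + L `^ p * m%:R + C `^ p).
  have K0 : 0 < K.
    by rewrite ltr_pwDl// mulr_ge0 ?powR_ge0// !addr_ge0 ?mulr_ge0 ?powR_ge0.
  have /cvge0P Hv : forall k, (0 <= \int[mu]_(x in Om `&` V) (sobolev_gap (v k) u G x)%:E)%E.
    by move=> k; apply: integral_ge0 => x _; rewrite lee_fin sobolev_gap_ge0.
  have := Hv.1 vu (e / 2 / K) ltac:(by rewrite !divr_gt0); apply: filterS => k Hk.
  apply: (@le_trans _ _ (K%:E * \int[mu]_(x in Om `&` V) (sobolev_gap (v k) u G x)%:E +
    c%:E * \int[mu]_(x in Om `&` V) (if m%:R < g x then g x else 0)%:E)%E); last first.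
    apply: (@le_trans _ _ (K%:E * (e / 2 / K)%:E + c%:E * (e / 2 / c)%:E)%E).
      by apply: leeD; apply: lee_wpmul2l => //; rewrite lee_fin ltW.
    rewrite -!EFinM -EFinD lee_fin le_eqVlt; apply/orP; left; apply/eqP.
    by field; rewrite !gt_eqF.
  apply: le_integral_lin2 => //.
  - exact: ltW.
  - exact: ltW.
  - by apply: (measurable_funS mOm) => //; exact: measurable_gap.
  - apply: (measurable_funS mOm) => //.
    have mk : measurable_fun [set: R] (fun t : R => if (m%:R < t) then t else 0).
      by apply: measurable_fun_ifT => //; exact: measurable_fun_ltr.
    exact: (measurableT_comp mk mg).
  - apply: (measurable_funS mOm) => //.
    by apply: (@measurable_gap (w k)) => //; exact: C1_gradW (wg k).
  - by move=> x _; exact: sobolev_gap_ge0.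
  - by move=> x _; case: ifP => //; rewrite powR_ge0.
  move=> x [Ox Vx]; rewrite addr_ge0 ?powR_ge0//=.
  have [hz hgz] := HC x Vx; have /andP[z0x z1x] := z01 x.
  set a := `|v k x - u x|; set b := enorm (grad (v k) x - G x).
  pose del := `|h' (v k x) - h' (u x)|.
  have a0 : 0 <= a := normr_ge0 _.
  have b0 : 0 <= b := enorm_ge0 _.
  have del0 : 0 <= del := normr_ge0 _.
  have H1 : `|w k x - h (u x) * z x| <= a.
    rewrite /w -mulrBl normrM (ger0_norm z0x) -[leRHS]mulr1.
    by apply: ler_pM => //; exact: hlip.
  have H2 : enorm (grad (w k) x - ((h' (u x) * z x) *: G x + h (u x) *: \row_i gz i x)) <=
      b + del * enorm (G x) + C * a.
    rewrite (_ : _ - _ = (z x * h' (v k x)) *: (grad (v k) x - G x) +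
       (z x * (h' (v k x) - h' (u x))) *: G x +
       (h (v k x) - h (u x)) *: grad z x); last first.
      rewrite (C1_gradE x (wg k)) (C1_gradE x zg).
      by apply/rowP => i; rewrite !mxE; ring.
    apply: le_trans (enormD _ _) _; apply: lerD.
      apply: le_trans (enormD _ _) _; rewrite !enormZ; apply: lerD.
        rewrite -[leRHS]mul1r ler_wpM2r ?enorm_ge0// normrM (ger0_norm z0x).
        by rewrite -[leRHS]mulr1; apply: ler_pM.
      by rewrite ler_wpM2r ?enorm_ge0// normrM (ger0_norm z0x) ler_piMl.
    rewrite enormZ mulrC; apply: ler_pM => //; first exact: enorm_ge0.
  have H3 : (del * enorm (G x)) `^ p <=
      L `^ p * m%:R * a `^ p + 2 `^ p * (if m%:R < g x then g x else 0).
    rewrite (powRM _ del0 (enorm_ge0 _)) -/(g x); case: ifPn => [mgx|].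
      rewrite ler_wpDl ?mulr_ge0 ?powR_ge0//.
      rewrite ler_wpM2r ?powR_ge0//; apply: ge0_ler_powR; rewrite ?nnegrE//.
      rewrite (le_trans (ler_normB _ _))//.
      by rewrite (_ : 2 = 1 + 1) ?lerD//; lra.
    rewrite -leNgt => mgx; rewrite mulr0 addr0 mulrAC -(powRM _ L0 a0).
    apply: ler_pM; rewrite ?powR_ge0//; apply: ge0_ler_powR; rewrite ?nnegrE ?mulr_ge0//.
    exact: h'lip.
  rewrite -/(sobolev_gap _ _ _ _) /sobolev_gap -/a -/b.
  set t := (if _ then _ else _) in H3 *.
  have t0 : 0 <= t by rewrite /t; case: ifP => //; rewrite powR_ge0.
  have P1 : `|w k x - h (u x) * z x| `^ p <= a `^ p by apply: ge0_ler_powR; rewrite ?nnegrE.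
  have P2 := ge0_ler_powR p0 _ _ H2.
  have P3 := powR_add3_le b0 (mulr_ge0 del0 (enorm_ge0 (G x))) (mulr_ge0 C0 a0).
  apply: le_trans (lerD P1 (le_trans (P2 _ _) P3)) _; rewrite ?nnegrE ?enorm_ge0//.
    by rewrite !addr_ge0 ?mulr_ge0 ?enorm_ge0.
  rewrite (powRM _ C0 a0) /K /c.
  have A0 := powR_ge0 a p; have B0 := powR_ge0 b p.
  have q0 := powR_ge0 4 p; have C1 := powR_ge0 C p.
  have Lm : 0 <= L `^ p * m%:R by rewrite mulr_ge0 ?powR_ge0.
  set DD := (_ * enorm _) `^ p in H3 *.
  exact: (chain_arith (mulr_ge0 q0 A0) (mulr_ge0 (mulr_ge0 q0 C1) B0)
    (mulr_ge0 (mulr_ge0 q0 Lm) B0) B0 (ler_wpM2l q0 H3)).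
- pose f k x := (`|v k x - T x| `^ p * \1_V x : R).
  pose f' k x := (`|w k x - h (T x) * z x| `^ p * \1_V x : R).
  have mf v' T' : measurable_fun [set: E] v' -> measurable_fun bd T' ->
     measurable_fun bd (fun x : E => `|v' x - T' x| `^ p * \1_V x).
    move=> mv' mT'; apply: measurable_funM.
      apply: measurable_powRD; apply: measurable_normD; apply: measurable_funB => //.
      exact: measurable_funTS.
    by apply: measurable_funTS; exact: measurable_indic.
  apply: (@squeeze_cvge _ _ _ _ (cst 0%E) _ (fun k => surface_integral d rho (EFin \o f k))).
  - apply: nearW => k; apply/andP; split.
      apply: surface_integral_ge0 => x _.
      by rewrite lee_fin mulr_ge0 ?powR_ge0// indicE.
    apply: (@le_surface_integral (f' k) (f k)).
    + by apply: mf => //; apply: Ck1_measurable; exact: C1_gradW (wg k).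
    + by apply: mf => //; exact: Ck1_measurable.
    + move=> x bx; rewrite /f /f' mulr_ge0 ?powR_ge0 ?indicE//=.
      rewrite ler_wpM2r//; apply: ge0_ler_powR; rewrite ?nnegrE//.
      have /andP[z0x z1x] := z01 x.
      rewrite /w -mulrBl normrM (ger0_norm z0x) -[leRHS]mulr1.
      by apply: ler_pM => //; exact: hlip.
  - exact: cvg_cst.
  - exact: vT.
Qed.

End traces.

(** * Weak gradients of limits of C^1 functions *)

Section weak_gradients.
Variables (R : realType) (n d : nat) (rho : \bar R) (p : R).
Hypotheses (dn : (d <= n)%N) (p1 : 1 < p).
Local Notation E := 'rV[R]_n.+1.
Local Notation Om := (@Omega R n d rho).
Local Notation mu := (leb R n.+1).
Local Notation trace_data := (trace_data d rho p).
Implicit Types (u v phi S : E -> R) (H : E -> E).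

(** The coordinate x_N has a positive minimum on K and vanishes on Gamma. *)
Lemma compact_nbhd (K : set E) : compact K -> K `<=` Om ->
  exists V, [/\ open V, bounded_set V, off_Gamma d V & K `<=` V].
Proof.
move=> cK KO.
have [M KM] := bounded_sub_cube (compact_bounded cK).
have [c c0 cP] : exists2 c : R, 0 < c & forall x, K x -> c < x ord0 ord_max.
  have [->|/set0P K0] := eqVneq K set0; first by exists 1.
  have [x0] := EVT_min_rV K0 cK (continuous_subspaceT (@continuous_coord R n.+1 ord_max)).
  rewrite inE => /KO [x00 _] Hx; exists (x0 ord0 ord_max / 2); first by rewrite divr_gt0.
  move=> x Kx; have := Hx x; rewrite inE => /(_ Kx); lra.
exists ([set x : E | c < x ord0 ord_max] `&` ball 0 (`|M| + 1)); split.
- apply: openI; last exact: ball_open.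
  rewrite (_ : mkset _ = (fun x : E => x ord0 ord_max) @^-1` [set t | c < t])//.
  by apply: open_comp; [move=> x _; exact: continuous_coord|exact: open_gt].
- have [N [NR HN]] := @cube_bounded R n.+1 (`|M| + 1).
  exists N; split => // r Nr x [_ /= [_ Hx]]; apply: (HN r Nr x) => i.
  have := Hx ord0 i.
  by rewrite -ball_normE /ball_/= mxE sub0r normrN => /ltW.
- apply/seteqP; split => // x [Vx Gx].
  have : (closure [set x : E | c <= x ord0 ord_max]) x.
    by apply: closure_subset Vx => y [/= /ltW].
  have cl : closed [set x : E | c <= x ord0 ord_max].
    rewrite (_ : mkset _ = (fun x : E => x ord0 ord_max) @^-1` [set t | c <= t])//.
    by apply: closed_comp; [move=> y _; exact: continuous_coord|exact: closed_ge].
  rewrite -(closure_id _).1//= => cx.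
  by move: cx; rewrite (Gx ord_max dn) leNgt c0.
- move=> x Kx; split; first exact: cP.
  split; first by rewrite ltr_wpDl.
  move=> i j; rewrite ord1 -ball_normE /ball_/= mxE sub0r normrN.
  by rewrite (le_lt_trans (KM x Kx j))// (le_lt_trans (ler_norm _))// ltrDl.
Qed.

Lemma coord_sub_le_enorm (a b : E) i : `|a ord0 i - b ord0 i| <= enorm (a - b).
Proof. by have := coord_le_enorm (a - b) i; rewrite !mxE. Qed.

Lemma trace_L1 phi H S (V : set E) : trace_data phi H S ->
  open V -> bounded_set V -> off_Gamma d V ->
  mu.-integrable (Om `&` V) (fun x => (`|phi x| + enorm (H x))%:E).
Proof.
move=> td oV bV gV; have [mphi mH _] := td.
have mOm := @measurable_Omega R n d rho.
have mV : measurable V := open_rV_measurable oV.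
have mD : measurable (Om `&` V) by exact: measurableI.
have m1 : measurable_fun (Om `&` V) (fun x => `|phi x| + enorm (H x)).
  apply: (measurable_funS mOm) => //; apply: measurable_funD.
    exact: measurable_normD.
  exact: measurable_enormD.
have m2 : measurable_fun (Om `&` V) (fun x => `|phi x| `^ p + enorm (H x) `^ p).
  apply: (measurable_funS mOm) => //; apply: measurable_funD; apply: measurable_powRD.
    exact: measurable_normD.
  exact: measurable_enormD.
apply/integrableP; split; first exact/measurable_EFinP.
rewrite (@eq_integral _ _ _ _ _ (fun x => (`|phi x| + enorm (H x))%:E)); last first.
  by move=> x _; rewrite gee0_abs// lee_fin addr_ge0 ?enorm_ge0.
apply: (@le_lt_trans _ _ (1%:E * \int[mu]_(x in Om `&` V)
   (`|phi x| `^ p + enorm (H x) `^ p)%:E + 2%:E * mu (Om `&` V))%E).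
  apply: le_integral_affine => // x _; first by rewrite addr_ge0 ?powR_ge0.
  rewrite addr_ge0 ?enorm_ge0//=.
  have := @powR_split R p 1 `|phi x| (ltW p1) ltr01 (normr_ge0 _).
  have := @powR_split R p 1 (enorm (H x)) (ltW p1) ltr01 (enorm_ge0 _).
  rewrite powR1; lra.
apply: lte_add_pinfty; apply: lte_mul_pinfty => //; first exact: trace_Lp td _ _ _.
apply: le_lt_trans (leb_bounded_lty mV bV); apply: le_measure; rewrite ?inE//.
Qed.

Lemma zero_off_support (f : E -> R) i x :
  ~ closure [set x | f x != 0] x -> f x = 0 /\ partial i f x = 0.
Proof.
move=> xK.
have f0 y : ~ closure [set x | f x != 0] y -> f y = 0.
  move=> yK; apply/eqP; apply: contrapT => /negP fy; apply: yK.
  exact: subset_closure.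
split; first exact: f0.
rewrite /partial (near_eq_derive (g := cst 0)) ?derive_cst//.
have : nbhs x (~` closure [set x | f x != 0]).
  by apply: open_nbhs_nbhs; split => //; apply: closed_openC; exact: closed_closure.
by apply: filterS => y /f0.
Qed.

Lemma approx_parts phi H S v f i (V : set E) (M : R) :
  trace_data phi H S -> Ck 1 v -> Ck 1 f -> (forall x, ~ cube n.+1 M x -> f x = 0) ->
  open V -> bounded_set V -> off_Gamma d V ->
  (forall x, ~ (Om `&` V) x -> f x = 0 /\ partial i f x = 0) ->
  (\int[mu]_(x in Om `&` V) (v x * partial i f x + f x * partial i v x)%:E = 0)%E /\
  mu.-integrable (Om `&` V) (fun x => (v x * partial i f x + f x * partial i v x)%:E).
Proof.
move=> td v1 f1 fM oV bV gV fout; split.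
  rewrite -(integration_by_parts i v1 f1 fM); apply: integral_supportE => // x _ /fout[-> ->].
  by rewrite mulr0 mul0r addr0.
have mOm := @measurable_Omega R n d rho.
have mD : measurable (Om `&` V) by apply: measurableI => //; exact: open_rV_measurable.
apply: (@integrableS _ _ _ mu setT) => //.
apply: (@integrable_continuous_cube R n.+1 (fun x => v x * partial i f x + f x * partial i v x) M).
  have [_ _ /(_ i) c] := C1_gradM (Ck1_grad v1) (Ck1_grad f1); exact: c.
move=> x xM; rewrite (fM x xM) (partial_out i fM xM); ring.
Qed.

(** The C^1 approximations satisfy the integration by parts formula. It passes to
    the limit since convergence in L^p on a bounded neighbourhood of the support of
    the test function implies convergence in L^1. *)
Lemma weak_grad_of_trace phi H S : trace_data phi H S -> weak_grad Om phi H.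
Proof.
move=> td; have [mphi mH [mS tr]] := td.
have mOm := @measurable_Omega R n d rho.
have loc (F : E -> R) : measurable_fun Om F ->
    (forall x, `|F x| <= `|phi x| + enorm (H x)) -> loc_integrable Om F.
  move=> mF FH; split => // K KO cK.
  have [V [oV bV gV KV]] := compact_nbhd cK KO.
  have mV := open_rV_measurable oV.
  have mD : measurable (Om `&` V) by exact: measurableI.
  have mK : measurable K.
    by apply: closed_rV_measurable; apply: compact_closed => //; exact: norm_hausdorff.
  have /integrableP[mg] := trace_L1 td oV bV gV; apply: le_lt_trans.
  apply: (@le_trans _ _ (\int[mu]_(x in K) `|(`|phi x| + enorm (H x))%:E|)%E).
    apply: ge0_le_integral => //.
    - apply/measurable_EFinP; apply: (measurable_funS mOm) => //; exact: measurable_normD.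
    - apply: measurableT_comp => //; apply: (measurable_funS mD) mg => //.
      by move=> x Kx; split; [exact: KO|exact: KV].
    - by move=> x _; rewrite lee_fin (le_trans (FH x))// ler_norm.
  apply: ge0_subset_integral => //.
  - exact: measurableT_comp.
  - by move=> x Kx; split; [exact: KO|exact: KV].
have mHi i := mH i.
split.
- by apply: loc => // x; rewrite lerDl enorm_ge0.
- move=> i; apply: loc => // x.
  by rewrite (le_trans (coord_le_enorm _ i))// lerDr.
move=> f i tf; have [sf cK KO] := tf.
have f1 : Ck 1 f := sf 1%N.
have fout := zero_off_support (f := f) i.
have [V [oV bV gV KV]] := compact_nbhd cK KO.
have [M KM] := bounded_sub_cube (compact_bounded cK).
have mV := open_rV_measurable oV.
have mD : measurable (Om `&` V) by exact: measurableI.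
have foutD x : ~ (Om `&` V) x -> f x = 0 /\ partial i f x = 0.
  by move=> xD; apply: fout => xK; apply: xD; split; [exact: KO|exact: KV].
have foutM x : ~ cube n.+1 M x -> f x = 0.
  by move=> xM; apply: (fout x _).1 => /KM.
have [C C0 HC] := Ck1_bounded f1 bV.
have bf x : V x -> `|f x| <= C /\ `|partial i f x| <= C.
  move=> /HC[h1 h2]; split => //; apply: le_trans h2.
  by have := coord_le_enorm (grad f x) i; rewrite mxE.
have iL := trace_L1 td oV bV gV.
have mfS (F : E -> R) : measurable_fun [set: E] F -> measurable_fun Om F.
  by move=> mF; exact: measurable_funTS.
have mf : measurable_fun Om f by apply: mfS; exact: Ck1_measurable.
have mdf : measurable_fun Om (partial i f) by apply: mfS; exact: Ck1_measurable_grad.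
have dom (F : E -> R) : measurable_fun Om F ->
    (forall x, V x -> `|F x| <= C * (`|phi x| + enorm (H x))) ->
    mu.-integrable (Om `&` V) (fun x => (F x)%:E).
  move=> mF FH.
  apply: (le_integrable mD _ _ (integrableZl mD C iL)).
    by apply/measurable_EFinP; exact: (measurable_funS mOm).
  move=> x [_ Vx]; rewrite -EFinM !abse_EFin lee_fin (le_trans (FH x Vx))//.
  exact: ler_norm.
have i1 : mu.-integrable (Om `&` V) (fun x => (phi x * partial i f x)%:E).
  apply: dom; first exact: measurable_funM.
  move=> x Vx; have [_ h] := bf x Vx; rewrite normrM mulrC.
  by apply: ler_pM => //; rewrite lerDl enorm_ge0.
have i2 : mu.-integrable (Om `&` V) (fun x => (H x ord0 i * f x)%:E).
  apply: dom; first exact: measurable_funM.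
  move=> x Vx; have [h _] := bf x Vx; rewrite normrM mulrC.
  by apply: ler_pM => //; rewrite (le_trans (coord_le_enorm _ i))// lerDr.
rewrite -(@integral_supportE _ _ _ mu (Om `&` V)) //; last first.
  by move=> x Ox xV; rewrite (foutD x xV).2 mulr0.
rewrite -[in RHS](@integral_supportE _ _ _ mu (Om `&` V)) //; last first.
  by move=> x Ox xV; rewrite (foutD x xV).1 mulr0.
suff I0 : (\int[mu]_(x in Om `&` V) ((phi x * partial i f x)%:E + (H x ord0 i * f x)%:E) = 0)%E.
  move: I0; rewrite integralD//.
  have f1' := integrable_fin_num mD i1; have f2' := integrable_fin_num mD i2.
  rewrite -(fineK f1') -(fineK f2') -EFinD => -[] I0; rewrite -EFinN; congr EFin; lra.
have [v [v1 vu _]] := tr V oV bV gV.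
apply/eqP; rewrite -abse_eq0 eq_le abse_ge0 andbT; apply/lee_addgt0Pr => e e0.
rewrite add0e.
have muD : (mu (Om `&` V) < +oo)%E.
  apply: le_lt_trans (leb_bounded_lty mV bV); apply: le_measure; rewrite ?inE//.
have muDf : mu (Om `&` V) \is a fin_num by rewrite ge0_fin_numE.
pose m := fine (mu (Om `&` V)).
have m0 : 0 <= m by exact: fine_ge0.
(* By [powR_split] at ep, an L^p-error costs Q times itself plus 2 C ep per unit of
   volume. *)
pose ep : R := e / 2 / (2 * C * m + 1).
have D0 : 0 < 2 * C * m + 1 by rewrite ltr_wpDl// !mulr_ge0.
have ep0 : 0 < ep by rewrite !divr_gt0.
pose Q : R := C * ep `^ (1 - p).
have Q0 : 0 <= Q by rewrite mulr_ge0 ?powR_ge0.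
have /cvge0P Hv : forall k, (0 <= \int[mu]_(x in Om `&` V) (sobolev_gap p (v k) phi H x)%:E)%E.
  by move=> k; apply: integral_ge0 => x _; rewrite lee_fin sobolev_gap_ge0.
have d0 : 0 < e / 2 / (Q + 1) by rewrite !divr_gt0// ltr_wpDl.
have [k _ /(_ k (leqnn k)) Hk] := Hv.1 vu _ d0.
have [A0 iA] := approx_parts td (v1 k) f1 foutM oV bV gV foutD.
pose Z x := (phi x * partial i f x + H x ord0 i * f x) -
            (v k x * partial i f x + f x * partial i (v k) x).
have -> : (\int[mu]_(x in Om `&` V) ((phi x * partial i f x)%:E + (H x ord0 i * f x)%:E) =
    \int[mu]_(x in Om `&` V) (Z x)%:E)%E.
  transitivity (\int[mu]_(x in Om `&` V) ((phi x * partial i f x)%:E + (H x ord0 i * f x)%:E)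
     - \int[mu]_(x in Om `&` V) (v k x * partial i f x + f x * partial i (v k) x)%:E)%E.
    by rewrite A0 sube0.
  rewrite -integralB//; last exact: integrableD.
have mvk : measurable_fun Om (v k) by apply: mfS; exact: Ck1_measurable.
have mdvk : measurable_fun Om (partial i (v k)) by apply: mfS; exact: Ck1_measurable_grad.
have mZ : measurable_fun Om Z.
  by apply: measurable_funB; apply: measurable_funD; apply: measurable_funM.
apply: (le_trans (le_abse_integral _ mD _)).
  by apply/measurable_EFinP; exact: (measurable_funS mOm).
apply: (@le_trans _ _ (Q%:E * \int[mu]_(x in Om `&` V) (sobolev_gap p (v k) phi H x)%:E
   + (C * (2 * ep))%:E * mu (Om `&` V))%E).
  apply: (@le_integral_affine _ _ _ mu _ mD Q (C * (2 * ep)) (sobolev_gap p (v k) phi H)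
    (fun x => `|Z x|)) => //.
  - by apply: mulr_ge0 => //; apply: mulr_ge0 => //; exact: ltW.
  - by apply: (measurable_funS mOm) => //; exact: measurable_gap.
  - by apply: (measurable_funS mOm) => //; exact: measurable_normD.
  - by move=> x _; exact: sobolev_gap_ge0.
  move=> x [Ox Vx]; rewrite normr_ge0/=.
  have [h1 h2] := bf x Vx.
  rewrite (_ : Z x = (phi x - v k x) * partial i f x + (H x ord0 i - partial i (v k) x) * f x);
    last by rewrite /Z; ring.
  rewrite (le_trans (ler_normD _ _))// !normrM.
  have g1 : `|phi x - v k x| * `|partial i f x| <= `|v k x - phi x| * C.
    by rewrite distrC; apply: ler_pM.
  have g2 : `|H x ord0 i - partial i (v k) x| * `|f x| <= enorm (grad (v k) x - H x) * C.
    apply: ler_pM => //; rewrite distrC.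
    by have := coord_sub_le_enorm (grad (v k) x) (H x) i; rewrite [X in `|X - _|]mxE.
  apply: le_trans (lerD g1 g2) _.
  have s1 := @powR_split R p ep `|v k x - phi x| (ltW p1) ep0 (normr_ge0 _).
  have s2 := @powR_split R p ep (enorm (grad (v k) x - H x)) (ltW p1) ep0 (enorm_ge0 _).
  rewrite /Q /sobolev_gap -mulrDl mulrC -!mulrA -mulrDr ler_wpM2l//.
  by apply: le_trans (lerD s1 s2) _; rewrite le_eqVlt; apply/orP; left; apply/eqP; ring.
apply: (@le_trans _ _ (Q%:E * (e / 2 / (Q + 1))%:E + (C * (2 * ep))%:E * m%:E)%E).
  by apply: leeD; [apply: lee_wpmul2l => //; rewrite lee_fin|rewrite /m fineK].
rewrite -!EFinM -EFinD lee_fin [leRHS](splitr e).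
apply: lerD.
  rewrite mulrCA -[leRHS]mulr1 ler_wpM2l//; first by rewrite divr_ge0// ltW.
  by rewrite ler_pdivrMr ?ltr_wpDl// mul1r lerDl.
rewrite /ep (_ : _ * m = e / 2 * ((2 * C * m) / (2 * C * m + 1))); last first.
  by field; rewrite gt_eqF.
rewrite -[leRHS]mulr1 ler_wpM2l//; first by rewrite divr_ge0// ltW.
by rewrite ler_pdivrMr// mul1r lerDl.
Qed.

End weak_gradients.

(** * A slowly growing odd nonlinearity *)

Section slow_nonlinearity.
Variable R : realType.
Implicit Types (a b s t : R).

Lemma lipschitz_of_derive (f f' : R -> R) (L : R) :
  (forall t : R, is_derive t 1 f (f' t)) -> (forall t, `|f' t| <= L) ->
  forall s t, `|f s - f t| <= L * `|s - t|.
Proof.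
move=> ff' f'L s t; wlog st : s t / t <= s.
  by move=> H; have [/H//|/ltW/H] := leP t s; rewrite distrC (distrC t).
have cf : {within `[t, s], continuous f}.
  apply: continuous_subspaceT => x; apply: differentiable_continuous.
  by apply/derivable1_diffP; have [] := ff' x.
have [c _ ->] := MVT_segment st (fun x _ => ff' x) cf.
by rewrite normrM ler_wpM2r.
Qed.

Definition bracket b t : R := (1 + t ^+ 2) `^ (- b).

Lemma one_sqr_gt0 t : 0 < 1 + t ^+ 2.
Proof. by rewrite ltr_pwDl// sqr_ge0. Qed.

Lemma bracket_gt0 b t : 0 < bracket b t.
Proof. by rewrite powR_gt0// one_sqr_gt0. Qed.

Lemma bracketS b t : bracket (b + 1) t * (1 + t ^+ 2) = bracket b t.
Proof.
have t0 := one_sqr_gt0 t; rewrite /bracket -{2}(powRr1 (ltW t0)) -powRD.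
  by congr (_ `^ _); ring.
by rewrite (gt_eqF t0) implybT.
Qed.

Lemma bracket_le1 b t : 0 <= b -> bracket b t <= 1.
Proof.
move=> b0; rewrite /bracket powRN invf_le1 ?powR_gt0 ?one_sqr_gt0//.
by rewrite -{1}(powRr0 (1 + t ^+ 2)) ler_powR// lerDl sqr_ge0.
Qed.

Lemma bracketS_le b t : bracket (b + 1) t <= bracket b t.
Proof. by rewrite -(bracketS b t) ler_peMr ?(ltW (bracket_gt0 _ _))// lerDl sqr_ge0. Qed.

Lemma is_derive_bracket b t :
  is_derive t 1 (bracket b) (- (2 * b) * t * bracket (b + 1) t).
Proof.
have dsq : is_derive t 1 (fun r : R => 1 + r ^+ 2) (2 * t).
  by apply: is_derive_eq; rewrite /GRing.scale/=; ring.
have := @is_derive1_comp R (fun r => r `^ (- b)) (fun r => 1 + r ^+ 2) t _ _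
  (is_derive1_powR (- b) (one_sqr_gt0 t)) dsq.
move=> H; apply: (is_derive_eq H); rewrite /bracket (_ : - b - 1 = - (b + 1)); ring.
Qed.

Lemma bracket_lipschitz b s t : 0 <= b ->
  `|bracket b s - bracket b t| <= b * `|s - t|.
Proof.
move=> b0; apply: lipschitz_of_derive => [r|r]; first exact: is_derive_bracket.
have r0 := one_sqr_gt0 r.
have h1 := bracket_le1 r b0.
have h : `|r| * bracket (b + 1) r <= 2^-1.
  have h2 := bracketS b r; have h3 := bracket_gt0 (b + 1) r.
  have : 2 * `|r| <= 1 + r ^+ 2.
    by rewrite -(real_normK (num_real r)); have := sqr_ge0 (`|r| - 1); nra.
  nra.
rewrite !normrM normrN normrM (ger0_norm b0) (gtr0_norm (bracket_gt0 _ _)).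
by rewrite (@ger0_norm _ 2)//; have := ler_wpM2l b0 h; lra.
Qed.

(** A function that behaves like the odd power |t|^(1-2a) sg t for large t but is
    smooth at 0 with a bounded and Lipschitz derivative, so that [trace_chain]
    applies to it. *)
Definition odd_power a t : R := t * bracket a t.
Definition odd_power' a t : R := 2 * a * bracket (a + 1) t + (1 - 2 * a) * bracket a t.

Lemma continuous_bracket b : continuous (bracket b).
Proof.
move=> t; apply: differentiable_continuous; apply/derivable1_diffP.
by have [] := is_derive_bracket b t.
Qed.

Section properties.
Variable a : R.
Hypothesis a01 : 0 < a < 2^-1.
Let h := odd_power a.
Let h' := odd_power' a.
Let a0 : 0 < a. Proof. by case/andP: a01. Qed.
Let k0 : 0 < 1 - 2 * a. Proof. by case/andP: a01 => _ ?; lra. Qed.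

Lemma is_derive_odd_power t : is_derive t 1 h (h' t).
Proof.
have H := is_deriveM (@is_derive_id _ _ t 1) (is_derive_bracket a t).
apply: (is_derive_eq H); rewrite /GRing.scale/= /h' /odd_power' -(bracketS a t); ring.
Qed.

Lemma continuous_odd_power' : continuous h'.
Proof.
move=> t; apply: cvgD; apply: cvgM; try exact: cvg_cst; exact: continuous_bracket.
Qed.

Lemma odd_power'_gt0 t : 0 < h' t.
Proof. by rewrite /h' /odd_power' addr_gt0// !mulr_gt0// bracket_gt0. Qed.

Lemma odd_power'_le1 t : `|h' t| <= 1.
Proof.
rewrite gtr0_norm ?odd_power'_gt0// /h' /odd_power'.
have := ler_wpM2l (ltW a0) (bracketS_le a t); have := bracket_le1 t (ltW a0); lra.
Qed.

Lemma odd_power_lipschitz s t : `|h s - h t| <= `|s - t|.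
Proof.
rewrite -[leRHS]mul1r; apply: lipschitz_of_derive => r.
  exact: is_derive_odd_power.
exact: odd_power'_le1.
Qed.

Lemma odd_power'_lipschitz s t :
  `|h' s - h' t| <= (2 * a * (a + 1) + (1 - 2 * a) * a) * `|s - t|.
Proof.
rewrite (_ : h' s - h' t = 2 * a * (bracket (a + 1) s - bracket (a + 1) t) +
   (1 - 2 * a) * (bracket a s - bracket a t)); last by rewrite /h' /odd_power'; ring.
rewrite (le_trans (ler_normD _ _))// !normrM.
rewrite (ger0_norm (ltW a0)) (gtr0_norm k0) (@ger0_norm _ 2)//.
have l1 := ler_wpM2l (ltW a0) (bracket_lipschitz s t (addr_ge0 (ltW a0) ler01)).
have l2 := ler_wpM2l (ltW k0) (bracket_lipschitz s t (ltW a0)).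
lra.
Qed.

Lemma norm_odd_power t : `|h t| = `|t| * bracket a t.
Proof. by rewrite /h /odd_power normrM (gtr0_norm (bracket_gt0 _ _)). Qed.

Lemma odd_power_sg t : h t = `|h t| * Num.sg t.
Proof.
by rewrite norm_odd_power mulrAC -[X in X * _]mulrC -numEsg.
Qed.

Lemma odd_power_le t : `|h t| <= `|t|.
Proof. by rewrite norm_odd_power ler_piMr// bracket_le1// ltW. Qed.

Lemma odd_power_eq0 t : h t = 0 -> t = 0.
Proof.
by move/eqP; rewrite /h /odd_power mulf_eq0 (gt_eqF (bracket_gt0 _ _)) orbF => /eqP.
Qed.

(** The counterpart for h of t h'(t) = (1 - 2a) h(t) for an exact power. *)
Lemma odd_power_ler t : (1 - 2 * a) * `|h t| <= h' t * `|t|.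
Proof.
rewrite norm_odd_power /h' /odd_power'.
have := mulr_ge0 (mulr_ge0 (ltW a0) (ltW (bracket_gt0 (a + 1) t))) (normr_ge0 t).
lra.
Qed.

Lemma odd_power_growth t : `|h t| <= `|t| `^ (1 - 2 * a).
Proof.
have [->|t0] := eqVneq t 0.
  by rewrite /h /odd_power mul0r normr0 powR_ge0.
have nt : 0 < `|t| by rewrite normr_gt0.
rewrite norm_odd_power powRD ?(gt_eqF nt) ?implybT// powRr1// ler_wpM2l//.
rewrite /bracket !powRN lef_pV2 ?posrE ?powR_gt0 ?one_sqr_gt0//.
rewrite powRrM powR_mulrn// ; apply: ge0_ler_powR; rewrite ?nnegrE ?(ltW a0)//.
  by rewrite ltW// one_sqr_gt0.
by rewrite real_normK ?num_real// lerDr.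
Qed.

(** The term to be absorbed comes from the gradient of the cutoff, x standing for
    |grad u|, t for u and y1, y2 for the gradients of the two cutoff factors; put
    y = y1 + y2. Either the gradient term on the right already dominates, or x is at
    most a multiple of |t| y, and the left-hand side is at most a multiple of
    |h(t)| |t|^(p-1) y^p. When y2 is the larger one, |h(t)| <= |t| gives the last
    term. When y1 is the larger one, either y1^p is at most a small multiple of
    |t|^(q-p+1), and |t|^q |h(t)| absorbs the product, or |t| is bounded by a power of
    y1, and |h(t)| |t|^(p-1) <= |t|^(p-2a) leaves exactly the power y1^P. *)
Lemma key_inequality (p q m A : R) :
  1 < p -> p - 1 < q -> 0 < m -> 0 <= A ->
  let P := p * (q + (1 - 2 * a)) / (q - p + 1) in
  exists2 C, 0 <= C & forall x t y1 y2, 0 <= x -> 0 <= y1 -> 0 <= y2 ->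
    A * x `^ (p - 1) * `|h t| * (y1 + y2) <=
    m / 2 * h' t * x `^ p + 2^-1 * `|t| `^ q * `|h t| +
    C * (y1 `^ P + `|t| `^ p * y2 `^ p).
Proof.
move=> p1 pq m0 A0 P.
have p0 : 0 < p by rewrite (lt_trans ltr01).
have pm0 : 0 < p - 1 by rewrite subr_gt0.
set k := 1 - 2 * a in P *.
have r0 : 0 < q - p + 1 by lra.
pose K1 := 2 * A / (m * k).
have K10 : 0 <= K1 by rewrite divr_ge0 ?mulr_ge0// ltW.
pose C2 := A * K1 `^ (p - 1) * 2 `^ p + 1.
have C1p : 0 <= A * K1 `^ (p - 1) * 2 `^ p by rewrite !mulr_ge0 ?powR_ge0.
have C20 : 0 < C2 by rewrite ltr_wpDl.
pose e := (k + p - 1) / (q - p + 1).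
pose C := C2 + C2 * (2 * C2) `^ e.
have C0 : 0 <= C by rewrite addr_ge0 ?mulr_ge0 ?powR_ge0 ?ltW.
exists C => // x t y1 y2 x0 y10 y20; set y := y1 + y2.
have y0 : 0 <= y by exact: addr_ge0.
have h'0 := odd_power'_gt0 t.
have hn : 0 <= `|h t| := normr_ge0 _.
have R1 : 0 <= m / 2 * h' t * x `^ p.
  by apply: mulr_ge0 (powR_ge0 _ _); apply: mulr_ge0 (ltW h'0); rewrite divr_ge0// ltW.
have R2 : 0 <= 2^-1 * `|t| `^ q * `|h t| by rewrite !mulr_ge0 ?powR_ge0.
have R3 : 0 <= y1 `^ P := powR_ge0 _ _.
have R4 : 0 <= `|t| `^ p * y2 `^ p by rewrite mulr_ge0 ?powR_ge0.
have CR3 := mulr_ge0 C0 R3; have CR4 := mulr_ge0 C0 R4.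
(* If A |h| y <= (m/2) h' x, multiplying by x^(p-1) gives the gradient term. *)
have [case1|case2] := leP (A * `|h t| * y) (m / 2 * h' t * x).
  have : x `^ (p - 1) * (A * `|h t| * y) <= x `^ (p - 1) * (m / 2 * h' t * x).
    by rewrite ler_wpM2l ?powR_ge0.
  have <- : x * x `^ (p - 1) = x `^ p by exact: mulr_powRB1.
  rewrite -(mulr_powRB1 x0 p0) in R1; nra.
have xle : x <= K1 * (`|t| * y).
  have := odd_power_ler t; rewrite -/k => hk.
  rewrite -(ler_pM2l (mulr_gt0 (mulr_gt0 m0 k0) h'0)).
  rewrite (_ : m * (1 - 2 * a) * h' t * (K1 * (`|t| * y)) = 2 * A * y * (h' t * `|t|)); last first.
    by rewrite /K1 -/k; field; rewrite !gt_eqF.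
  apply: (@le_trans _ _ (2 * A * y * (k * `|h t|))); last first.
    by rewrite ler_wpM2l// !mulr_ge0.
  have : k * (m / 2 * h' t * x) <= k * (A * `|h t| * y) by rewrite ler_wpM2l ?(ltW k0)// ltW.
  rewrite -/k; lra.
have step : A * x `^ (p - 1) * `|h t| * y <=
    A * K1 `^ (p - 1) * (`|h t| * `|t| `^ (p - 1)) * y `^ p.
  rewrite -(mulr_powRB1 y0 p0).
  have : x `^ (p - 1) <= K1 `^ (p - 1) * (`|t| `^ (p - 1) * y `^ (p - 1)).
    rewrite -(powRM _ (normr_ge0 t) y0) -(powRM _ K10 (mulr_ge0 (normr_ge0 t) y0)).
    apply: ge0_ler_powR xle; rewrite ?nnegrE//; first exact: ltW pm0.
    exact: (mulr_ge0 K10 (mulr_ge0 (normr_ge0 t) y0)).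
  move=> H.
  have := ler_wpM2l (mulr_ge0 (mulr_ge0 A0 hn) y0) H; lra.
have [t0|t0] := eqVneq t 0.
  have ht0 : h t = 0 by rewrite t0 /h /odd_power mul0r.
  by rewrite ht0 normr0; lra.
have nt : 0 < `|t| by rewrite normr_gt0.
have htp : 0 <= `|h t| * `|t| `^ (p - 1) by rewrite mulr_ge0 ?powR_ge0.
apply: (le_trans step).
have [y12|y21] := leP y1 y2.
  have yp : y `^ p <= 2 `^ p * y2 `^ p.
    rewrite -powRM//; apply: ge0_ler_powR; rewrite ?nnegrE ?mulr_ge0 ?(ltW p0)//.
    by rewrite /y; lra.
  have hp : `|h t| * `|t| `^ (p - 1) <= `|t| `^ p.
    by rewrite -(mulr_powRB1 (ltW nt) p0) ler_wpM2r ?powR_ge0// odd_power_le.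
  apply: (@le_trans _ _ (A * K1 `^ (p - 1) * `|t| `^ p * (2 `^ p * y2 `^ p))).
    apply: ler_pM => //; rewrite ?mulr_ge0 ?powR_ge0//.
    by rewrite ler_wpM2l// mulr_ge0 ?powR_ge0.
  have : A * K1 `^ (p - 1) * 2 `^ p * (`|t| `^ p * y2 `^ p) <= C * (`|t| `^ p * y2 `^ p).
    rewrite ler_wpM2r// /C; apply: (@le_trans _ _ C2); first by rewrite /C2 lerDl.
    by rewrite lerDl mulr_ge0 ?powR_ge0// ltW.
  lra.
have yp : y `^ p <= 2 `^ p * y1 `^ p.
  rewrite -powRM//; apply: ge0_ler_powR; rewrite ?nnegrE ?mulr_ge0 ?(ltW p0)//.
  by rewrite /y; lra.
apply: (@le_trans _ _ (C2 * (`|h t| * `|t| `^ (p - 1)) * y1 `^ p)).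
  apply: (@le_trans _ _ (A * K1 `^ (p - 1) * (`|h t| * `|t| `^ (p - 1)) * (2 `^ p * y1 `^ p))).
    by rewrite ler_wpM2l// !mulr_ge0 ?powR_ge0.
  have := mulr_ge0 htp (powR_ge0 y1 p); rewrite /C2; nra.
(* The factor 1/2 matches the coefficient of |t|^q |h(t)|. *)
have [small|big] := leP (C2 * y1 `^ p) (2^-1 * `|t| `^ (q - p + 1)).
  have E : `|t| `^ q = `|t| `^ (p - 1) * `|t| `^ (q - p + 1).
    by rewrite -powRD ?(gt_eqF nt) ?implybT//; congr (_ `^ _); ring.
  have := ler_wpM2l htp small; rewrite E in R2 *; lra.
have y1p : 0 <= y1 `^ p := powR_ge0 _ _.
have tle : `|t| `^ (k + p - 1) <= (2 * C2) `^ e * y1 `^ (p * e).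
  rewrite (powRrM y1) -powRM ?mulr_ge0 ?(ltW C20)//.
  have -> : k + p - 1 = (q - p + 1) * e by rewrite /e; field; rewrite gt_eqF.
  rewrite powRrM; apply: ge0_ler_powR; rewrite ?nnegrE ?mulr_ge0 ?powR_ge0 ?(ltW C20)//.
    - by rewrite -addrA; exact: (addr_ge0 (ltW k0) (ltW pm0)).
    - by rewrite invr_ge0 ltW.
  by move: big; lra.
have h3 : `|h t| * `|t| `^ (p - 1) <= `|t| `^ (k + p - 1).
  rewrite (_ : k + p - 1 = k + (p - 1)); last by ring.
  rewrite (@powRD _ `|t| k (p - 1)) ?(gt_eqF nt) ?implybT// ler_wpM2r ?powR_ge0//.
  exact: odd_power_growth.
have PE : y1 `^ (p * e) * y1 `^ p = y1 `^ P.
  have pe0 : 0 < p * e.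
    rewrite mulr_gt0// divr_gt0// -addrA; exact: (addr_gt0 k0 pm0).
  rewrite -powRD; first by congr (_ `^ _); rewrite /P /e; field; rewrite gt_eqF.
  by rewrite gt_eqF// addr_gt0.
have L1 : C2 * (`|h t| * `|t| `^ (p - 1)) * y1 `^ p <= C2 * (2 * C2) `^ e * y1 `^ P.
  have H := ler_wpM2l (ltW C20) (ler_wpM2r y1p (le_trans h3 tle)).
  by rewrite -PE; move: H; rewrite !mulrA.
have L2 : C2 * (2 * C2) `^ e * y1 `^ P <= C * y1 `^ P.
  by rewrite ler_wpM2r// /C lerDr ltW.
apply: le_trans L1 (le_trans L2 _); rewrite -[leLHS]add0r [C * (_ + _)]mulrDr.
by apply: lerD; [exact: addr_ge0 R1 R2|rewrite lerDl].
Qed.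

End properties.
End slow_nonlinearity.

(** * Admissible test functions *)

Section admissible_functions.
Variables (R : realType) (n d : nat) (rho : \bar R) (p alpha : R).
Hypotheses (dn : (d <= n)%N) (p1 : 1 < p) (alpha0 : 0 <= alpha).
Local Notation E := 'rV[R]_n.+1.
Local Notation Om := (@Omega R n d rho).
Local Notation Ga := (@Gamma R n d).
Local Notation mu := (leb R n.+1).
Local Notation trace_data := (trace_data d rho p).
Implicit Types (u v phi S : E -> R) (H : E -> E).

(** A test function of U is a test function of the domain, and it contributes
    nothing to the integrals outside U. *)
Lemma weak_gradS (U : set E) phi H : open U -> U `<=` Om ->
  weak_grad Om phi H -> weak_grad U phi H.
Proof.
move=> oU UO [lphi lH wg].
have mU := open_rV_measurable oU.
have locS F : loc_integrable Om F -> loc_integrable U F.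
  move=> [mF iF]; split; first exact: (measurable_funS (@measurable_Omega R n d rho) UO).
  by move=> K KU; apply: iF; exact: subset_trans UO.
split; [exact: locS|by move=> i; exact: locS|move=> f i tf].
have [sf cf fU] := tf.
have fout := zero_off_support (f := f) i.
have zero x : Om x -> ~ U x -> f x = 0 /\ partial i f x = 0.
  by move=> _ xU; apply: fout => /fU.
rewrite (integral_supportE _ UO); last by move=> x Ox /(zero x Ox)[_ ->]; rewrite mulr0.
rewrite [in RHS](integral_supportE _ UO); last by move=> x Ox /(zero x Ox)[-> _]; rewrite mulr0.
by apply: wg; split => //; exact: subset_trans UO.
Qed.

Definition weak_test phi : Prop :=
  [/\ W1p_loc d rho p (weight alpha) phi, Linfty_loc d rho phi &
      ess_supp Om phi `<=` closure Om `\` Ga].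

(** A function that vanishes outside a bounded open set V whose closure misses Gamma
    is globally in W^{1,p} by [trace_Lp], because the weight is at most 1. *)
Lemma admissible phi H S (V : set E) : trace_data phi H S ->
  open V -> bounded_set V -> off_Gamma d V ->
  (forall x, ~ V x -> phi x = 0 /\ H x = 0) -> Linfty_loc d rho phi ->
  weak_test phi.
Proof.
move=> td oV bV gV out Li; have [mphi mH _] := td.
have mOm := @measurable_Omega R n d rho.
have mV := open_rV_measurable oV.
have mD : measurable (Om `&` V) by exact: measurableI.
have p0 : p != 0 by rewrite gt_eqF// (lt_trans ltr01).
have mpow (F : E -> R) : measurable_fun Om F -> measurable_fun Om (fun x => `|F x| `^ p).
  by move=> mF; apply: measurable_powRD; exact: measurable_normD.
have mw : measurable_fun Om (weight alpha).
  by apply: measurable_funTS; exact: measurable_weight.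
have LpS (F : E -> R) (U : set E) : open U -> U `<=` Om -> measurable_fun Om F ->
    (forall x, ~ V x -> F x = 0) ->
    (forall x, `|F x| `^ p <= `|phi x| `^ p + enorm (H x) `^ p) ->
    Lp p (weight alpha) U F.
  move=> oU UO mF F0 Fle; have mU := open_rV_measurable oU.
  have m1 : measurable_fun Om (fun x => (`|F x| `^ p * weight alpha x)%:E).
    by apply/measurable_EFinP; apply: measurable_funM => //; exact: mpow.
  split; first exact: (measurable_funS mOm UO).
  apply: (@le_lt_trans _ _ (\int[mu]_(x in Om) (`|F x| `^ p * weight alpha x)%:E)%E).
    apply: ge0_subset_integral => // x _.
    by rewrite lee_fin mulr_ge0 ?powR_ge0// ltW// weight_gt0.
  rewrite -(@integral_supportE _ _ _ _ (Om `&` V)) //; last first.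
    move=> x Ox xD; rewrite F0 ?normr0 ?powR0 ?mul0r// => Vx; exact: xD.
  apply: le_lt_trans (trace_Lp p1 td oV bV gV).
  apply: ge0_le_integral => //.
  - by move=> x _; rewrite lee_fin mulr_ge0 ?powR_ge0// ltW// weight_gt0.
  - exact: (measurable_funS mOm).
  - apply/measurable_EFinP; apply: (measurable_funS mOm) => //.
    apply: measurable_funD; first exact: mpow.
    by apply: measurable_powRD; exact: measurable_enormD.
  - move=> x _; rewrite lee_fin; apply: le_trans (Fle x).
    by rewrite ler_piMr ?powR_ge0// weight_le1.
split => //.
- move=> U oU UO gU; split.
    apply: LpS => // [x /out[]//|x]; by rewrite lerDl powR_ge0.
  exists H; split; first exact: weak_gradS (weak_grad_of_trace dn p1 td).
  apply: LpS => //; first exact: measurable_enormD.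
    by move=> x /out[_ ->]; exact: enorm0.
  by move=> x; rewrite (ger0_norm (enorm_ge0 _)) lerDr powR_ge0.
- move=> x Hx; split.
    apply: contrapT => xO; apply: (Hx (~` closure Om)) => //.
      exact: closed_openC (@closed_closure _ Om).
    by apply: aeW => y Oy yO; exfalso; apply: yO; exact: subset_closure.
  move=> Gx; apply: (Hx (~` closure V)).
  - exact: closed_openC (@closed_closure _ V).
  - by move=> Vx; have : (closure V `&` Ga) x by []; rewrite gV.
  - apply: aeW => y _ yV; apply: (out y _).1 => Vy; apply: yV.
    exact: subset_closure.
Qed.

End admissible_functions.

(** * Integrals over a thin layer around Gamma *)

Section smooth_step.
Variable R : realType.
Implicit Types t : R.

(** A quadratic spline that increases from 0 at 1 to 1 at 2. *)
Definition step t : R := 2 * (sqp (t - 1) + (-2) * sqp (t - 3 / 2) + sqp (t - 2)).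
Definition step' t : R := 4 * (Num.max 0 (t - 1) + (-2) * Num.max 0 (t - 3 / 2) + Num.max 0 (t - 2)).

Lemma is_derive_sqp_shift c t : is_derive t 1 (fun s : R => sqp (s - c)) (2 * Num.max 0 (t - c)).
Proof.
have dsh : is_derive t 1 (fun s : R => s - c) 1.
  by apply: is_derive_eq; rewrite ?subr0.
have := @is_derive1_comp R (@sqp R) (fun s => s - c) t _ _ (is_derive_sqp (t - c)) dsh.
by rewrite mulr1.
Qed.

Lemma is_derive_step t : is_derive t 1 step (step' t).
Proof.
have H1 := is_derive_sqp_shift 1 t.
have H2 := is_derive_sqp_shift (3 / 2) t.
have H3 := is_derive_sqp_shift 2 t.
have H2' := is_deriveM (is_derive_cst (-2 : R) t 1) H2.
have H4 := is_deriveM (is_derive_cst (2 : R) t 1) (is_deriveD (is_deriveD H1 H2') H3).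
apply: (is_derive_eq H4); rewrite /step' /GRing.scale/=; ring.
Qed.

Lemma continuous_step' : continuous step'.
Proof.
have c (a : R) : continuous (fun t : R => Num.max 0 (t - a)).
  move=> t; apply: (@continuous_comp _ _ _ (fun t : R => t - a) (fun t : R => Num.max 0 t)).
    by apply: cvgB; [exact: cvg_id|exact: cvg_cst].
  exact: continuous_maxr0.
move=> t; apply: cvgM; first exact: cvg_cst.
apply: cvgD; last exact: c.
by apply: cvgD; [exact: c|apply: cvgM; [exact: cvg_cst|exact: c]].
Qed.

Lemma step_le0 t : t <= 1 -> step t = 0 /\ step' t = 0.
Proof. by move=> t1; rewrite /step /step' /sqp !max_l; try lra; split; ring. Qed.

Lemma step_ge1 t : 2 <= t -> step t = 1 /\ step' t = 0.
Proof. by move=> t1; rewrite /step /step' /sqp !max_r; try lra; split; field. Qed.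

Lemma step_bounds t : 0 <= step t <= 1 /\ 0 <= step' t <= 2.
Proof.
have [t1|t1] := leP t 1; first by have [-> ->] := step_le0 t1; split; apply/andP; split; lra.
have [t2|t2] := leP 2 t; first by have [-> ->] := step_ge1 t2; split; apply/andP; split; lra.
rewrite /step /step' /sqp (@max_r _ _ 0 (t - 1)); last lra.
rewrite (@max_l _ _ 0 (t - 2)); last lra.
have [t3|t3] := leP t (3 / 2).
  rewrite max_l; last lra.
  split; apply/andP; split; nra.
rewrite max_r; last lra.
split; apply/andP; split; nra.
Qed.

End smooth_step.

Section weighted_shells.
Variables (R : realType) (d M : nat) (j : R).
Hypothesis j0 : 0 < j.
Local Notation lam := (@lebesgue_measure R).

(** With B = jw x in [thin], the product in [shell_density] is the indicator of a
    box around Gamma that contains the layer 1 < jw x |x'|^2 < 2, and the density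
    jw^c with c = P/2 dominates the P-th power of the gradient of the cutoff.
    Since jw only involves x'', the coordinates of x' can be integrated one at a
    time. *)
Definition jw m (x : 'rV[R]_m) : R := j * (1 + \sum_(i < m | (i < d)%N) x ord0 i ^+ 2) ^+ M.
Definition thin (t B : R) : R := if t ^+ 2 * B <= 2 then 1 else 0.
Definition shell_density m (c : R) (x : 'rV[R]_m) : R :=
  jw x `^ c * \prod_(i < m | (d <= i)%N) thin (x ord0 i) (jw x).

Lemma sumsq_pos m (x : 'rV[R]_m) : 0 < 1 + \sum_(i < m | (i < d)%N) x ord0 i ^+ 2.
Proof. by rewrite ltr_pwDl// sumsq_ge0. Qed.

Lemma jw_gt0 m (x : 'rV[R]_m) : 0 < jw x.
Proof. by rewrite mulr_gt0// exprn_gt0// sumsq_pos. Qed.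

Lemma measurable_jw m : measurable_fun [set: 'rV[R]_m] (@jw m).
Proof.
apply: measurable_funM => //; apply: measurable_funX; apply: measurable_funD => //.
exact: (continuous_rV_measurable (@continuous_sumsq R m (fun i => i < d)%N)).
Qed.

Lemma thin_ge0 t B : 0 <= thin t B. Proof. by rewrite /thin; case: ifP. Qed.

Lemma shell_density_ge0 m c (x : 'rV[R]_m) : 0 <= shell_density c x.
Proof. by rewrite mulr_ge0 ?powR_ge0// prodr_ge0// => i _; exact: thin_ge0. Qed.

Lemma measurable_shell_density m c :
  measurable_fun [set: 'rV[R]_m] (@shell_density m c).
Proof.
apply: measurable_funM.
  exact: (measurableT_comp (measurable_powR c) (@measurable_jw m)).
have H (i : 'I_m) : measurable_fun [set: 'rV[R]_m]
    (fun x : 'rV[R]_m => if (d <= i)%N then thin (x ord0 i) (jw x) else 1).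
  case: (d <= i)%N; last exact: measurable_cst.
  apply: measurable_fun_ifT => //; apply: measurable_fun_ler => //.
  apply: measurable_funM; last exact: measurable_jw.
  by apply: measurable_funX; exact: measurable_rV_coordT.
rewrite (_ : (fun x : 'rV[R]_m => _) = (fun x : 'rV[R]_m =>
    \prod_(i < m) (if (d <= i)%N then thin (x ord0 i) (jw x) else 1))).
  by apply: measurable_prod => i _; exact: H.
by apply/funext => x; rewrite big_mkcond.
Qed.

Lemma prod_snoc m (P : pred nat) (F : R -> R) (y : 'rV[R]_m) t :
  \prod_(i < m.+1 | P i) F (snoc y t ord0 i) =
  \prod_(i < m | P i) F (y ord0 i) * (if P m then F t else 1).
Proof.
rewrite !(big_mkcond (fun i : 'I__ => P i)) big_ord_recr/=; congr (_ * _).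
  apply: eq_bigr => i _; case: ifP => // _; rewrite -(snoc_lift y t).
  congr (F (snoc _ _ _ _)); apply: val_inj.
  by rewrite /= /bump leqNgt ltn_ord.
case: ifP => // _; rewrite -[in RHS](snoc_max y t); congr (F (snoc _ _ _ _)).
Qed.

Lemma jw_snoc m (y : 'rV[R]_m) t : (d <= m)%N -> jw (snoc y t) = jw y.
Proof.
by move=> dm; rewrite /jw (sumsq_snoc (fun i => i < d)%N) ltnNge dm addr0.
Qed.

Lemma integral_thin (B : R) : 0 < B ->
  (\int[lam]_t (thin t B)%:E <= (2 * (2 / B) `^ 2^-1)%:E)%E.
Proof.
move=> B0; set r := (2 / B) `^ 2^-1.
have r0 : 0 <= r := powR_ge0 _ _.
have r2 : r ^+ 2 = 2 / B.
  by rewrite -powR_mulrn// /r -powRrM mulVf// powRr1// divr_ge0// ltW.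
apply: (@le_trans _ _ (\int[lam]_t (\1_(`[- r, r]%classic) t)%:E)%E).
  apply: ge0_le_integral => //.
  - by move=> t _; rewrite lee_fin thin_ge0.
  - apply/measurable_EFinP; apply: measurable_fun_ifT => //.
    by apply: measurable_fun_ler => //; apply: measurable_funM => //; apply: measurable_funX.
  - by apply/measurable_EFinP; exact: measurable_indic.
  move=> t _; rewrite lee_fin /thin indicE; case: ifPn => // h.
  rewrite mem_set//= in_itv/= -ler_norml -(@ler_pXn2r _ 2)// ?nnegrE//.
  by rewrite real_normK ?num_real// r2 ler_pdivlMr.
rewrite integral_indic// setIT [X in (X <= _)%E]lebesgue_measure_itv/= lte_fin.
case: ifP => _; last by rewrite lee_fin mulr_ge0.
by rewrite lee_fin; lra.
Qed.

(** In the absence of x' the density is a negative power of 1 + |x''|^2, which is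
    integrable over R^d for large M. *)
Lemma integral_shell_density_base c : d%:R <= M%:R * - c ->
  (\int[leb R d]_x (shell_density c x)%:E <= (j `^ c * pi ^+ d)%:E)%E.
Proof.
move=> Mc; have j1 := powR_ge0 j c.
have mV : measurable_fun [set: R] (fun t : R => (oneDsqr t)^-1).
  by apply: continuous_measurable_fun; exact: continuous_oneDsqrV.
rewrite EFinM -integral_prod_oneDsqr -ge0_integralZl//=; last 2 first.
- apply/measurable_EFinP; apply: measurable_prod => i _.
  exact: (measurableT_comp mV (@measurable_rV_coordT R d i)).
- by move=> x _; rewrite lee_fin prodr_ge0.
apply: ge0_le_integral => //.
- by move=> x _; rewrite lee_fin shell_density_ge0.
- by apply/measurable_EFinP; exact: measurable_shell_density.
- apply: measurable_funeM; apply/measurable_EFinP; apply: measurable_prod => i _.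
  exact: (measurableT_comp mV (@measurable_rV_coordT R d i)).
move=> x _; rewrite -EFinM lee_fin /shell_density big1 ?mulr1; last first.
  by move=> i; rewrite leqNgt ltn_ord.
have S0 := sumsq_pos x; set S := (1 + _) in S0.
have S1 : 1 <= S by rewrite lerDl sumsq_ge0.
rewrite /jw -/S powRM ?(ltW j0) ?exprn_ge0 ?(ltW S0)// ler_wpM2l//.
rewrite -powR_mulrn ?(ltW S0)// -powRrM.
apply: (@le_trans _ _ (S `^ (- d%:R))).
  by rewrite ler_powR//; lra.
rewrite powRN powR_mulrn ?(ltW S0)// -exprVn -[X in _ ^+ X]card_ord -prodr_const.
apply: ler_prod => i _; rewrite invr_ge0 (ltW S0)/= lef_pV2 ?posrE//.
by rewrite /oneDsqr /S lerD2l (bigD1 i)//= lerDl sumr_ge0// => k _; exact: sqr_ge0.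
Qed.

(** Each of the k coordinates of x' ranges over an interval of length of the order
    of jw^(-1/2), so that integrating it out lowers the exponent c by 1/2. *)
Lemma integral_shell_density k m c : m = (k + d)%N ->
  d%:R <= M%:R * (k%:R / 2 - c) ->
  (\int[leb R m]_x (shell_density c x)%:E <=
   ((2 * 2 `^ 2^-1) ^+ k * (j `^ (c - k%:R / 2) * pi ^+ d))%:E)%E.
Proof.
elim: k m c => [|k IH] m c ->.
  rewrite mul0r sub0r subr0 expr0 mul1r => h.
  exact: integral_shell_density_base.
move=> Mc; rewrite addSn; set m' := (k + d)%N.
have K0 : 0 <= 2 * 2 `^ 2^-1 :> R by rewrite mulr_ge0 ?powR_ge0.
have dm : (d <= m')%N by rewrite leq_addl.
rewrite ge0_integral_lebS; last 2 first.
- by apply/measurable_EFinP; exact: measurable_shell_density.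
- by move=> x; rewrite lee_fin shell_density_ge0.
apply: (@le_trans _ _ (\int[leb R m']_y ((2 * 2 `^ 2^-1)%:E * (shell_density (c - 2^-1) y)%:E))%E).
  apply: ge0_le_integral => //.
  - by move=> y _; apply: integral_ge0 => t _; rewrite lee_fin shell_density_ge0.
  - apply: (measurable_fun_fubini_tonelli_F (m2 := lam)
      (fun z : 'rV[R]_m' * measurableTypeR R => (shell_density c (snoc z.1 z.2))%:E)).
      apply/measurable_EFinP.
      exact: (measurableT_comp (@measurable_shell_density m'.+1 c) (@measurable_snoc R m')).
    by move=> z; rewrite lee_fin shell_density_ge0.
  - by apply: measurable_funeM; apply/measurable_EFinP; exact: measurable_shell_density.
  move=> y _; have W0 := jw_gt0 y.
  have -> : (\int[lam]_t (shell_density c (snoc y t))%:E =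
      (shell_density c y)%:E * \int[lam]_t (thin t (jw y))%:E)%E.
    rewrite -ge0_integralZl//.
    - apply: eq_integral => t _; rewrite -EFinM /shell_density (jw_snoc _ _ dm).
      by rewrite (prod_snoc (leq d) (fun s => thin s (jw y))) dm mulrA.
    - apply/measurable_EFinP; apply: measurable_fun_ifT => //.
      by apply: measurable_fun_ler => //; apply: measurable_funM => //; apply: measurable_funX.
    - by move=> t _; rewrite lee_fin thin_ge0.
    - by rewrite lee_fin shell_density_ge0.
  apply: le_trans (lee_wpmul2l _ (integral_thin W0)) _.
    by rewrite lee_fin shell_density_ge0.
  rewrite -!EFinM lee_fin /shell_density.
  rewrite (@powRM _ 2 (jw y)^-1) ?invr_ge0 ?(ltW W0)//.
  rewrite -(powR_inv1 (ltW W0)) -powRrM mulN1r.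
  rewrite (@powRD _ (jw y) c (- 2^-1)) ?(gt_eqF W0) ?implybT//.
  by rewrite le_eqVlt; apply/orP; left; apply/eqP; ring.
rewrite ge0_integralZl//; last 2 first.
- by apply/measurable_EFinP; exact: measurable_shell_density.
- by move=> y _; rewrite lee_fin shell_density_ge0.
have E : (k.+1%:R / 2 : R) = k%:R / 2 + 2^-1 by rewrite -natr1 mulrDl mul1r.
move: (2 * 2 `^ 2^-1 : R) K0 (IH m') => K K0 {}IH.
rewrite exprS -mulrA [X in (_ <= X)%E]EFinM lee_wpmul2l ?lee_fin//.
rewrite (_ : c - k.+1%:R / 2 = (c - 2^-1) - k%:R / 2); last by rewrite E; ring.
apply: IH => //; rewrite (_ : k%:R / 2 - (c - 2^-1) = k.+1%:R / 2 - c)//.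
by rewrite E; ring.
Qed.

End weighted_shells.

(** * Cutoff functions *)

Section cutoffs.
Variables (R : realType) (n d M : nat) (j k : R).
Hypotheses (dn : (d <= n)%N) (j1 : 1 <= j) (k0 : 0 < k).
Local Notation E := 'rV[R]_n.+1.
Local Notation Ga := (@Gamma R n d).
Implicit Types x : E.
Let j0 : 0 < j. Proof. exact: lt_le_trans j1. Qed.

Lemma is_derive_pow m (t : R) : is_derive t 1 (fun s : R => s ^+ m) (m%:R * t ^+ m.-1).
Proof.
apply: DeriveDef; first exact: exprn_derivable.
by rewrite exp_derive; exact: mulr1.
Qed.

Lemma continuous_pow m (c : R) : continuous (fun s : R => c * s ^+ m).
Proof. by move=> t; apply: cvgM; [exact: cvg_cst|exact: exprn_continuous]. Qed.

(** The squared distance to Gamma in units of the squared thickness of the layer. *)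
Definition tau x : R := jw d M j x * \sum_(i < n.+1 | (d <= i)%N) x ord0 i ^+ 2.

Lemma tauE x : tau x = jw d M j x * enorm' d x ^+ 2.
Proof. by rewrite sqr_enorm'. Qed.

Definition tau_grad (i : 'I_n.+1) x : R :=
  jw d M j x * (if (d <= i)%N then 2 * x ord0 i else 0) +
  (\sum_(i < n.+1 | (d <= i)%N) x ord0 i ^+ 2) *
  (j * (M%:R * (1 + \sum_(i < n.+1 | (i < d)%N) x ord0 i ^+ 2) ^+ M.-1 *
    (if (i < d)%N then 2 * x ord0 i else 0))).

Lemma C1_grad_tau : C1_grad tau tau_grad.
Proof.
have H1 := C1_gradD (C1_grad_cst n.+1 (1 : R)) (@C1_grad_sumsq R n.+1 (fun i => i < d)%N).
have H2 := C1_grad_comp (is_derive_pow M) (@continuous_pow M.-1 M%:R) H1.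
have H3 := C1_gradM (C1_grad_cst n.+1 j) H2.
have := C1_gradM H3 (@C1_grad_sumsq R n.+1 (fun i => d <= i)%N).
congr C1_grad; apply/funext => i; apply/funext => x; rewrite /tau_grad /jw.
by rewrite add0r mulr0 addr0.
Qed.

Lemma jw_ge1 x : 1 <= jw d M j x.
Proof. by rewrite mulr_ege1// exprn_ege1// lerDl sumsq_ge0. Qed.

Lemma tau_grad_le i x :
  `|tau_grad i x| <= jw d M j x * enorm' d x * (2 + M%:R * enorm' d x).
Proof.
have N0 := enorm'_ge0 d x; have J0 := jw_gt0 d M j0 x.
rewrite /tau_grad -sqr_enorm'.
have b1 : `|jw d M j x * (if (d <= i)%N then 2 * x ord0 i else 0)| <=
    jw d M j x * (2 * enorm' d x).
  rewrite normrM (gtr0_norm J0) ler_wpM2l ?(ltW J0)//.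
  case: ifPn => di; last by rewrite normr0 mulr_ge0.
  rewrite normrM ger0_norm// ler_wpM2l//.
  rewrite -(@ler_pXn2r _ 2)// ?nnegrE// sqr_enorm' real_normK ?num_real//.
  exact: (ler_sumsq (P := fun i : 'I_n.+1 => (d <= i)%N)).
have S0 := sumsq_pos d x; set S := (1 + _) in S0 *.
have b2 : `|j * (M%:R * S ^+ M.-1 * (if (i < d)%N then 2 * x ord0 i else 0))| <=
    jw d M j x * M%:R.
  rewrite normrM (gtr0_norm j0) /jw -/S -[leRHS]mulrA ler_wpM2l ?(ltW j0)//.
  have SM : 0 <= M%:R * S ^+ M.-1 by rewrite mulr_ge0// exprn_ge0// ltW.
  rewrite normrM (ger0_norm SM); have [M0|M0] := posnP M.
    by rewrite M0 !mul0r mulr0.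
  have xS : `|if (i < d)%N then 2 * x ord0 i else 0| <= S.
    case: ifPn => di; last by rewrite normr0 ltW.
    have := ler_sumsq (P := fun i : 'I_n.+1 => (i < d)%N) x di.
    rewrite normrM ger0_norm// -(real_normK (num_real (x ord0 i))) /S.
    have := sqr_ge0 (`|x ord0 i| - 1); nra.
  apply: (le_trans (ler_wpM2l SM xS)).
  by rewrite -mulrA -exprSr prednK// mulrC.
apply: (le_trans (ler_normD _ _)).
rewrite [X in _ + X]normrM (ger0_norm (sqr_ge0 _)).
have := ler_wpM2l (sqr_ge0 (enorm' d x)) b2; move: b1; nra.
Qed.

Definition eta x : R := step (tau x).

Lemma C1_grad_eta : C1_grad eta (fun i x => step' (tau x) * tau_grad i x).
Proof. exact: (C1_grad_comp (@is_derive_step R) (@continuous_step' R) C1_grad_tau). Qed.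

(** The gradient of [eta] lives in the layer where jw |x'|^2 <= 2. There it is
    controlled by jw |x'|, which is at most of the order of jw^(1/2). *)
Lemma enorm_grad_eta x P : 0 < P ->
  enorm (grad eta x) `^ P <=
  (n.+1%:R * (8 * (1 + M%:R))) `^ P * shell_density d M j (2^-1 * P) x.
Proof.
move=> P0; have J0 := jw_gt0 d M j0 x; have N0 := enorm'_ge0 d x.
have [t2|t2] := leP 2 (tau x).
  rewrite (_ : grad eta x = 0) ?enorm0 ?powR0 ?gt_eqF//.
    by rewrite mulr_ge0 ?powR_ge0 ?shell_density_ge0.
  rewrite (C1_gradE x C1_grad_eta); apply/rowP => i; rewrite !mxE.
  by rewrite (step_ge1 t2).2 mul0r.
have tauN := tauE x.
have thin1 : \prod_(i < n.+1 | (d <= i)%N) thin (x ord0 i) (jw d M j x) = 1.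
  apply: big1 => i di; rewrite /thin ifT// ltW// (le_lt_trans _ t2)//.
  rewrite /tau [leRHS]mulrC ler_wpM2r ?(ltW J0)//.
  exact: (ler_sumsq (P := fun i : 'I_n.+1 => (d <= i)%N)).
have N2 : enorm' d x <= 2.
  have h1 := ler_wpM2r (sqr_ge0 (enorm' d x)) (jw_ge1 x).
  by rewrite -(@ler_pXn2r _ 2)// ?nnegrE//; nra.
have JN : jw d M j x * enorm' d x <= 2 * jw d M j x `^ 2^-1.
  have q2 : (jw d M j x `^ 2^-1) ^+ 2 = jw d M j x.
    by rewrite -powR_mulrn ?powR_ge0// -powRrM mulVf// powRr1// (ltW J0).
  have h := ler_wpM2l (ltW J0) (ltW t2); rewrite tauN in h.
  have e1 : (jw d M j x * enorm' d x) ^+ 2 =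
      jw d M j x * (jw d M j x * enorm' d x ^+ 2) by ring.
  have e2 : (2 * jw d M j x `^ 2^-1) ^+ 2 = 4 * jw d M j x.
    by rewrite -[in RHS]q2; ring.
  rewrite -(@ler_pXn2r _ 2)// ?nnegrE.
  - rewrite e1 e2; lra.
  - exact: (mulr_ge0 (ltW J0) N0).
  - exact: (mulr_ge0 (ler0n _ 2) (powR_ge0 _ _)).
have J2 : 0 <= jw d M j x `^ 2^-1 := powR_ge0 _ _.
have gi i : `|step' (tau x) * tau_grad i x| <= 8 * (1 + M%:R) * jw d M j x `^ 2^-1.
  have [_ /andP[s0 s2]] := step_bounds (tau x).
  rewrite normrM (ger0_norm s0).
  have h := tau_grad_le i x.
  have MN : M%:R * enorm' d x <= M%:R * 2 by rewrite ler_wpM2l.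
  have M0 : 0 <= M%:R :> R by [].
  have h2 : jw d M j x * enorm' d x * (2 + M%:R * enorm' d x) <=
      2 * jw d M j x `^ 2^-1 * (2 + M%:R * 2).
    apply: ler_pM => //; first by rewrite mulr_ge0// ltW.
      by rewrite addr_ge0// mulr_ge0.
    by rewrite lerD2l.
  apply: (le_trans (ler_pM s0 (normr_ge0 _) s2 (le_trans h h2))).
  by rewrite le_eqVlt; apply/orP; left; apply/eqP; ring.
rewrite /shell_density thin1 mulr1 powRrM -powRM ?mulr_ge0//.
apply: ge0_ler_powR; rewrite ?nnegrE ?(ltW P0) ?enorm_ge0 ?mulr_ge0//.
rewrite (C1_gradE x C1_grad_eta); apply: le_trans (enorm_le_sum _) _.
rewrite -mulrA -[X in X%:R * _]card_ord mulr_natl -sumr_const.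
by apply: ler_sum => i _; rewrite mxE; exact: gi.
Qed.

(** Cuts off at distance k from the origin. *)
Definition chi x : R := 1 + (-1) * step (k ^- 2 * \sum_i x ord0 i ^+ 2).

Lemma C1_grad_chi : C1_grad chi (fun i x => (-1) *
   (step' (k ^- 2 * \sum_i x ord0 i ^+ 2) * (k ^- 2 * (2 * x ord0 i)))).
Proof.
have H1 := C1_gradM (C1_grad_cst n.+1 (k ^- 2)) (@C1_grad_sumsq R n.+1 predT).
have H2 := C1_grad_comp (@is_derive_step R) (@continuous_step' R) H1.
have H3 := C1_gradM (C1_grad_cst n.+1 (-1 : R)) H2.
have := C1_gradD (C1_grad_cst n.+1 (1 : R)) H3.
congr C1_grad; apply/funext => i; apply/funext => x.
by rewrite add0r mulr0 addr0 mulr0 addr0.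
Qed.

Lemma enorm_grad_chi x : enorm (grad chi x) <= n.+1%:R * (8 / k).
Proof.
have k2 : 0 < k ^- 2 by rewrite invr_gt0 exprn_gt0.
rewrite (C1_gradE x C1_grad_chi); apply: le_trans (enorm_le_sum _) _.
rewrite -[X in X%:R * _]card_ord mulr_natl -sumr_const; apply: ler_sum => i _.
rewrite mxE; set s := k ^- 2 * _.
have K8 : 0 <= 8 / k by rewrite divr_ge0// ltW.
have [s2|s2] := leP 2 s; first by rewrite (step_ge1 s2).2 mul0r mulr0 normr0.
have [_ /andP[b0 b2]] := step_bounds s.
rewrite normrM normrN1 mul1r normrM (ger0_norm b0) normrM (gtr0_norm k2) normrM ger0_norm//.
have xk : `|x ord0 i| <= 2 * k.
  rewrite -(@ler_pXn2r _ 2)// ?nnegrE ?mulr_ge0 ?(ltW k0)// real_normK ?num_real//.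
  apply: le_trans (ler_sumsq (P := predT) x (i := i) isT) _.
  move: s2; rewrite /s mulrC ltr_pdivrMr ?exprn_gt0// => /ltW h.
  by apply: (le_trans h); rewrite exprMn ler_wpM2r ?sqr_ge0//; lra.
apply: (@le_trans _ _ (2 * (k ^- 2 * (2 * (2 * k))))).
  by apply: ler_pM => //; rewrite ?mulr_ge0 ?(ltW k2)// ler_wpM2l ?(ltW k2)// ler_wpM2l.
by rewrite le_eqVlt; apply/orP; left; apply/eqP; field; rewrite gt_eqF.
Qed.

Definition cutoff x : R := eta x * chi x.

Lemma cutoff_bounds x : [/\ 0 <= eta x <= 1, 0 <= chi x <= 1 & 0 <= cutoff x <= 1].
Proof.
have [e01 _] := step_bounds (tau x).
have [c01 _] := step_bounds (k ^- 2 * \sum_i x ord0 i ^+ 2).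
have c : 0 <= chi x <= 1 by rewrite /chi; apply/andP; split; move/andP: c01 => [? ?]; lra.
split => //; move: e01 c; rewrite -/(eta x) /cutoff => /andP[a1 a2] /andP[b1 b2].
by rewrite mulr_ge0//= mulr_ile1.
Qed.

Lemma C1_grad_cutoff_pow s :
  C1_grad (fun x => cutoff x ^+ s)
    (fun i x => s%:R * cutoff x ^+ s.-1 * (eta x *: grad chi x + chi x *: grad eta x) ord0 i).
Proof.
have H := C1_gradM C1_grad_eta C1_grad_chi.
have := C1_grad_comp (is_derive_pow s) (@continuous_pow s.-1 s%:R) H.
congr C1_grad; apply/funext => i; apply/funext => x.
rewrite (C1_gradE x C1_grad_eta) (C1_gradE x C1_grad_chi) !mxE.
by congr (_ * (_ + _)); ring.
Qed.

Lemma continuous_tau : continuous tau.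
Proof. exact: (Ck1_continuous (C1_gradW C1_grad_tau)). Qed.

Lemma tau_Gamma x : Ga x -> tau x = 0.
Proof.
move=> Gx; rewrite /tau big1 ?mulr0// => i di.
by rewrite Gx// expr0n.
Qed.

Lemma open_tau_gt1 : open [set x | 1 < tau x].
Proof.
rewrite (_ : mkset _ = tau @^-1` [set t | 1 < t])//.
by apply: open_comp; [move=> x _; exact: continuous_tau|exact: open_gt].
Qed.

Lemma tau_gt1_off_Gamma (V : set E) : V `<=` [set x | 1 < tau x] -> off_Gamma d V.
Proof.
move=> V1; apply/seteqP; split => // x [Vx Gx].
have cl : closed [set x : E | 1 <= tau x].
  rewrite (_ : mkset _ = tau @^-1` [set t | 1 <= t])//.
  by apply: closed_comp; [move=> y _; exact: continuous_tau|exact: closed_ge].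
have : (closure [set x : E | 1 <= tau x]) x.
  by apply: closure_subset Vx => y /V1 /ltW.
rewrite -(closure_id _).1//= (tau_Gamma Gx).
by rewrite ler10.
Qed.

Definition cutoff_support : set E :=
  [set x | 1 < tau x] `&` ball 0 (2 * k).

Lemma cutoff_out x : ~ cutoff_support x -> cutoff x = 0.
Proof.
move=> xV; have [t1|t1] := leP (tau x) 1.
  by rewrite /cutoff /eta (step_le0 t1).1 mul0r.
rewrite /cutoff /chi (step_ge1 _).1; first by rewrite mulN1r subrr mulr0.
rewrite leNgt; apply/negP => h; apply: xV; split => //.
split; first by rewrite mulr_gt0.
move=> i' i; rewrite ord1 -ball_normE /ball_/= mxE sub0r normrN.
rewrite -(@ltr_pXn2r _ 2)// ?nnegrE ?mulr_ge0 ?(ltW k0)// real_normK ?num_real//.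
apply: le_lt_trans (ler_sumsq (P := predT) x (i := i) isT) _.
move: h; rewrite mulrC ltr_pdivrMr ?exprn_gt0// => h.
by apply: (lt_le_trans h); rewrite exprMn ler_wpM2r ?sqr_ge0//; lra.
Qed.

Lemma open_cutoff_support : open cutoff_support.
Proof. by apply: openI; [exact: open_tau_gt1|exact: ball_open]. Qed.

Lemma bounded_cutoff_support : bounded_set cutoff_support.
Proof.
have [N [NR HN]] := @cube_bounded R n.+1 (2 * k).
exists N; split => // r Nr x [_ /= [_ Hx]]; apply: (HN r Nr x) => i.
have := Hx ord0 i.
by rewrite -ball_normE /ball_/= mxE sub0r normrN => /ltW.
Qed.

End cutoffs.

(** * The energy estimate *)

Section energy.
Variable R : realType.

(** The point is that f need not be integrable a priori. As +oo + -oo = -oo in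
    [\bar R], the vanishing of the sum forces the positive and negative parts of f to
    have finite integrals once s >= 0. *)
Lemma balance dd (X : measurableType dd) (m : {measure set X -> \bar R})
    (D : set X) (f Q Y : X -> R) (s : \bar R) :
  measurable D -> measurable_fun D f -> measurable_fun D Q -> measurable_fun D Y ->
  (forall x, D x -> 0 <= Q x) -> (forall x, D x -> 0 <= Y x) ->
  (forall x, D x -> Q x <= f x + Y x) -> (0 <= s)%E ->
  (\int[m]_(x in D) (f x)%:E + s = 0)%E ->
  (\int[m]_(x in D) (Q x)%:E + s <= \int[m]_(x in D) (Y x)%:E)%E.
Proof.
move=> mD mf mQ mY Q0 Y0 QfY s0.
have mfE : measurable_fun D (EFin \o f) by exact/measurable_EFinP.
have mQE : measurable_fun D (EFin \o Q) by exact/measurable_EFinP.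
have mYE : measurable_fun D (EFin \o Y) by exact/measurable_EFinP.
have key : (\int[m]_(x in D) (Q x)%:E + \int[m]_(x in D) (EFin \o f)^\- x <=
    \int[m]_(x in D) (EFin \o f)^\+ x + \int[m]_(x in D) (Y x)%:E)%E.
  rewrite -!ge0_integralD//.
  - apply: ge0_le_integral => //.
    + by move=> x Dx; rewrite adde_ge0// lee_fin Q0.
    + by apply: emeasurable_funD => //; exact: measurable_funeneg.
    + by apply: emeasurable_funD => //; exact: measurable_funepos.
    + move=> x Dx; rewrite funeposE funenegE /= -!EFin_max -!EFinD lee_fin.
      by have := QfY x Dx; case: (leP 0 (f x)) => f0; case: (leP 0 (- f x)) => f1 //=; lra.
  - exact: measurable_funepos.
  - exact: measurable_funeneg.
have P0 : (0 <= \int[m]_(x in D) (EFin \o f)^\+ x)%E by apply: integral_ge0.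
have N0 : (0 <= \int[m]_(x in D) (EFin \o f)^\- x)%E by apply: integral_ge0.
have I0 : (0 <= \int[m]_(x in D) (Q x)%:E)%E by apply: integral_ge0 => x /Q0; rewrite lee_fin.
have J0 : (0 <= \int[m]_(x in D) (Y x)%:E)%E by apply: integral_ge0 => x /Y0; rewrite lee_fin.
rewrite [in X in X -> _]integralE.
move: (\int[m]_(x in D) (EFin \o f)^\+ x)%E P0 key => ip P0.
move: (\int[m]_(x in D) (EFin \o f)^\- x)%E N0 => im N0.
move: (\int[m]_(x in D) (Q x)%:E)%E I0 => iq I0.
move: (\int[m]_(x in D) (Y x)%:E)%E J0 => iy J0.
case: ip P0 => [ip||]// P0; case: im N0 => [im||]// N0; case: s s0 => [s||]// s0;
  case: iq I0 => [iq||]// I0; case: iy J0 => [iy||]// J0; rewrite ?leey//.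
by rewrite -!EFinD !lee_fin => h [e]; lra.
Qed.

(** Multiply [key_inequality] at y_i = e_i / z by z^s: the negative powers of z are
    absorbed because s is at least P and p. *)
Lemma scaled_inequality (a p q m A : R) (s : nat) :
  0 < a < 2^-1 -> 1 < p -> p - 1 < q -> 0 < m -> 0 <= A ->
  let P := p * (q + (1 - 2 * a)) / (q - p + 1) in
  P <= s%:R -> p <= s%:R ->
  exists2 C, 0 <= C & forall x t z e1 e2, 0 <= x -> 0 <= z <= 1 -> 0 <= e1 -> 0 <= e2 ->
    A * x `^ (p - 1) * `|odd_power a t| * (s%:R * z ^+ s.-1) * (e1 + e2) <=
    (m / 2 * odd_power' a t * x `^ p + 2^-1 * `|t| `^ q * `|odd_power a t|) * z ^+ s +
    C * (e1 `^ P + `|t| `^ p * e2 `^ p).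
Proof.
move=> a01 p1 pq m0 A0 P Ps ps.
have [C C0 HC] := key_inequality a01 p1 pq m0 (mulr_ge0 A0 (ler0n _ s)).
exists C => // x t z e1 e2 x0 /andP[z0 z1] e10 e20.
have s1 : (1 < s)%N by rewrite -(ltr_nat R) (lt_le_trans p1).
have R3 : 0 <= C * (e1 `^ P + `|t| `^ p * e2 `^ p).
  by rewrite mulr_ge0// addr_ge0 ?mulr_ge0 ?powR_ge0.
have [zz|zz] := eqVneq z 0.
  by case: s s1 {Ps ps HC} => [|[|s]]// _; rewrite zz !exprS !mul0r !mulr0 mul0r add0r.
have z00 : 0 < z by rewrite lt0r zz.
have zs0 : 0 < z ^+ s by rewrite exprn_gt0.
have := HC x t (e1 / z) (e2 / z) x0 (divr_ge0 e10 z0) (divr_ge0 e20 z0).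
move=> /(ler_wpM2l (ltW zs0)).
have zsE : z ^+ s = z * z ^+ s.-1 by rewrite -exprS prednK// ltnW.
have pw r e : 0 <= e -> r <= s%:R -> z ^+ s * (e / z) `^ r <= e `^ r.
  move=> e0 rs; rewrite powRM ?invr_ge0// mulrCA -[leRHS]mulr1 ler_wpM2l ?powR_ge0//.
  rewrite -(powR_inv1 z0) -powRrM mulN1r -powR_mulrn// -powRD ?(gt_eqF z00) ?implybT//.
  by rewrite -{2}(powRr0 z) ger_powR ?z00// subr_ge0.
have h1 := ler_wpM2l C0 (pw P e1 e10 Ps).
have h2 := ler_wpM2l (mulr_ge0 C0 (powR_ge0 `|t| p)) (pw p e2 e20 ps).
rewrite (_ : z ^+ s * (A * s%:R * x `^ (p - 1) * `|odd_power a t| * (e1 / z + e2 / z)) =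
   A * x `^ (p - 1) * `|odd_power a t| * (s%:R * z ^+ s.-1) * (e1 + e2)); last first.
  by rewrite zsE; field; rewrite gt_eqF.
move: (_ * _ * (e1 + e2)) (e1 `^ P) (e2 `^ p) ((e1 / z) `^ P) ((e2 / z) `^ p) h1 h2 => L E1 E2 E3 E4.
move: (`|t| `^ p) (_ + _ * `|odd_power a t|) (z ^+ s) => T1 T2 T3 h1 h2 h3; lra.
Qed.

End energy.

Lemma linear_balance (R : realType) (e x1 x2 gp y k1 c a1 a2 : R) :
  - k1 <= x2 -> a1 <= x1 -> a2 <= gp -> c <= y -> k1 <= e + c -> 2 * e = a1 + a2 ->
  e <= x1 + x2 + gp + y.
Proof. lra. Qed.

Section energy_estimate.
Variables (R : realType) (n d : nat) (rho : \bar R).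
Variables (p q alpha beta m m1 : R) (A : 'rV[R]_n.+1 -> 'rV[R]_n.+1) (g b : R -> R).
Variables (u : 'rV[R]_n.+1 -> R) (G : 'rV[R]_n.+1 -> 'rV[R]_n.+1) (T : 'rV[R]_n.+1 -> R).
Local Notation E := 'rV[R]_n.+1.
Local Notation Om := (@Omega R n d rho).
Local Notation bd := (@bdOmega R n d rho).
Local Notation mu := (leb R n.+1).
Hypotheses (dn : (d <= n)%N) (p1 : 1 < p) (pq : p - 1 < q) (m0 : 0 < m) (m10 : 0 <= m1).
Hypotheses (alpha0 : 0 <= alpha).
Hypotheses (mA : measurable_fun [set: E] A) (mg : measurable_fun [set: R] g)
  (mb : measurable_fun [set: R] b).
Hypothesis H1 : condition_H1 p q m m1 A g b.
Hypothesis uLi : Linfty_loc d rho u.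
Hypothesis td : trace_data d rho p u G T.
Hypothesis eqn : forall phi H S, weak_test d rho p alpha phi ->
  weak_grad Om phi H -> is_trace d rho p phi H S ->
  weak_identity d rho alpha beta A g b u G T phi H S.

Lemma measurable_field (D : set E) (F : E -> E) : measurable D ->
  (forall i, measurable_fun D (fun x => F x ord0 i)) ->
  forall i, measurable_fun D (fun x => A (F x) ord0 i).
Proof.
move=> mD mF i.
have mFv : measurable_fun D F by exact: measurable_fun_rVD.
exact: (measurableT_comp (measurable_rV_coordT i) (measurableT_comp mA mFv)).
Qed.

Lemma measurable_integrand phi (H : E -> E) :
  measurable_fun Om phi -> (forall i, measurable_fun Om (fun x => H x ord0 i)) ->
  measurable_fun Om (fun x =>
    (dot (A (G x)) (H x) + g (u x) * phi x) * weight alpha x).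
Proof.
move=> mphi mH; have [m_u mG _] := td.
have mOm := @measurable_Omega R n d rho.
apply: measurable_funM; last by apply: measurable_funTS; exact: measurable_weight.
apply: measurable_funD.
  by apply: measurable_dot => //; exact: measurable_field.
by apply: measurable_funM => //; exact: (measurableT_comp mg).
Qed.

Lemma measurable_boundary_integrand (S : E -> R) : measurable_fun bd S ->
  measurable_fun bd (fun x => b (T x) * S x * weight beta x).
Proof.
move=> mS; have [_ _ [mT _]] := td.
apply: measurable_funM; last by apply: measurable_funTS; exact: measurable_weight.
by apply: measurable_funM => //; exact: (measurableT_comp mb).
Qed.

Section with_exponent.
Variable a : R.
Hypothesis a01 : 0 < a < 2^-1.
Let P : R := p * (q + (1 - 2 * a)) / (q - p + 1).
Variable s : nat.
Hypotheses (Ps : P <= s%:R) (ps : p <= s%:R).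
Let h := odd_power a.
Let h' := odd_power' a.

(** The quantity that the test function h(u) zeta^s controls; the halves are what
    remains after the absorption. *)
Definition energy x : R := m / 2 * h' (u x) * enorm (G x) `^ p +
  2^-1 * `|u x| `^ q * `|h (u x)|.

Lemma energy_ge0 x : 0 <= energy x.
Proof.
have h0 := odd_power'_gt0 a01 (u x).
apply: addr_ge0; last by rewrite !mulr_ge0 ?powR_ge0.
by apply: mulr_ge0 (powR_ge0 _ _); apply: mulr_ge0 (ltW h0); rewrite divr_ge0// ltW.
Qed.

Lemma measurable_energy : measurable_fun Om energy.
Proof.
have [m_u mG _] := td; have mOm := @measurable_Omega R n d rho.
have ch : continuous h.
  move=> t; apply: differentiable_continuous; apply/derivable1_diffP.
  by have [] := is_derive_odd_power a t.
have mh := continuous_measurable_fun ch.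
have mh' := continuous_measurable_fun (@continuous_odd_power' R a).
apply: measurable_funD; apply: measurable_funM.
- by apply: measurable_funM => //; exact: (measurableT_comp mh').
- by apply: measurable_powRD; exact: measurable_enormD.
- by apply: measurable_funM => //; apply: measurable_powRD; exact: measurable_normD.
- by apply: measurable_normD; exact: (measurableT_comp mh).
Qed.

(** Test the equation with h(u) zeta^s for zeta = [cutoff d M j k], and drop the
    weight from the error terms, as it is at most 1. *)
Lemma energy_estimate (M : nat) : exists2 C, 0 <= C & forall j k : R, 1 <= j -> 0 < k ->
  (\int[mu]_(x in Om) (energy x * cutoff d M j k x ^+ s * weight alpha x)%:E +
   surface_integral d rho (fun x =>
     (b (T x) * (h (T x) * cutoff d M j k x ^+ s) * weight beta x)%:E) <=
   C%:E * \int[mu]_x (shell_density d M j (2^-1 * P) x)%:E +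
   (C * (n.+1%:R * (8 / k)) `^ p)%:E *
     \int[mu]_(x in Om `&` [set x : E | (1 < tau d M j x)%R]) (`|u x| `^ p)%:E)%E.
Proof.
have minv : 0 <= m^-1 by rewrite invr_ge0 ltW.
have [C0 C00 HC] := scaled_inequality a01 p1 pq m0 minv Ps ps.
have s1 : (1 < s)%N by rewrite -(ltr_nat R) (lt_le_trans p1).
have r0 : 0 < q - p + 1 by rewrite (_ : _ + 1 = q - (p - 1)) ?subr_gt0//; ring.
have k0' : 0 < 1 - 2 * a by case/andP: a01 => _ a2; rewrite subr_gt0 mulrC -ltr_pdivlMr// mul1r.
have P0 : 0 < P.
  rewrite divr_gt0// mulr_gt0 ?(lt_trans ltr01 p1)// addr_gt0//.
    by apply: lt_trans pq; rewrite subr_gt0.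
pose Ce := (n.+1%:R * (8 * (1 + M%:R))) `^ P.
have Ce0 : 0 <= Ce := powR_ge0 _ _.
exists (C0 * (Ce + 1)); first by rewrite mulr_ge0// addr_ge0.
move=> j k j1 k0.
have [m_u mG _] := td; have mOm := @measurable_Omega R n d rho.
pose V := @cutoff_support R n d M j k.
pose z (x : E) := cutoff d M j k x ^+ s.
have z01 x : 0 <= z x <= 1.
  have [_ _ /andP[c0 c1]] := cutoff_bounds d M j k x.
  by rewrite /z exprn_ge0//= exprn_ile1.
pose phi x := h (u x) * z x.
have td' := trace_chain dn p1 td (is_derive_odd_power a) (@continuous_odd_power' R a)
  (odd_power'_le1 a01) (odd_power_lipschitz a01) _ (odd_power'_lipschitz a01)
  (@C1_grad_cutoff_pow R n d M j k s) z01.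
have L0 : 0 <= 2 * a * (a + 1) + (1 - 2 * a) * a.
  case/andP: a01 => a0 _; have := ltW a0 => a0'.
  have a2 : 0 <= 2 * a by rewrite mulr_ge0.
  exact: addr_ge0 (mulr_ge0 a2 (addr_ge0 a0' ler01)) (mulr_ge0 (ltW k0') a0').
move: {td'}(td' L0); set H := (fun x : E => _ *: G x + _); set S := (fun x : E => h (T x) * _).
rewrite -/phi => td'.
have [mphi mH [mS trS]] := td'.
have HE (x : E) : H x = (h' (u x) * z x) *: G x + (h (u x) * (s%:R * cutoff d M j k x ^+ s.-1)) *:
    (eta d M j x *: grad (chi k) x + chi k x *: grad (eta d M j) x).
  by apply/rowP => i; rewrite /H !mxE -/h -/h' -/(z x); ring.
have out (x : E) : cutoff d M j k x = 0 -> phi x = 0 /\ H x = 0.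
  move=> c0; rewrite HE /phi /z c0; case: s s1 => [|[|s']]// _.
  by rewrite !expr0n/= !mulr0 !scale0r addr0.
have Li : Linfty_loc d rho phi.
  move=> U oU UO gU; have [mU [N HN]] := uLi oU UO gU.
  split; first exact: (measurable_funS mOm UO).
  exists N; move: HN; apply: filterS => x Hx Ux; apply: le_trans (Hx Ux).
  have /andP[z0x z1x] := z01 x.
  rewrite /phi normrM (ger0_norm z0x) -[leRHS]mulr1; apply: ler_pM => //.
  exact: odd_power_le.
have wt : weak_test d rho p alpha phi.
  apply: (admissible dn p1 alpha0 td' (V := V)) => //.
  - exact: open_cutoff_support.
  - exact: bounded_cutoff_support.
  - by apply: (@tau_gt1_off_Gamma R n d M j) => x [].
  - by move=> x xV; apply: out; exact: cutoff_out.
have id0 := eqn wt (weak_grad_of_trace dn p1 td') (conj mS trS).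
pose e2 := n.+1%:R * (8 / k).
have e20 : 0 <= e2 by rewrite mulr_ge0// divr_ge0// ltW.
pose X (x : E) := \1_[set x : E | (1 < tau d M j x)%R] x : R.
have mX : measurable_fun [set: E] X.
  by apply: measurable_indic; apply: open_rV_measurable; exact: open_tau_gt1.
have mz : measurable_fun [set: E] z.
  exact: (Ck1_measurable (C1_gradW (@C1_grad_cutoff_pow R n d M j k s))).
pose C := C0 * (Ce + 1).
have C_ge0 : 0 <= C by rewrite mulr_ge0// addr_ge0.
pose Y x := C * shell_density d M j (2^-1 * P) x + C * e2 `^ p * (`|u x| `^ p * X x).
have mup : measurable_fun Om (fun x => `|u x| `^ p * X x).
  apply: measurable_funM; last exact: measurable_funTS.
  by apply: measurable_powRD; exact: measurable_normD.
have mSh : measurable_fun Om (@shell_density R d M j n.+1 (2^-1 * P)).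
  by apply: measurable_funTS; exact: measurable_shell_density.
have X0 x : 0 <= X x by rewrite /X indicE.
have Y0 x : 0 <= Y x.
  exact: addr_ge0 (mulr_ge0 C_ge0 (shell_density_ge0 _ _ _ _ _))
    (mulr_ge0 (mulr_ge0 C_ge0 (powR_ge0 _ _)) (mulr_ge0 (powR_ge0 _ _) (X0 x))).
have w0 (x : E) := ltW (weight_gt0 alpha x).
have w1 (x : E) := weight_le1 x alpha0.
have surf0 : (0 <= surface_integral d rho (fun x => (b (T x) * S x * weight beta x)%:E))%E.
  apply: surface_integral_ge0 => // x _; rewrite lee_fin.
  have /andP[z0x _] := z01 x.
  rewrite mulr_ge0 ?(ltW (weight_gt0 _ _))// /S -/(z x) mulrA mulr_ge0//.
  rewrite /h odd_power_sg mulrCA mulr_ge0//.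
  by apply: le_trans (H1.2 (T x)).2; rewrite mulr_ge0 ?powR_ge0.
have pt x : Om x -> energy x * z x * weight alpha x <=
    (dot (A (G x)) (H x) + g (u x) * phi x) * weight alpha x + Y x.
  move=> Ox; have /andP[z0x z1x] := z01 x.
  have [t1|t1] := leP (tau d M j x) 1.
    have c0 : cutoff d M j k x = 0 by rewrite /cutoff /eta (step_le0 t1).1 mul0r.
    have [-> ->] := out x c0.
    have z0 : z x = 0 by rewrite /z c0 expr0n; case: s s1.
    rewrite z0 !mulr0 mul0r addr0 (_ : dot _ 0 = 0) ?mul0r ?add0r ?Y0//.
    by rewrite /dot big1// => i _; rewrite mxE mulr0.
  have X1 : X x = 1 by rewrite /X indicE mem_set.
  have [/andP[eta0 eta1] /andP[chi0 chi1] c01] := cutoff_bounds d M j k x.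
  have /andP[c0 c1] := c01.
  pose v := eta d M j x *: grad (chi k) x + chi k x *: grad (eta d M j) x.
  pose f1 := enorm (grad (eta d M j) x); pose f2 := enorm (grad (chi k : E -> R) x).
  have f10 : 0 <= f1 := enorm_ge0 _.
  have f20 : 0 <= f2 := enorm_ge0 _.
  have vle : enorm v <= f1 + f2.
    apply: le_trans (enormD _ _) _; rewrite !enormZ (ger0_norm eta0) (ger0_norm chi0) addrC.
    by apply: lerD; rewrite ler_piMl ?enorm_ge0.
  have := HC (enorm (G x)) (u x) (cutoff d M j k x) f1 f2 (enorm_ge0 _) c01 f10 f20.
  rewrite -/h -/h' -/(z x) -/(energy x).
  have [HA1 HA2] := H1.1 (G x).
  have h'0 := odd_power'_gt0 a01 (u x).
  have sc : 0 <= s%:R * cutoff d M j k x ^+ s.-1 by rewrite mulr_ge0// exprn_ge0.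
  have B1 : `|h (u x) * (s%:R * cutoff d M j k x ^+ s.-1) * dot (A (G x)) v| <=
      m^-1 * enorm (G x) `^ (p - 1) * `|h (u x)| * (s%:R * cutoff d M j k x ^+ s.-1) * (f1 + f2).
    rewrite normrM normrM (ger0_norm sc).
    have B0 : `|dot (A (G x)) v| <= m^-1 * enorm (G x) `^ (p - 1) * (f1 + f2).
      by apply: le_trans (dot_le_enorm _ _) _; apply: ler_pM; rewrite ?enorm_ge0.
    apply: le_trans (ler_wpM2l (mulr_ge0 (normr_ge0 (h (u x))) sc) B0) _.
    by rewrite le_eqVlt; apply/orP; left; apply/eqP; ring.
  have B2 : h' (u x) * z x * (m * enorm (G x) `^ p) <= h' (u x) * z x * dot (A (G x)) (G x).
    by rewrite ler_wpM2l// mulr_ge0// ltW.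
  have B3 : `|u x| `^ q * `|h (u x)| * z x <= g (u x) * phi x.
    rewrite /phi mulrA ler_wpM2r//.
    rewrite [X in _ <= _ * X](odd_power_sg a) -/h mulrCA mulrC ler_wpM2l//.
    exact: (H1.2 (u x)).1.
  have B4 : C0 * (f1 `^ P + `|u x| `^ p * f2 `^ p) <= Y x.
    have b1 := enorm_grad_eta d M j1 x P0; rewrite -/f1 -/Ce in b1.
    have b2 : f2 `^ p <= e2 `^ p.
      apply: ge0_ler_powR; rewrite ?nnegrE ?(ltW (lt_trans ltr01 p1))//.
      exact: enorm_grad_chi.
    rewrite /Y X1 mulr1 mulrDr; apply: lerD.
      rewrite /C -mulrA ler_wpM2l//; apply: (le_trans b1).
      by rewrite ler_wpM2r ?shell_density_ge0// lerDl.
    rewrite mulrCA [leRHS]mulrC ler_wpM2l ?powR_ge0//.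
    apply: ler_pM; rewrite ?powR_ge0//.
    by rewrite /C ler_peMr// lerDr.
  move=> B5.
  have DE : dot (A (G x)) (H x) = h' (u x) * z x * dot (A (G x)) (G x) +
      h (u x) * (s%:R * cutoff d M j k x ^+ s.-1) * dot (A (G x)) v.
    by rewrite HE dotDr !dotZr.
  have main : energy x * z x <= dot (A (G x)) (H x) + g (u x) * phi x + Y x.
    rewrite DE; move: B1; rewrite ler_norml => /andP[B1 _].
    have E2 : 2 * (energy x * z x) = h' (u x) * z x * (m * enorm (G x) `^ p) +
        `|u x| `^ q * `|h (u x)| * z x.
      by rewrite /energy; field.
    exact: linear_balance B1 B2 B3 B4 B5 E2.
  apply: le_trans (ler_wpM2r (w0 x) main) _; rewrite mulrDl.
  by rewrite lerD2l ler_piMr.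
(* Integrate; the boundary term is nonnegative and stays on the left. *)
have bal : (\int[mu]_(x in Om) (energy x * z x * weight alpha x)%:E +
    surface_integral d rho (fun x => (b (T x) * S x * weight beta x)%:E) <=
    \int[mu]_(x in Om) (Y x)%:E)%E.
  apply: (balance mOm _ _ _ _ _ pt surf0 id0) => //.
  - exact: measurable_integrand.
  - apply: measurable_funM; last by apply: measurable_funTS; exact: measurable_weight.
    by apply: measurable_funM; [exact: measurable_energy|exact: measurable_funTS].
  - by apply: measurable_funD; apply: measurable_funM.
  - move=> x _; have /andP[z0x _] := z01 x.
    by rewrite mulr_ge0// mulr_ge0// energy_ge0.
apply: (le_trans bal).
apply: (@le_trans _ _ (C%:E * \int[mu]_(x in Om) (shell_density d M j (2^-1 * P) x)%:E +
   (C * e2 `^ p)%:E * \int[mu]_(x in Om) (`|u x| `^ p * X x)%:E)%E).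
  apply: le_integral_lin2 => //.
  - by rewrite mulr_ge0 ?powR_ge0.
  - by apply: measurable_funD; apply: measurable_funM.
  - by move=> x _; exact: shell_density_ge0.
  - by move=> x _; rewrite mulr_ge0 ?powR_ge0.
  - by move=> x _; rewrite Y0/=.
apply: leeD; apply: lee_wpmul2l; rewrite ?lee_fin ?mulr_ge0 ?powR_ge0 ?addr_ge0//.
  apply: ge0_subset_integral => //; last by move=> x _; rewrite lee_fin shell_density_ge0.
  by apply/measurable_EFinP; exact: measurable_shell_density.
rewrite -(@integral_supportE _ _ _ mu (Om `&` [set x : E | (1 < tau d M j x)%R])) //; last first.
  move=> x Ox xt; rewrite /X indicE memNset ?mulr0// => tx; exact: xt.
rewrite le_eqVlt; apply/orP; left; apply/eqP; apply: eq_integral => x.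
by rewrite inE => -[_ tx]; rewrite /X indicE mem_set// mulr1.
Qed.

End with_exponent.
End energy_estimate.

(** * Vanishing of the solution *)

Section vanishing_tools.
Variable R : realType.

Lemma cvge0_le (f g : nat -> \bar R) : (forall k, 0 <= f k <= g k)%E ->
  (g k @[k --> \oo] --> 0)%E -> (f k @[k --> \oo] --> 0)%E.
Proof.
move=> fg g0; apply: (squeeze_cvge _ (cvg_cst 0%E) g0).
by near=> k; exact: fg.
Unshelve. all: by end_near. Qed.

(** Letting the second parameter grow fast enough compared with the first one,
    a bound by C I(j) + o(1) as k -> oo gives a diagonal sequence along which the
    left-hand side tends to 0. *)
Lemma diagonal_sequence (F : R -> R -> \bar R) (I L : R -> \bar R) (C K D e p : R) :
  0 <= C -> 0 <= K -> 0 < D -> 0 < e -> 1 <= p ->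
  (forall j, 1 <= j -> (I j <= (K * j `^ (- e))%:E)%E) ->
  (forall j, 1 <= j -> (0 <= L j < +oo)%E) ->
  (forall j k, 1 <= j -> 0 < k ->
    (0 <= F j k <= C%:E * I j + (C * (D / k) `^ p)%:E * L j)%E) ->
  exists j k : nat -> R, [/\ forall N, N.+1%:R <= j N, forall N, N.+1%:R <= k N &
    (F (j N) (k N) @[N --> \oo] --> 0)%E].
Proof.
move=> C0 K0 D0 e0 p1 HI HL HF.
(* The exponent makes both j(N) >= N + 1 and j(N)^(-e) <= 1/(N + 1). *)
pose j N : R := N.+1%:R `^ (e^-1 + 1).
pose k N : R := (D + 1) * (C * fine (L (j N)) + 1) * N.+1%:R.
have N1 (N : nat) : 1 <= N.+1%:R :> R by rewrite ler1n.
have ev : 0 < e^-1 by rewrite invr_gt0.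
have jN N : N.+1%:R <= j N.
  by rewrite -[leLHS]powRr1// ler_powR// lerDr ltW.
have j1 N : 1 <= j N := le_trans (N1 N) (jN N).
have l0 N : 0 <= C * fine (L (j N)).
  by have /andP[L0 _] := HL _ (j1 N); apply: mulr_ge0 => //; exact: fine_ge0.
have k1 N : 1 <= (D + 1) * (C * fine (L (j N)) + 1).
  by apply: mulr_ege1; rewrite lerDr// ltW.
have kN N : N.+1%:R <= k N by rewrite /k ler_peMl.
have k0 N : 0 < k N by apply: lt_le_trans (kN N); rewrite ltr0n.
exists j, k; split => //.
have F0 N : (0 <= F (j N) (k N))%E by have /andP[] := HF _ _ (j1 N) (k0 N).
have bound N : (F (j N) (k N) <= ((C * K + 1) / N.+1%:R)%:E)%E.
  have /andP[_ H] := HF _ _ (j1 N) (k0 N); apply: (le_trans H).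
  have /andP[L0 L1] := HL _ (j1 N).
  have NV : 0 <= N.+1%:R^-1 :> R by rewrite invr_ge0.
  rewrite mulrDl EFinD; apply: leeD.
    apply: (@le_trans _ _ (C%:E * (K * j N `^ (- e))%:E)%E).
      by apply: lee_wpmul2l; [rewrite lee_fin|exact: HI].
    rewrite -EFinM lee_fin mulrA ler_wpM2l ?mulr_ge0//.
    rewrite /j -powRrM -[leRHS]powR_inv1// ler_powR//.
    by rewrite mulrDl mul1r mulrN mulVf ?gt_eqF// gerDl oppr_le0 ltW.
  rewrite -[L _]fineK ?ge0_fin_numE// -EFinM lee_fin mul1r.
  have y1 : D / k N <= ((C * fine (L (j N)) + 1) * N.+1%:R)^-1.
    rewrite /k -mulrA invfM mulrA ler_piMl//.
      by rewrite invr_ge0 mulr_ge0// addr_ge0.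
    by rewrite ler_pdivrMr ?mul1r ?lerDl ?addr_gt0.
  have y0 : 0 <= D / k N by rewrite divr_ge0 ?ltW.
  have y2 : D / k N <= 1.
    apply: (le_trans y1); rewrite invf_le1 ?mulr_gt0 ?ltr_wpDl//.
    by apply: mulr_ege1 => //; rewrite lerDr.
  have yp : (D / k N) `^ p <= D / k N.
    have [->|yn] := eqVneq (D / k N) 0; first by rewrite powR0// gt_eqF// (lt_le_trans ltr01).
    by apply: ge1r_powR => //; rewrite y2 andbT lt_def yn.
  apply: (@le_trans _ _ (C * fine (L (j N)) * ((C * fine (L (j N)) + 1) * N.+1%:R)^-1)).
    rewrite mulrAC ler_wpM2l//; exact: le_trans yp y1.
  rewrite invfM mulrA ler_piMl// ler_pdivrMr ?mul1r ?lerDl ?ltr_wpDl//.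
apply/cvge0P => // eps eps0; near=> N.
apply: (le_trans (bound N)); rewrite lee_fin ler_pdivrMr// -ler_pdivrMl//.
apply: ltW; apply: (lt_le_trans (Num.Theory.truncnS_gt _)).
rewrite ler_nat ltnS.
near: N; exact: nbhs_infty_ge.
Unshelve. all: by end_near. Qed.

End vanishing_tools.

Section surface_null.
Variables (R : realType) (n d : nat) (rho : \bar R).
Hypothesis dn : (d < n)%N.
Let dn' : (d <= n)%N := ltnW dn.
Local Notation E := 'rV[R]_n.+1.
Local Notation bd := (@bdOmega R n d rho).

(** Vanishing almost everywhere for the surface measure, read in the charts in
    which the surface integral is written. *)
Definition surface_ae0 (f : E -> R) : Prop :=
  (\forall y \ae leb R n, flat d rho y -> f (snoc y 0) = 0) /\
  (forall r : R, rho = r%:E -> \forall y \ae leb R n, cap d r y -> f (capmap d r y) = 0).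

Lemma enorm'_gt0 m (y : 'rV[R]_m.+1) : (d <= m)%N -> y ord0 ord_max != 0 -> 0 < enorm' d y.
Proof.
move=> dm y0; rewrite lt_def enorm'_ge0 andbT; apply: contra_neq y0 => y0.
apply/eqP; rewrite -normr_le0 -y0.
rewrite -(@ler_pXn2r _ 2)// ?nnegrE ?enorm'_ge0// sqr_enorm'.
have H := @ler_sumsq R m.+1 (fun i => (d <= i)%N) y ord_max dm.
by rewrite (real_normK (num_real (y ord0 ord_max))).
Qed.

(** Where x' = 0 the last coordinate vanishes, and this hyperplane is a null set. *)
Lemma ae_enorm'_gt0 : \forall y \ae leb R n, 0 < enorm' d y.
Proof.
case: n dn => // m dm.
exists [set y : 'rV[R]_m.+1 | y ord0 ord_max = 0]; split.
- rewrite (_ : mkset _ = setT `&` (fun y : 'rV[R]_m.+1 => y ord0 ord_max) @^-1` [set 0]).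
    by apply: measurable_rV_coordT.
  by rewrite setTI.
- exact: leb_hyperplane.
- move=> y /=; apply: contra_notP => /eqP; exact: enorm'_gt0.
Qed.

(** [fatou_ae0] in both charts; the area element is positive on the cap. *)
Lemma surface_fatou_ae0 (f : nat -> E -> R) (f0 : E -> R) :
  (forall k, measurable_fun bd (f k)) -> (forall k x, bd x -> 0 <= f k x) ->
  (surface_integral d rho (EFin \o f k) @[k --> \oo] --> 0)%E ->
  (forall x, bd x -> 0 < enorm' d x -> \forall k \near \oo, f k x = f0 x) ->
  surface_ae0 f0.
Proof.
move=> mf f_ge0 cf ef.
have flat0 k : (0 <= \int[leb R n]_(y in flat d rho) (f k (snoc y 0))%:E)%E.
  by apply: integral_ge0 => y yf; rewrite lee_fin; exact/f_ge0/flat_bdOmega.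
split.
  apply: (fatou_ae0 (F := fun k y => f k (snoc y 0))).
  - exact: measurable_flat.
  - by move=> k; exact: measurable_flat_bd.
  - by move=> k y yf; exact/f_ge0/flat_bdOmega.
  - apply: cvge0_le cf => k; rewrite flat0/=; apply: leeDl.
    case rhoE : {1}rho => [r||]//; apply: integral_ge0 => y yc.
    apply: mule_ge0; first by rewrite lee_fin; exact/f_ge0/cap_bdOmega.
    by rewrite lee_fin ltW//; exact: jac_gt0.
  - move: ae_enorm'_gt0; apply: filterS => y y0 yf.
    apply: ef; first exact: flat_bdOmega.
    by rewrite (enorm'_snoc dn') sqrtr_gt0 expr0n addr0 exprn_gt0.
move=> r rhoE.
have mj : measurable_fun (@cap R n d r) (@jac R n d r).
  by apply: measurable_funTS; exact: measurable_jac.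
have cap0 k y : cap d r y -> 0 <= f k (capmap d r y) * jac d r y.
  move=> yc; apply: mulr_ge0; first exact/f_ge0/cap_bdOmega.
  by rewrite ltW//; exact: jac_gt0.
have := fatou_ae0 (m := leb R n) (D := cap d r)
  (F := fun k y => f k (capmap d r y) * jac d r y) (F0 := fun y => f0 (capmap d r y) * jac d r y).
move=> /(_ (@measurable_cap R n d r)) H.
have {H} : \forall y \ae leb R n, cap d r y -> f0 (capmap d r y) * jac d r y = 0.
  apply: H => //.
  - move=> k; apply: measurable_funM => //; exact: (measurable_capmap_bd dn' rhoE).
  - move: flat0 cf; rewrite /surface_integral rhoE => flat0; apply: cvge0_le => k.
    apply/andP; split; first by apply: integral_ge0 => y yc; rewrite lee_fin; exact: cap0.
    exact: (leeDr _ (flat0 k)).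
  - apply: aeW => y yc.
    have r0 : 0 < r by exact: le_lt_trans (enorm'_ge0 d y) yc.
    have := ef _ (cap_bdOmega dn' rhoE yc).
    rewrite (enorm'_capmap dn' yc) => /(_ r0); apply: filterS => k ->; reflexivity.
apply: filterS => y Hy yc; apply/eqP; move/eqP: (Hy yc).
by rewrite mulf_eq0 [X in _ || X]gt_eqF ?orbF//; exact: jac_gt0.
Qed.

End surface_null.

Section vanishing.
Variables (R : realType) (n d : nat) (rho : \bar R) (p q alpha beta m m1 : R).
Local Notation E := 'rV[R]_n.+1.
Local Notation Om := (@Omega R n d rho).
Local Notation bd := (@bdOmega R n d rho).
Local Notation mu := (leb R n.+1).

(** The strict inequality for the exponent at kappa = 0 leaves room for a small
    kappa = 1 - 2a = e. *)
Lemma exists_exponent : 1 < p -> p - 1 < q -> p * q / (q - p + 1) < n.+1%:R - d%:R ->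
  exists2 a : R, 0 < a < 2^-1 &
    p * (q + (1 - 2 * a)) / (q - p + 1) < n.+1%:R - d%:R.
Proof.
move=> p1 pq; have r0 : 0 < q - p + 1 by lra.
rewrite ltr_pdivrMr//; set K := (_ * (q - p + 1)) => K0.
have p0 : 0 < p by exact: lt_trans p1.
pose e := Num.min 2^-1 ((K - p * q) / (2 * p)).
have e0 : 0 < e.
  by rewrite lt_min invr_gt0 ltr0n/= divr_gt0 ?subr_gt0// mulr_gt0.
have e1 : e <= 2^-1 by rewrite ge_min lexx.
have e2 : e * (2 * p) <= K - p * q.
  by rewrite -ler_pdivlMr ?mulr_gt0// ge_min lexx orbT.
exists ((1 - e) / 2); first by apply/andP; split; lra.
rewrite ltr_pdivrMr// -/K.
by have pe := mulr_gt0 p0 e0; lra.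
Qed.

Lemma cutoff_eventually1 (M : nat) (j k : nat -> R) (x : E) :
  (forall N, N.+1%:R <= j N) -> (forall N, N.+1%:R <= k N) -> 0 < enorm' d x ->
  \forall N \near \oo, cutoff d M (j N) (k N) x = 1.
Proof.
move=> Hj Hk x0; near=> N.
have N1 : 1 <= N.+1%:R :> R by rewrite ler1n.
have k1 : 0 < k N by apply: lt_le_trans (Hk N).
have j1 : 0 < j N by apply: lt_le_trans (Hj N).
have x2 : 0 < enorm' d x ^+ 2 by rewrite exprn_gt0.
have t2 : 2 <= tau d M (j N) x.
  rewrite tauE; apply: (@le_trans _ _ (j N * enorm' d x ^+ 2)).
    rewrite -ler_pdivrMr//; apply: le_trans (Hj N); apply: ltW.
    apply: (lt_le_trans (Num.Theory.truncnS_gt _)); rewrite ler_nat ltnS.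
    by near: N; exact: nbhs_infty_ge.
  by rewrite ler_wpM2r ?(ltW x2)// /jw ler_peMr ?(ltW j1)// exprn_ege1// lerDl sumsq_ge0.
rewrite /cutoff /eta (step_ge1 t2).1 mul1r /chi (step_le0 _).1 ?mulr0 ?addr0//.
rewrite -sqr_enorm mulrC -exprVn -exprMn exprn_ile1// ?divr_ge0 ?enorm_ge0 ?(ltW k1)//.
rewrite ler_pdivrMr// mul1r; apply: le_trans (Hk N); apply: ltW.
apply: (lt_le_trans (Num.Theory.truncnS_gt _)); rewrite ler_nat ltnS.
by near: N; exact: nbhs_infty_ge.
Unshelve. all: by end_near. Qed.

Variables (A : E -> E) (g b : R -> R) (u : E -> R) (G : E -> E) (T : E -> R).
Hypotheses (dn : (d < n)%N) (p1 : 1 < p) (pq : p - 1 < q) (m0 : 0 < m) (m10 : 0 < m1).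
Hypotheses (alpha0 : 0 <= alpha) (mA : measurable_fun [set: E] A)
  (mg : measurable_fun [set: R] g) (mb : measurable_fun [set: R] b).
Hypothesis dim : p * q / (q - p + 1) < n.+1%:R - d%:R.
Hypothesis H1 : condition_H1 p q m m1 A g b.
Hypotheses (uLi : Linfty_loc d rho u) (uW : W1p_loc d rho p (fun=> 1) u).
Hypothesis td : trace_data d rho p u G T.
Hypothesis eqn : forall phi H S, weak_test d rho p alpha phi ->
  weak_grad Om phi H -> is_trace d rho p phi H S ->
  weak_identity d rho alpha beta A g b u G T phi H S.

Lemma Omega_enorm'_gt0 x : Om x -> 0 < enorm' d x.
Proof. by case=> x0 _; apply: enorm'_gt0; [exact: ltnW|rewrite gt_eqF]. Qed.

Lemma mass_outside_finite M j : 1 <= j ->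
  (0 <= \int[mu]_(x in Om `&` [set x : E | (1 < tau d M j x)%R]) (`|u x| `^ p)%:E < +oo)%E.
Proof.
move=> j1; apply/andP; split.
  by apply: integral_ge0 => x _; rewrite lee_fin powR_ge0.
have [] := @uW (Om `&` [set x : E | 1 < tau d M j x]) _ _ _.
- by apply: openI; [exact: open_Omega|exact: open_tau_gt1].
- by move=> x [].
- by apply: (@tau_gt1_off_Gamma R n d M j) => x [].
case=> _ + _; apply: le_lt_trans; rewrite le_eqVlt; apply/orP; left; apply/eqP.
by apply: eq_integral => x _; rewrite mulr1.
Qed.

(** Along a diagonal sequence both nonnegative terms on the left of
    [energy_estimate] tend to 0 while the cutoffs tend to 1. *)
Lemma solution_vanishes :
  (\forall x \ae mu, Om x -> u x = 0 /\ G x = 0) /\ surface_ae0 d rho T.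
Proof.
have [a a01 HP] := exists_exponent p1 pq dim.
set P := p * _ / _ in HP.
have dn' := ltnW dn.
have [m_u mG [mT _]] := td.
have r0 : 0 < q - p + 1 by rewrite (_ : _ + 1 = q - (p - 1)) ?subr_gt0//; ring.
have q0 : 0 < q by apply: lt_trans pq; rewrite subr_gt0.
have kk : (n.+1 - d)%N%:R = n.+1%:R - d%:R :> R by rewrite natrB// ltnW// ltnS ltnW.
pose e : R := (n.+1 - d)%N%:R / 2 - 2^-1 * P.
have e0 : 0 < e by rewrite /e kk mulrC -mulrBr mulr_gt0// subr_gt0.
(* The convergence condition of [integral_shell_density] for c = P/2. *)
pose M := (Num.trunc (d%:R / e)).+1.
have HM : d%:R <= M%:R * e.
  by rewrite -ler_pdivrMr// ltW// Num.Theory.truncnS_gt.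
pose s := (Num.trunc (Num.max P p)).+1.
have sP : Num.max P p <= s%:R by rewrite ltW// Num.Theory.truncnS_gt.
have Ps : P <= s%:R by apply: le_trans sP; rewrite le_max lexx.
have ps : p <= s%:R by apply: le_trans sP; rewrite le_max lexx orbT.
have [C C0 HC] := energy_estimate dn' p1 pq m0 (ltW m10) alpha0 mA mg H1 uLi td eqn
  a01 Ps ps M.
pose h := odd_power a.
have bh t : m1 * `|t| `^ (p - 1) * `|h t| <= b t * h t.
  rewrite [X in _ <= _ * X](odd_power_sg a) -/h mulrCA [leLHS]mulrC ler_wpM2l//.
  exact: (H1.2 t).2.
have mh : measurable_fun [set: R] h.
  apply: continuous_measurable_fun => t; apply: differentiable_continuous.
  by apply/derivable1_diffP; have [] := is_derive_odd_power a t.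
have mz j k : measurable_fun [set: E] (fun x => cutoff d M j k x ^+ s).
  exact: (Ck1_measurable (C1_gradW (@C1_grad_cutoff_pow R n d M j k s))).
have z0 j k (x : E) : 0 <= cutoff d M j k x ^+ s.
  by have [_ _ /andP[c0 _]] := cutoff_bounds d M j k x; exact: exprn_ge0.
pose Q x := energy p q m u G a x.
have Q0 x : 0 <= Q x := energy_ge0 p q u G m0 a01 x.
pose F1 j k (x : E) := Q x * cutoff d M j k x ^+ s * weight alpha x.
pose F2 j k (x : E) := b (T x) * (h (T x) * cutoff d M j k x ^+ s) * weight beta x.
have F1_ge0 j k x : 0 <= F1 j k x.
  exact: mulr_ge0 (mulr_ge0 (Q0 x) (z0 j k x)) (ltW (weight_gt0 _ _)).
have F2_ge0 j k x : 0 <= F2 j k x.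
  rewrite /F2 mulrA; apply: mulr_ge0 (ltW (weight_gt0 _ _)); apply: mulr_ge0 (z0 j k x).
  apply: le_trans (bh (T x)); exact: mulr_ge0 (mulr_ge0 (ltW m10) (powR_ge0 _ _)) _.
pose I1 j k := (\int[mu]_(x in Om) (F1 j k x)%:E)%E.
pose I2 j k := surface_integral d rho (EFin \o F2 j k).
have I1_ge0 j k : (0 <= I1 j k)%E by apply: integral_ge0 => x _; rewrite lee_fin.
have I2_ge0 j k : (0 <= I2 j k)%E.
  by apply: surface_integral_ge0 => // x _; rewrite /= lee_fin.
pose D : R := n.+1%:R * 8.
have [|||||||j [k [Hj Hk cv]]] := @diagonal_sequence R (fun j k => I1 j k + I2 j k)%E
  (fun j => \int[mu]_x (shell_density d M j (2^-1 * P) x)%:E)%E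
  (fun j => \int[mu]_(x in Om `&` [set x : E | (1 < tau d M j x)%R]) (`|u x| `^ p)%:E)%E
  C ((2 * 2 `^ 2^-1) ^+ (n.+1 - d) * pi ^+ d) D e p C0.
- by rewrite mulr_ge0// exprn_ge0// ?mulr_ge0 ?powR_ge0 ?pi_ge0.
- by rewrite mulr_gt0.
- exact: e0.
- exact: ltW.
- move=> j j1.
  have := @integral_shell_density R d M j (lt_le_trans ltr01 j1) (n.+1 - d) n.+1 (2^-1 * P).
  rewrite subnK ?(leq_trans dn')// => /(_ erefl HM) /le_trans; apply.
  by rewrite lee_fin /e opprB mulrA [leRHS]mulrAC mulrA.
- by move=> j j1; exact: mass_outside_finite.
- move=> j k j1 k0; rewrite adde_ge0//=.
  by have := HC j k j1 k0; rewrite mulrA.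
have cv1 : (I1 (j N) (k N) @[N --> \oo] --> 0)%E.
  by apply: cvge0_le cv => N; rewrite I1_ge0/= leeDl.
have cv2 : (I2 (j N) (k N) @[N --> \oo] --> 0)%E.
  by apply: cvge0_le cv => N; rewrite I2_ge0/= leeDr.
split.
  have : \forall x \ae mu, Om x -> Q x * weight alpha x = 0.
    apply: (fatou_ae0 (F := fun N => F1 (j N) (k N))) => //.
    - exact: measurable_Omega.
    - move=> N; apply: measurable_funM; last by apply: measurable_funTS; exact: measurable_weight.
      by apply: measurable_funM; [exact: measurable_energy td a|exact: measurable_funTS].
    - apply: aeW => x Ox; move: (cutoff_eventually1 M Hj Hk (Omega_enorm'_gt0 Ox)).
      by apply: filterS => N c1; rewrite /F1 c1 expr1n mulr1.
  apply: filterS => x Hx Ox; move/eqP: (Hx Ox).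
  rewrite mulf_eq0 [X in _ || X]gt_eqF ?weight_gt0// orbF /Q /energy.
  have h'0 := odd_power'_gt0 a01 (u x).
  have t1 : 0 <= m / 2 * odd_power' a (u x) * enorm (G x) `^ p.
    by apply: mulr_ge0 (powR_ge0 _ _); apply: mulr_ge0 (ltW h'0); rewrite divr_ge0// ltW.
  have t2 : 0 <= 2^-1 * `|u x| `^ q * `|odd_power a (u x)|.
    by apply: mulr_ge0 => //; exact: mulr_ge0 _ (powR_ge0 _ _).
  rewrite paddr_eq0// => /andP[/eqP E1 /eqP E2]; split.
    move/eqP: E2; rewrite !mulf_eq0 invr_eq0 pnatr_eq0/= powR_eq0 !normr_eq0.
    by case/orP => [/andP[/eqP]//|/eqP/odd_power_eq0].
  move/eqP: E1; rewrite !mulf_eq0 (gt_eqF m0) (gt_eqF h'0) invr_eq0 pnatr_eq0/= powR_eq0.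
  by move=> /andP[/eqP G0 _]; exact: enorm_eq0.
have mF2 N : measurable_fun bd (F2 (j N) (k N)).
  apply: (measurable_boundary_integrand beta mb td).
  by apply: measurable_funM; [exact: (measurableT_comp mh)|exact: measurable_funTS].
have [||||H3 H4] := @surface_fatou_ae0 R n d rho dn (fun N => F2 (j N) (k N))
  (fun x => b (T x) * h (T x) * weight beta x).
- exact: mF2.
- by move=> N x _; exact: F2_ge0.
- exact: cv2.
- move=> x _ x0; move: (cutoff_eventually1 M Hj Hk x0).
  by apply: filterS => N c1; rewrite /F2 c1 expr1n mulr1.
have key (x : E) : b (T x) * h (T x) * weight beta x = 0 -> T x = 0.
  move/eqP; rewrite mulf_eq0 [X in _ || X]gt_eqF ?weight_gt0// orbF => /eqP bh0.
  have := bh (T x); rewrite bh0 => le0; apply/eqP/negPn/negP => T0.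
  have : 0 < m1 * `|T x| `^ (p - 1) * `|h (T x)|.
    apply: mulr_gt0; first by apply: mulr_gt0 => //; apply: powR_gt0; rewrite normr_gt0.
    by rewrite normr_gt0; apply: contra_neq T0; exact: odd_power_eq0.
  by move=> /lt_le_trans /(_ le0); rewrite ltxx.
split; first by apply: filterS H3 => y Hy yf; exact/key/Hy.
by move=> r rE; apply: filterS (H4 r rE) => y Hy yf; exact/key/Hy.
Qed.

End vanishing.

(** * Vanishing of g(0) and b(0), and removability *)

(** For weak identities in which the integrand is a constant multiple of a bump. *)
Lemma scaled_integral_eq0 (R : realType) (n : nat) (D U : set 'rV[R]_n) (f : 'rV[R]_n -> R)
    (c : R) x :
  measurable D -> measurable_fun D f -> (forall y, D y -> 0 <= f y) ->
  open U -> U x -> U `<=` D -> (forall y, U y -> 0 < f y) ->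
  (\int[leb R n]_(y in D) (c * f y)%:E = 0)%E -> c = 0.
Proof.
move=> mD mf f0 oU Ux UD fU I0; apply/eqP/negPn/negP => c0.
have [I|I] : (\int[leb R n]_(y in D) (`|c| * f y)%:E = 0)%E \/ False.
  left; case: (leP 0 c) => [cp|cn]; first by rewrite (ger0_norm cp).
  rewrite (ltr0_norm cn) -[LHS]oppeK -integral_ge0N; last first.
    by move=> y Dy; rewrite lee_fin mulr_ge0 ?f0// oppr_ge0 ltW.
  by under eq_integral do rewrite -EFinN mulNr opprK; rewrite I0 oppe0.
- have : \forall y \ae leb R n, D y -> `|c| * f y = 0.
    apply: (fatou_ae0 (F := fun _ y => `|c| * f y)) => //.
    + by move=> _; exact: measurable_funM.
    + by move=> _ y Dy; rewrite mulr_ge0// f0.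
    + by rewrite I; exact: cvg_cst.
    + by apply: aeW => y Dy; exact: nearW.
  case=> N [mN N0 HN]; have := leb_open_gt0 oU Ux; rewrite ltNge => /negP; apply.
  rewrite -[leRHS]N0; apply: le_measure; rewrite ?inE//; first exact: open_rV_measurable.
  move=> y Uy; apply: HN => /= H; have := fU _ Uy.
  move/eqP: (H (UD _ Uy)); rewrite mulf_eq0 normr_eq0 (negPf c0)/= => /eqP ->.
  by rewrite ltxx.
- by [].
Qed.

Section bumps.
Variables (R : realType) (n d : nat) (c : R) (k : 'I_n.+1).
Hypothesis c0 : 0 < c.
Local Notation E := 'rV[R]_n.+1.
Implicit Types x : E.

(** Equal to c^2/4 - |x - c e_k|^2. *)
Definition ball_gap x : R := - (3 / 4 * c ^+ 2) + 2 * c * x ord0 k - \sum_i x ord0 i ^+ 2.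
Definition bump x : R := sqp (ball_gap x).

Lemma C1_grad_ball_gap : C1_grad ball_gap
  (fun i x => 2 * c * (i == k)%:R - 2 * x ord0 i).
Proof.
have H1 := C1_gradM (C1_grad_cst n.+1 (2 * c)) (@C1_grad_coord R n.+1 k).
have H2 := C1_gradM (C1_grad_cst n.+1 (-1 : R)) (@C1_grad_sumsq R n.+1 predT).
have := C1_gradD (C1_gradD (C1_grad_cst n.+1 (- (3 / 4 * c ^+ 2))) H1) H2.
congr C1_grad.
  by apply/funext => x; rewrite /ball_gap; ring.
by apply/funext => i; apply/funext => x /=; ring.
Qed.

Lemma C1_grad_bump : C1_grad bump
  (fun i x => 2 * Num.max 0 (ball_gap x) * (2 * c * (i == k)%:R - 2 * x ord0 i)).
Proof.
apply: (C1_grad_comp (h' := fun t => 2 * Num.max 0 t)) C1_grad_ball_gap.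
  exact: is_derive_sqp.
by move=> t; apply: cvgM; [exact: cvg_cst|exact: continuous_maxr0].
Qed.

Lemma bump_ge0 x : 0 <= bump x. Proof. exact: sqr_ge0. Qed.

Lemma bump_gt0 x : 0 < ball_gap x -> 0 < bump x.
Proof. by move=> g0; rewrite /bump /sqp max_r ?exprn_gt0// ltW. Qed.

Lemma bump_out x : ball_gap x <= 0 -> bump x = 0 /\ grad bump x = 0.
Proof.
move=> g0; rewrite /bump /sqp (max_l g0) expr0n; split => //.
rewrite (C1_gradE x C1_grad_bump); apply/rowP => i; rewrite !mxE (max_l g0); ring.
Qed.

(** The ball of centre c e_k and radius c/2 stays away from the hyperplane x_k = 0,
    hence from Gamma if k >= d, and inside the ball of radius 3c/2. *)
Lemma ball_gap_bounds x : 0 < ball_gap x -> c / 2 < x ord0 k < 3 / 2 * c /\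
  enorm x < 3 / 2 * c.
Proof.
rewrite /ball_gap => g0.
have xk : x ord0 k ^+ 2 <= \sum_i x ord0 i ^+ 2.
  exact: (@ler_sumsq R n.+1 predT x k).
set S := \sum_i _ in g0 xk *; set t := x ord0 k in g0 xk *.
have prod : (t - c / 2) * (t - 3 / 2 * c) < 0.
  rewrite (_ : _ * _ = t ^+ 2 - 2 * c * t + 3 / 4 * c ^+ 2); last by field.
  by move: xk g0; lra.
have t1 : t < 3 / 2 * c.
  rewrite ltNge; apply/negP => h; move: prod; rewrite ltNge mulr_ge0 ?subr_ge0//.
  by move: c0 h; lra.
have t2 : c / 2 < t.
  rewrite ltNge; apply/negP => h; move: prod; rewrite ltNge mulr_le0 ?subr_le0//.
  exact: ltW.
split; first by rewrite t2.
rewrite -(@ltr_pXn2r _ 2)// ?nnegrE ?enorm_ge0 ?mulr_ge0 ?(ltW c0)// sqr_enorm -/S.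
rewrite (_ : (3 / 2 * c) ^+ 2 = 2 * (c * (3 / 2 * c)) - 3 / 4 * c ^+ 2); last by field.
by have := mulr_gt0 c0 (_ : 0 < 3 / 2 * c - t); rewrite subr_gt0 mulrBr => /(_ t1); move: g0; lra.
Qed.

Lemma open_ball_gap : open [set x | 0 < ball_gap x].
Proof.
rewrite (_ : mkset _ = ball_gap @^-1` [set t | 0 < t])//.
apply: open_comp; last exact: open_gt.
by move=> x _; exact: (Ck1_continuous (C1_gradW C1_grad_ball_gap)).
Qed.

Lemma ball_gap_center : 0 < ball_gap (c *: delta_mx ord0 k).
Proof.
rewrite /ball_gap (bigD1 k)//= big1 => [|i ik]; rewrite !mxE ?eqxx ?(negPf ik) ?andbF.
  by rewrite mulr1 addr0; have := mulr_gt0 c0 c0; nra.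
by rewrite mulr0 expr0n.
Qed.

Lemma bounded_ball_gap : bounded_set [set x | 0 < ball_gap x].
Proof.
have [N [NR HN]] := @cube_bounded R n.+1 (3 / 2 * c).
exists N; split => // r Nr x /= xg; apply: (HN r Nr x) => i.
by have [_ /ltW] := ball_gap_bounds xg; apply: le_trans; exact: coord_le_enorm.
Qed.

Lemma ball_gap_off_Gamma : (d <= k)%N -> off_Gamma d [set x | 0 < ball_gap x].
Proof.
move=> dk; apply/seteqP; split => // x [Vx Gx].
have cl : closed [set x : E | c / 2 <= x ord0 k].
  rewrite (_ : mkset _ = (fun x : E => x ord0 k) @^-1` [set t | c / 2 <= t])//.
  by apply: closed_comp; [move=> y _; exact: continuous_coord|exact: closed_ge].
have sub : [set x | 0 < ball_gap x] `<=` [set x : E | c / 2 <= x ord0 k].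
  by move=> y /ball_gap_bounds[/andP[/ltW]].
have /= := closure_subset sub Vx; rewrite -(closure_id _).1//=.
by rewrite Gx// leNgt divr_gt0.
Qed.

End bumps.

Section trivial_solution.
Variables (R : realType) (n d : nat) (rho : \bar R) (p q alpha beta m m1 : R).
Local Notation E := 'rV[R]_n.+1.
Local Notation Om := (@Omega R n d rho).
Local Notation bd := (@bdOmega R n d rho).
Local Notation mu := (leb R n.+1).
Variables (A : E -> E) (g b : R -> R) (u : E -> R) (G : E -> E) (T : E -> R).
Hypotheses (dn : (d < n)%N) (rho0 : (0 < rho)%E) (p1 : 1 < p) (alpha0 : 0 <= alpha).
Hypotheses (mA : measurable_fun [set: E] A)
  (mg : measurable_fun [set: R] g) (mb : measurable_fun [set: R] b).
Hypothesis H1 : condition_H1 p q m m1 A g b.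
Hypothesis td : trace_data d rho p u G T.
Hypothesis eqn : forall phi H S, weak_test d rho p alpha phi ->
  weak_grad Om phi H -> is_trace d rho p phi H S ->
  weak_identity d rho alpha beta A g b u G T phi H S.
Hypothesis uG0 : \forall x \ae mu, Om x -> u x = 0 /\ G x = 0.
Hypothesis T0 : surface_ae0 d rho T.
Let dn' : (d <= n)%N := ltnW dn.

Lemma field0 : A 0 = 0.
Proof.
apply: enorm_eq0; apply/eqP; rewrite eq_le enorm_ge0 andbT.
have [_] := H1.1 0; rewrite enorm0 powR0 ?mulr0//.
by rewrite subr_eq0 gt_eqF.
Qed.

Lemma surface_integral_ae (f h : E -> R) : measurable_fun bd f -> measurable_fun bd h ->
  (forall x, T x = 0 -> f x = h x) ->
  surface_integral d rho (EFin \o f) = surface_integral d rho (EFin \o h).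
Proof.
move=> mf mh fh; have [F0 C0] := T0; congr (_ + _)%E.
  apply: ae_eq_integral.
  - exact: (@measurable_flat R n d rho).
  - apply/measurable_EFinP; exact: measurable_flat_bd.
  - apply/measurable_EFinP; exact: measurable_flat_bd.
  - by apply: filterS F0 => y Hy yf /=; rewrite (fh _ (Hy yf)).
case rhoE : {1 2}rho => [r||]//.
have mj : measurable_fun (@cap R n d r) (@jac R n d r).
  by apply: measurable_funTS; exact: measurable_jac.
apply: ae_eq_integral.
- exact: measurable_cap.
- apply: emeasurable_funM; apply/measurable_EFinP => //.
  exact: (measurable_capmap_bd dn' rhoE mf).
- apply: emeasurable_funM; apply/measurable_EFinP => //.
  exact: (measurable_capmap_bd dn' rhoE mh).
- by apply: filterS (C0 r rhoE) => y Hy yc /=; rewrite (fh _ (Hy yc)).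
Qed.

(** With u, its gradient and its trace equal to 0 almost everywhere, and A(0) = 0
    by the growth condition, only g(0) and b(0) are left of the equation. *)
Lemma weak_identity_trivial (phi : E -> R) (H : E -> E) (S : E -> R) : measurable_fun Om phi ->
  (forall i, measurable_fun Om (fun x => H x ord0 i)) -> measurable_fun bd S ->
  weak_identity d rho alpha beta A g b u G T phi H S <->
  (\int[mu]_(x in Om) (g 0 * (phi x * weight alpha x))%:E +
   surface_integral d rho (fun x => (b 0 * (S x * weight beta x))%:E) = 0)%E.
Proof.
move=> mphi mH mS; rewrite /weak_identity.
have -> : (\int[mu]_(x in Om) ((dot (A (G x)) (H x) + g (u x) * phi x) * weight alpha x)%:E =
    \int[mu]_(x in Om) (g 0 * (phi x * weight alpha x))%:E)%E.
  apply: ae_eq_integral.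
  - exact: measurable_Omega.
  - by apply/measurable_EFinP; exact: (measurable_integrand alpha mA mg td).
  - apply/measurable_EFinP; apply: measurable_funM => //; apply: measurable_funM => //.
    by apply: measurable_funTS; exact: measurable_weight.
  - apply: filterS uG0 => x Hx Ox; have [-> ->] := Hx Ox.
    by rewrite field0 dot0l add0r mulrA.
have -> // : surface_integral d rho (fun x => (b (T x) * S x * weight beta x)%:E) =
    surface_integral d rho (fun x => (b 0 * (S x * weight beta x))%:E).
apply: (surface_integral_ae (f := fun x => b (T x) * S x * weight beta x)
  (h := fun x => b 0 * (S x * weight beta x))).
- exact: (measurable_boundary_integrand beta mb td).
- apply: measurable_funM => //; apply: measurable_funM => //.
  by apply: measurable_funTS; exact: measurable_weight.
- by move=> x ->; rewrite mulrA.
Qed.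

Lemma surface_integral0 : (surface_integral d rho (fun _ : E => 0) = 0)%E.
Proof.
rewrite /surface_integral integral0 add0e.
by case: {1}rho => // r; apply: integral0_eq => y _; rewrite mul0e.
Qed.

(** The constant sequence approximates phi. *)
Lemma trace_data_Ck1 (phi : E -> R) : Ck 1 phi -> trace_data d rho p phi (grad phi) phi.
Proof.
move=> c1; have p0 : p != 0 by rewrite gt_eqF// (lt_trans ltr01).
split; first by apply: measurable_funTS; exact: Ck1_measurable.
  move=> i; apply: measurable_funTS; rewrite (_ : (fun _ => _) = partial i phi).
    exact: Ck1_measurable_grad.
  by apply/funext => x; rewrite mxE.
split; first by apply: measurable_funTS; exact: Ck1_measurable.
move=> V _ _ _; exists (fun=> phi); split => //.
  under eq_fun do under eq_integral do
    rewrite !subrr enorm0 normr0 powR0// addr0.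
  by under eq_fun do rewrite integral0; exact: cvg_cst.
under eq_fun do under [fun x : E => _]eq_fun do rewrite subrr normr0 powR0// mul0r.
by rewrite surface_integral0; exact: cvg_cst.
Qed.

Lemma exists_radius : exists2 c : R, 0 < c & ((3 / 2 * c)%:E <= rho)%E.
Proof.
move: rho0; case: rho => [r r0||]//; last by move=> _; exists 1; rewrite ?leey.
exists (2 / 3 * r); first by rewrite mulr_gt0 ?divr_gt0.
by rewrite lee_fin le_eqVlt; apply/orP; left; apply/eqP; field.
Qed.

Lemma enorm'_le_enorm (x : E) : enorm' d x <= enorm x.
Proof.
rewrite -(@ler_pXn2r _ 2)// ?nnegrE ?enorm_ge0 ?enorm'_ge0// sqr_enorm' sqr_enorm.
rewrite [leLHS]big_mkcond; apply: ler_sum => i _; case: ifP => // _; exact: sqr_ge0.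
Qed.

Section one_bump.
Variables (c : R) (k : 'I_n.+1).
Hypotheses (c0 : 0 < c) (crho : ((3 / 2 * c)%:E <= rho)%E) (dk : (d <= k)%N).
Let phi : E -> R := bump c k.

Lemma bump_enorm' x : 0 < ball_gap c k x -> ((enorm' d x)%:E < rho)%E.
Proof.
move=> /(ball_gap_bounds c0)[_ xc]; apply: lt_le_trans crho; rewrite lte_fin.
exact: le_lt_trans (enorm'_le_enorm x) xc.
Qed.

Lemma bump_identity :
  (\int[mu]_(x in Om) (g 0 * (phi x * weight alpha x))%:E +
   surface_integral d rho (fun x => (b 0 * (phi x * weight beta x))%:E) = 0)%E.
Proof.
have c1 := C1_gradW (C1_grad_bump c k).
have td' := trace_data_Ck1 c1; have [mphi mH [mS trS]] := td'.
apply/(weak_identity_trivial mphi mH mS); apply: eqn; last exact: conj.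
  have bV := bounded_ball_gap k c0.
  apply: (admissible dn' p1 alpha0 td' (@open_ball_gap R n c k) bV).
  - exact: ball_gap_off_Gamma.
  - by move=> x /negP; rewrite -leNgt => /bump_out.
  - move=> U oU UO _; split; first exact: (measurable_funS (@measurable_Omega R n d rho) UO).
    have [C C_ge0 HC] := Ck1_bounded c1 bV.
    exists C; apply: aeW => x _.
    have [xg|/bump_out[-> _]] := ltP 0 (ball_gap c k x); last by rewrite normr0.
    by have [] := HC x xg.
exact: (weak_grad_of_trace dn' p1 td').
Qed.

End one_bump.

(** A bump centred on the x_N axis has its support inside the domain, so that the
    boundary term drops. *)
Lemma reaction0 : g 0 = 0.
Proof.
have [c c0 crho] := exists_radius.
have gapOm (x : E) : 0 < ball_gap c ord_max x -> Om x.
  move=> xg; split; last exact: (bump_enorm' c0 crho xg).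
  by have [/andP[+ _] _] := ball_gap_bounds c0 xg; apply: lt_trans; rewrite divr_gt0.
have bd0 x : bd x -> bump c ord_max x = 0.
  case=> _ nO; apply: (bump_out _).1; rewrite leNgt; apply/negP => /gapOm; exact: nO.
have := @bump_identity c ord_max c0 dn'.
rewrite (_ : surface_integral _ _ _ = 0%E) ?adde0; last first.
  apply/eqP; rewrite eq_le; apply/andP; split.
    rewrite -surface_integral0.
    apply: (le_surface_integral dn' (f := fun x => b 0 * (bump c ord_max x * weight beta x))
      (g := fun=> 0)) => //.
      apply: measurable_funTS; apply: measurable_funM => //; apply: measurable_funM.
        exact: (Ck1_measurable (C1_gradW (C1_grad_bump c ord_max))).
      exact: measurable_weight.
    by move=> x /bd0 ->; rewrite mul0r mulr0 lexx.
  by apply: surface_integral_ge0 => // x /bd0 ->; rewrite mul0r mulr0.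
apply: (@scaled_integral_eq0 R n.+1 Om [set x : E | 0 < ball_gap c ord_max x] _ _
  (c *: delta_mx ord0 ord_max)).
- exact: measurable_Omega.
- apply: measurable_funTS; apply: measurable_funM; last exact: measurable_weight.
  exact: (Ck1_measurable (C1_gradW (C1_grad_bump c ord_max))).
- by move=> x _; rewrite mulr_ge0 ?bump_ge0// ltW// weight_gt0.
- exact: open_ball_gap.
- exact: ball_gap_center.
- exact: gapOm.
- by move=> x xg; apply: mulr_gt0 (bump_gt0 xg) (weight_gt0 _ _).
Qed.

(** A bump centred on the x_{N-1} axis sits at a flat boundary point; this point is
    not on Gamma since d <= N - 2. The bump does not reach the spherical part, and
    the volume term drops since g(0) = 0. *)
Lemma boundary_term0 : b 0 = 0.
Proof.
have [c c0 crho] := exists_radius.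
have n0 : (0 < n)%N by exact: leq_ltn_trans dn.
have kn : (n.-1 < n)%N by rewrite prednK.
(* The index of x_{N-1}, seen as an index of both R^N and R^(N-1). *)
pose k : 'I_n.+1 := widen_ord (leqnSn n) (Ordinal kn).
have kE : k = lift ord_max (Ordinal kn).
  by apply: ord_inj; rewrite lift_max.
have dk : (d <= k)%N by rewrite /= -ltnS prednK.
have := @bump_identity c k c0 dk.
rewrite reaction0; under eq_integral do rewrite mul0r.
rewrite integral0 add0e /surface_integral.
rewrite [X in (_ + X)%E](_ : _ = 0%E) ?adde0; last first.
  case rhoE : {1}rho => [r||]//; apply: integral0_eq => y yc.
  rewrite -/(capmap d r y) (bump_out _).1 ?mul0r ?mulr0 ?mul0e//.
  rewrite leNgt; apply/negP => /(bump_enorm' c0 crho).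
  by rewrite (enorm'_capmap dn' yc) rhoE ltxx.
pose U := [set y : 'rV[R]_n | 0 < ball_gap c k (snoc y 0)].
apply: (@scaled_integral_eq0 R n (flat d rho) U _ _ (c *: delta_mx ord0 (Ordinal kn))).
- exact: measurable_flat.
- apply: (measurable_flat_bd dn' (f := fun x => bump c k x * weight beta x)).
  apply: measurable_funTS; apply: measurable_funM; last exact: measurable_weight.
  exact: (Ck1_measurable (C1_gradW (C1_grad_bump c k))).
- by move=> y _; rewrite mulr_ge0 ?bump_ge0// ltW// weight_gt0.
- rewrite (_ : U = (fun y : 'rV[R]_n => snoc y 0) @^-1` [set x | 0 < ball_gap c k x])//.
  apply: open_comp; last exact: open_ball_gap.
  by move=> y _; exact: continuous_snocl.
- rewrite /U/= (_ : snoc _ _ = c *: delta_mx ord0 k); first exact: ball_gap_center.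
  apply/rowP => i; rewrite kE; case: (snocP i) => [[j ->]|->].
    by rewrite snoc_lift !mxE (inj_eq lift_inj).
  by rewrite snoc_max !mxE eq_sym (negPf (neq_lift _ _)) mulr0.
- move=> y /(bump_enorm' c0 crho); rewrite (enorm'_snoc dn') expr0n/= addr0.
  by rewrite sqrtr_sqr ger0_norm ?enorm'_ge0.
- by move=> y yg; apply: mulr_gt0 (bump_gt0 yg) (weight_gt0 _ _).
Qed.

(** All the norms in question are 0, and so is each term of the equation. *)
Lemma vanishing_removable : removable d rho p alpha beta A g b u.
Proof.
have mOm := @measurable_Omega R n d rho.
have [m_u mG [mT trT]] := td.
have p0 : p != 0 by rewrite gt_eqF// (lt_trans ltr01).
have wg := weak_grad_of_trace dn' p1 td.
have Lp0 (F : E -> R) : measurable_fun Om F -> (\forall x \ae mu, Om x -> F x = 0) ->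
    Lp p (weight alpha) Om F.
  move=> mF F0; split => //; rewrite (_ : (\int[mu]_(x in Om) _)%E = 0%E) ?ltry//.
  rewrite -[RHS](integral0 mu Om); apply: ae_eq_integral => //.
    apply/measurable_EFinP; apply: measurable_funM.
      by apply: measurable_powRD; exact: measurable_normD.
    by apply: measurable_funTS; exact: measurable_weight.
  by apply: filterS F0 => x Hx Ox; rewrite Hx// normr0 powR0// mul0r.
split.
- split; first by apply: Lp0 => //; apply: filterS uG0 => x Hx /Hx[].
  exists G; split => //; apply: Lp0; first exact: measurable_enormD.
  by apply: filterS uG0 => x Hx /Hx[_ ->]; exact: enorm0.
- by split => //; exists 0; apply: filterS uG0 => x Hx /Hx[-> _]; rewrite normr0.
- exists G, T; split => // phi H S [[[mphi _] _] _] [_ lH _] [mS _].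
  apply/weak_identity_trivial => //; first by move=> i; have [] := lH i.
  rewrite reaction0 boundary_term0.
  under eq_integral do rewrite mul0r.
  rewrite integral0 add0e -[RHS]surface_integral0; congr surface_integral.
  by apply/funext => x; rewrite mul0r.
Qed.

End trivial_solution.

Theorem theorem1p1 (R : realType) (n d : nat) (rho : \bar R)
    (p q alpha beta mu mu1 : R) (A : 'rV[R]_n.+1 -> 'rV[R]_n.+1) (g b : R -> R)
    (u : 'rV[R]_n.+1 -> R) :
  let N := n.+1 in
  (3 <= N)%N -> (1 <= d <= N - 2)%N -> (0 < rho)%E ->
  measurable_fun [set: 'rV[R]_n.+1] A ->
  measurable_fun [set: R] g -> measurable_fun [set: R] b ->
  locally_bounded g -> locally_bounded b ->
  1 < p < N%:R ->
  0 <= alpha < N%:R -> 0 <= beta < N%:R -> p - 1 <= beta - alpha ->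
  0 < q - p + 1 -> 0 < mu -> 0 <= mu1 ->
  condition_H1 p q mu mu1 A g b -> condition_H2 A ->
  p - 1 < beta -> 0 < mu1 ->
  Num.max (p * q / (q - p + 1)) (p ^+ 2 / (p - 1)) < N%:R - d%:R ->
  W1p_loc d rho p (fun=> 1) u -> Linfty_loc d rho u ->
  weak_solution d rho p alpha beta A g b u ->
  assumption_A1 d rho u ->
  removable d rho p alpha beta A g b u.
Proof.
move=> N N3 /andP[_ dN] rho0 mA mg mb _ _ /andP[p1 _] /andP[alpha0 _] _ _ pq m0 _ H1 _ _ m10.
rewrite gt_max => /andP[dim _] uW uLi [_ _ [G [T [wg trT eqn]]]] _.
have dn : (d < n)%N.
  have n0 : (0 < n)%N by move: N3; rewrite /N; case: (n).
  by move: dN; rewrite /N subSS subn1 -ltnS prednK.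
have pq' : p - 1 < q by rewrite -subr_gt0 opprB addrCA addrC.
have td : trace_data d rho p u G T.
  have [[m_u _] lG _] := wg; split => // i; by have [] := lG i.
have [uG0 T0] := solution_vanishes dn p1 pq' m0 m10 alpha0 mA mg mb dim H1 uLi uW td eqn.
exact: (vanishing_removable dn rho0 p1 alpha0 mA mg mb H1 td eqn uG0 T0).
Qed.
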